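(* Let $m$ be a positive integer, $p\in(1,\infty]$, and let $E$ be a closed subset of $\mathbb{R}$ containing at least $m+1$ points. A function $f:E\to\mathbb{R}$ can be extended to a function $F\in W^m_p(\mathbb{R})$ (that is, there is $F\in W^m_p(\mathbb{R})$ with $F|_E=f$) if and only if $\mathcal{W}_{m,p}(f:E)<\infty$. Furthermore, $$\|f\|_{W^m_p(\mathbb{R})|_E}\sim \mathcal{W}_{m,p}(f:E),$$ where the constants in this equivalence depend only on $m$; i.e., there is a constant $C\ge 1$ depending only on $m$ such that $C^{-1}\,\mathcal{W}_{m,p}(f:E)\le \|f\|_{W^m_p(\mathbb{R})|_E}\le C\,\mathcal{W}_{m,p}(f:E)$.
   Context: Sobolev spaces. $L^m_p(\mathbb{R})$ is the space of all functions $F:\mathbb{R}\to\mathbb{R}$ such that $F^{(m-1)}$ is absolutely continuous on $\mathbb{R}$ and the weak derivative $F^{(m)}$ belongs to $L_p(\mathbb{R})$. $W^m_p(\mathbb{R})$ is the space of all $F\in L^m_p(\mathbb{R})$ whose derivatives of all orders $0,\dots,m$ belong to $L_p(\mathbb{R})$, normed by $\|F\|_{W^m_p(\mathbb{R})}=\sum_{k=0}^m\|F^{(k)}\|_{L_p(\mathbb{R})}$. The trace norm is $\|f\|_{W^m_p(\mathbb{R})|_E}=\inf\{\|F\|_{W^m_p(\mathbb{R})}: F\in W^m_p(\mathbb{R}),\ F|_E=f\}$. Divided differences. For distinct points $x_0,\dots,x_k$, $\Delta^kf[x_0,\dots,x_k]=\sum_{i=0}^k f(x_i)\big/\prod_{j\ne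 i}(x_i-x_j)$ (so $\Delta^0f[x_0]=f(x_0)$). For a finite strictly increasing sequence $\{x_0,\dots,x_n\}$ one sets $x_i=+\infty$ for $i>n$. For $1<p<\infty$, $$\mathcal{W}_{m,p}(f:E)=\sup_{\{x_0,\dots,x_n\}\subset E}\left(\sum_{k=0}^m\sum_{i=0}^{n-k}\min\{1,x_{i+m}-x_i\}\,|\Delta^kf[x_i,\dots,x_{i+k}]|^p\right)^{1/p},$$ where the supremum is over all integers $n\ge m$ and all strictly increasing sequences $\{x_0,\dots,x_n\}\subset E$ of $n+1$ elements. For $p=\infty$, $$\mathcal{W}_{m,\infty}(f:E)=\sup|\Delta^kf[y_0,\dots,y_k]|,$$ where the supremum is over all $k=0,\dots,m$ and all strictly increasing sequences $\{y_0,\dots,y_k\}\subset E$. *)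

(* Defs.v *)
From HB Require Import structures.
From mathcomp Require Import all_boot all_order all_algebra.
From mathcomp Require Import all_classical all_reals all_analysis.

Set Implicit Arguments.
Unset Strict Implicit.
Unset Printing Implicit Defensive.

Import Order.TTheory GRing.Theory Num.Theory.
Import numFieldNormedType.Exports.

Local Open Scope classical_set_scope.
Local Open Scope ring_scope.

Definition absolutely_continuous (R : realType) (h : R -> R) : Prop :=
  forall e : R, 0 < e -> exists2 d : R, 0 < d &
    forall (n : nat) (a b : nat -> R),
      (forall i, (i < n)%N -> a i <= b i) ->
      trivIset `I_n (fun i => `]a i, b i[%classic) ->
      \sum_(i < n) (b i - a i) < d ->
      \sum_(i < n) `|h (b i) - h (a i)| < e.

Definition test_function (R : realType) (phi : R -> R) : Prop :=
  (forall (k : nat) (x : R), derivable phi^`(k)%classic x 1) /\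
  (exists M : R, forall x : R, M < `|x| -> phi x = 0).

Definition is_weak_derivative (R : realType) (h g : R -> R) : Prop :=
  [/\ locally_integrable setT h, locally_integrable setT g &
      forall phi : R -> R, test_function phi ->
        \int[lebesgue_measure]_x (h x * phi^`()%classic x) =
        - \int[lebesgue_measure]_x (g x * phi x)].

Definition weakly_derivable (R : realType) (h : R -> R) : Prop :=
  exists g : R -> R, is_weak_derivative h g.

(* A representative of the almost everywhere class of weak derivatives of h;
   it is meaningful only under [weakly_derivable h]. *)
Definition weak_derive (R : realType) (h : R -> R) : R -> R :=
  xget (cst 0) [set g | is_weak_derivative h g].

(* For F in L^m_p(R) (m > 0), the derivatives of order k < m are classical,
   and the one of order m is the weak derivative of the (m-1)-st. *)
Definition sobolev_derive (R : realType) (m : nat) (F : R -> R) (k : nat) :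
    R -> R :=
  if (k < m)%N then F^`(k)%classic else weak_derive F^`(m.-1)%classic.

(* L^m_p(R), for m > 0. *)
Definition homogeneous_sobolev (R : realType) (m : nat) (p : \bar R)
    (F : R -> R) : Prop :=
  [/\ forall k : nat, (k < m.-1)%N -> forall x : R, derivable F^`(k)%classic x 1,
      absolutely_continuous F^`(m.-1)%classic,
      weakly_derivable F^`(m.-1)%classic &
      sobolev_derive m F m \in Lfun lebesgue_measure p].

(* W^m_p(R), for m > 0. *)
Definition sobolev (R : realType) (m : nat) (p : \bar R) (F : R -> R) : Prop :=
  homogeneous_sobolev m p F /\
  forall k : nat, (k <= m)%N ->
    sobolev_derive m F k \in Lfun lebesgue_measure p.

Definition sobolev_norm (R : realType) (m : nat) (p : \bar R) (F : R -> R) :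
    \bar R :=
  (\sum_(k < m.+1)
     'N[ lebesgue_measure ]_p [ EFin \o sobolev_derive m F k ])%E.

(* A function on E is represented by a total function of which only the values
   on E are used. *)
Definition extends (R : realType) (E : set R) (f F : R -> R) : Prop :=
  forall x : R, E x -> F x = f x.

Definition trace_norm (R : realType) (m : nat) (p : \bar R) (E : set R)
    (f : R -> R) : \bar R :=
  ereal_inf [set sobolev_norm m p F | F in
    [set F : R -> R | sobolev m p F /\ extends E f F]].

(* Divided difference of order k on the points y 0, ..., y k. *)
Definition divided_difference (R : realType) (f : R -> R) (k : nat)
    (y : nat -> R) : R :=
  \sum_(i < k.+1) f (y i) / \prod_(j < k.+1 | j != i) (y i - y j).

(* x 0 < ... < x n are points of E; the values of x beyond n are not used. *)
Definition increasing_in (R : realType) (E : set R) (n : nat) (x : nat -> R) :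
    Prop :=
  (forall i j : nat, (i < j <= n)%N -> x i < x j) /\
  (forall i : nat, (i <= n)%N -> E (x i)).

Definition extended_point (R : realType) (n : nat) (x : nat -> R) (i : nat) :
    \bar R :=
  if (i <= n)%N then (x i)%:E else +oo%E.

Definition variation_sum (R : realType) (m : nat) (r : R) (f : R -> R)
    (n : nat) (x : nat -> R) : \bar R :=
  (\sum_(k < m.+1) \sum_(i < (n - k).+1)
     mine 1 (extended_point n x (i + m)%N - extended_point n x i) *
     (`|divided_difference f k (fun j => x (i + j)%N)| `^ r)%:E)%E.

(* The second branch is meant for p = +oo. *)
Definition variation_functional (R : realType) (m : nat) (p : \bar R)
    (E : set R) (f : R -> R) : \bar R :=
  match p with
  | r%:E => ereal_sup [set v | exists n x,
      [/\ (m <= n)%N, increasing_in E n x &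
          v = (variation_sum m r f n x `^ r^-1)%E]]
  | _ => ereal_sup [set v | exists k y,
      [/\ (k <= m)%N, increasing_in E k y &
          v = `|divided_difference f k y|%:E]]
  end.

(* Main.v *)
From HB Require Import structures.
From mathcomp Require Import all_boot all_order all_algebra.
From mathcomp Require Import all_classical all_reals all_analysis.
From mathcomp Require Import measurable_realfun ess_sup_inf.
From mathcomp Require Import ring lra zify.
Require Import Defs.

Set Implicit Arguments.
Unset Strict Implicit.
Unset Printing Implicit Defensive.

Import Order.TTheory GRing.Theory Num.Theory.
Import numFieldNormedType.Exports HBNNSimple.

Local Open Scope classical_set_scope.
Local Open Scope ring_scope.

Local Notation "f ^` ()" := (derive1 f) : ring_scope.
Local Notation "f ^` ( n )" := (derive1n n f) : ring_scope.

(** Necessity rests on averages. A divided difference of order k < m of F is a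
    value of its k-th derivative divided by k! (dd_mean_value), and the one of
    order m is, up to a factor, an increment of the derivative of order m - 1
    divided by the length of the window. Hence each difference on x_i, ...,
    x_(i+k) is at most the average of W, the sum of the |F^(j)| for j <= m, over
    an interval of length at least min(1, x_(i+m) - x_i) inside [x_i, x_(i+m)]
    (dd_average). Raised to the power p by convexity (integral_powR_ge), this
    bounds every term of the variation by the integral of W^p over a window, and
    a point belongs to at most m of the windows of a given order
    (variation_real_le).

    Sufficiency is first proved for a finite set s of more than m points of E,
    with a bound that does not depend on s (finite_extension). The set is padded
    by further knots, at distances between 1 and 2, where the function is
    declared to be 0 (knot_sequence). The extension is a sum of terms c_i psi_i
    cut off by smooth steps, where c_i psi_i is the difference of two
    consecutive Newton interpolants; on an interval between knots its
    derivatives are bounded by the divided differences of the nearby windows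
    (spline_bound). It remains to bound the differences of the padded data by
    the variation of f. A window that contains a padding knot is long, so that
    the recurrence expresses its difference by differences of lower order
    without loss, and finally by differences on windows inside s (impure_dd).
    Those carry the weight 1 in the variation of a suitable subsequence of s,
    either all of s or the points of s that follow closely a padding knot
    (selection_sum, padded_dd_sum).

    The extension from E is a limit along an ultrafilter on the finite subsets
    of E. Since p > 1, a bound in L^p makes the derivatives equi-integrable
    (lp_bounded_equi). The derivatives of order less than m are therefore
    bounded and equicontinuous and converge locally uniformly, and those of
    order m converge weakly in L^1 on bounded intervals, the limit being a
    Radon-Nikodym density (equiintegrable_weak_limit, local_weak_limit). The
    fundamental theorem of calculus passes to the limit and identifies the weak
    limit with the weak derivative (FTC_weak_derivative, sobolev_limit); the
    norms are lower semicontinuous (weak_limit_Lnorm). *)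

(** * Smooth functions *)
Section smooth.
Context {R : realType}.
Implicit Types (f g : R -> R) (n k : nat) (x : R).

Definition Ck n f := forall k, (k < n)%N -> forall x, derivable f^`(k) x 1.

Definition smooth f := forall k x, derivable f^`(k) x 1.

Lemma derivable_is_derive1 f x : derivable f x 1 -> is_derive x 1 f (f^`() x).
Proof. by move=> fx; rewrite derive1E; exact: derivableP. Qed.

Lemma is_derive1E f x (a : R) : is_derive x 1 f a -> f^`() x = a.
Proof. by move=> [_ <-]; rewrite derive1E. Qed.

Lemma CkS n f : Ck n.+1 f <-> (forall x, derivable f x 1) /\ Ck n f^`().
Proof.
split=> [Cf|[f0 Cf] [|k] kn x]; last 2 first.
- exact: f0.
- by rewrite derive1Sn; exact: Cf.
split=> [|k kn x]; first exact: (Cf 0).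
by rewrite -derive1Sn; exact: Cf.
Qed.

Lemma Ck_is_derive n f df : (forall x, is_derive x 1 f (df x)) -> Ck n df ->
  Ck n.+1 f.
Proof.
move=> fdf Cdf; rewrite CkS; split; first by move=> x; case: (fdf x).
by rewrite (_ : f^`() = df)//; apply/funext => x; exact: is_derive1E.
Qed.

Lemma CkW n k f : (k <= n)%N -> Ck n f -> Ck k f.
Proof. by move=> kn Cf i ik; apply: Cf; exact: leq_trans ik kn. Qed.

Lemma Ck_smooth f : smooth f <-> forall n, Ck n f.
Proof. by split=> [sf n k _|Cf k]; [exact: sf|apply: (Cf k.+1)]. Qed.

Lemma Ck0 f : Ck 0 f. Proof. by move=> k; rewrite ltn0. Qed.

Lemma CkD n f g : Ck n f -> Ck n g -> Ck n (fun x => f x + g x).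
Proof.
elim: n f g => [|n IH] f g; first by move=> _ _; exact: Ck0.
move=> /CkS[f1 Cf] /CkS[g1 Cg].
apply: (Ck_is_derive (df := fun x => f^`() x + g^`() x)); last exact: IH.
by move=> x; apply: is_deriveD; exact: derivable_is_derive1.
Qed.

Lemma CkM n f g : Ck n f -> Ck n g -> Ck n (fun x => f x * g x).
Proof.
elim: n f g => [|n IH] f g Cf0 Cg0; first exact: Ck0.
move: (Cf0) (Cg0) => /CkS[f1 Cf] /CkS[g1 Cg].
apply: (Ck_is_derive (df := fun x => f x * g^`() x + g x * f^`() x)).
  by move=> x; apply: is_deriveM; exact: derivable_is_derive1.
have CfW := CkW (leqnSn n) Cf0; have CgW := CkW (leqnSn n) Cg0.
exact: (CkD (IH _ _ CfW Cg) (IH _ _ CgW Cf)).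
Qed.

Lemma Ck_cst n (c : R) : Ck n (fun=> c).
Proof.
elim: n c => [|n IH] c; first exact: Ck0.
by apply: (Ck_is_derive (df := fun=> 0)).
Qed.

Lemma Ck_id n : Ck n (fun x : R => x).
Proof.
case: n => [|n]; first exact: Ck0.
apply: (Ck_is_derive (df := fun=> 1)); exact: Ck_cst.
Qed.

Lemma CkV n f : (forall x, f x != 0) -> Ck n f -> Ck n (fun x => (f x)^-1).
Proof.
move=> f0; elim: n => [|n IH] Cf0; first exact: Ck0.
move: (Cf0) => /CkS[f1 Cf].
apply: (Ck_is_derive (df := fun x => -1 * ((f x)^-1 * (f x)^-1) * f^`() x)).
  move=> x; have := is_deriveV (f0 x) (derivable_is_derive1 (f1 x)).
  by move=> h; apply: is_derive_eq h _; rewrite -exprVn /GRing.scale/= expr2 mulN1r.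
have Ci := IH (CkW (leqnSn n) Cf0).
exact: (CkM (CkM (@Ck_cst n (-1)) (CkM Ci Ci)) Cf).
Qed.

Lemma is_derive_affine f (a b x d : R) : is_derive (a * x + b) 1 f d ->
  is_derive x 1 (fun x => f (a * x + b)) (a * d).
Proof.
move=> fd; have h : is_derive x 1 (fun x => a * x + b) a.
  have h1 : is_derive x 1 (fun x : R => a * x) a.
    have := @is_deriveZ R R^o R^o id a x 1 1 _.
    by rewrite /GRing.scale/= mulr1 => h1; exact: h1.
  by have := is_deriveD h1 (is_derive_cst b x 1); rewrite addr0.
have H := @is_derive1_comp R f (fun x => a * x + b) x d a fd h.
by rewrite [a * d]mulrC; exact: H.
Qed.

Lemma Ck_affine n f (a b : R) : Ck n f -> Ck n (fun x => f (a * x + b)).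
Proof.
elim: n f => [|n IH] f; first by move=> _; exact: Ck0.
move=> /CkS[f1 Cf].
apply: (Ck_is_derive (df := fun x => a * f^`() (a * x + b))).
  by move=> x; apply: is_derive_affine; exact: derivable_is_derive1.
exact: (CkM (@Ck_cst n a) (IH _ Cf)).
Qed.

Lemma smooth_is_derive f k x : smooth f -> is_derive x 1 f^`(k) (f^`(k.+1) x).
Proof. by move=> sf; rewrite derive1nS; apply: derivable_is_derive1. Qed.

Lemma smooth_derive f k : smooth f -> smooth f^`(k).
Proof.
move=> sf i x; rewrite /derive1n -iterD; exact: sf.
Qed.

Lemma smooth_continuous f k : smooth f -> continuous f^`(k).
Proof. by move=> sf x; apply/differentiable_continuous/derivable1_diffP. Qed.

Lemma smoothM f g : smooth f -> smooth g -> smooth (fun x => f x * g x).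
Proof. by move=> /Ck_smooth sf /Ck_smooth sg; apply/Ck_smooth => n; exact: CkM. Qed.

Lemma smooth_cst (c : R) : smooth (fun=> c).
Proof. by apply/Ck_smooth => n; exact: Ck_cst. Qed.

Lemma smoothZ f (c : R) : smooth f -> smooth (fun x => c * f x).
Proof. by move=> sf; apply: (smoothM (f := fun=> c)) => //; exact: smooth_cst. Qed.

Lemma smooth_affine f (a b : R) : smooth f -> smooth (fun x => f (a * x + b)).
Proof. by move=> /Ck_smooth sf; apply/Ck_smooth => n; exact: Ck_affine. Qed.

Lemma smooth_derive1nD f g k x : smooth f -> smooth g ->
  (fun x => f x + g x)^`(k) x = f^`(k) x + g^`(k) x.
Proof.
move=> sf sg; elim: k x => [//|k IH] x.
rewrite derive1nS (funext IH); apply: is_derive1E.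
by apply: is_deriveD; exact: smooth_is_derive.
Qed.

Lemma smooth_derive1nZ f (c : R) k x : smooth f ->
  (fun x => c * f x)^`(k) x = c * f^`(k) x.
Proof.
move=> sf; elim: k x => [//|k IH] x.
rewrite derive1nS (funext IH); apply: is_derive1E.
exact: (is_deriveZ c (smooth_is_derive k x sf)).
Qed.

Lemma derive1n_affine f (a b : R) k x : smooth f ->
  (fun x => f (a * x + b))^`(k) x = a ^+ k * f^`(k) (a * x + b).
Proof.
move=> sf; elim: k x => [|k IH] x; first by rewrite expr0 mul1r.
rewrite derive1nS (funext IH); apply: is_derive1E.
rewrite exprSr -mulrA.
exact: (is_deriveZ (a ^+ k) (is_derive_affine (smooth_is_derive k _ sf))).
Qed.

Lemma derive1n_cst (c : R) k x : (cst c)^`(k.+1) x = 0.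
Proof.
elim: k x => [|k IH] x; first by rewrite derive1n1 derive1_cst.
by rewrite derive1nS (funext IH) derive1_cst.
Qed.

Lemma smooth_sum (I : Type) (r : seq I) (P : pred I) (F : I -> R -> R) :
  (forall i, smooth (F i)) -> smooth (fun x => \sum_(i <- r | P i) F i x).
Proof.
move=> sF; apply/Ck_smooth => n; elim: r => [|i r IH].
  by under eq_fun do rewrite big_nil; exact: Ck_cst.
rewrite (_ : (fun x => _) = (fun x => if P i then F i x + \sum_(j <- r | P j) F j x
    else \sum_(j <- r | P j) F j x)); last by apply/funext => x; rewrite big_cons.
case: (P i); last exact: IH.
by apply: CkD IH; exact: (Ck_smooth _).1.
Qed.

Lemma derive1n_sum (I : Type) (r : seq I) (P : pred I) (F : I -> R -> R) k x :
  (forall i, smooth (F i)) ->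
  (fun x => \sum_(i <- r | P i) F i x)^`(k) x = \sum_(i <- r | P i) (F i)^`(k) x.
Proof.
move=> sF; elim: r => [|i r IH].
  rewrite big_nil (_ : (fun x => _) = cst 0); last first.
    by apply/funext => y; rewrite big_nil.
  by case: k => [//|k]; rewrite derive1n_cst.
rewrite big_cons; case: ifP => Pi; last first.
  by rewrite -IH; congr (derive1n _ _ _); apply/funext => y; rewrite big_cons Pi.
rewrite -IH -smooth_derive1nD//; last exact: smooth_sum.
by congr (derive1n _ _ _); apply/funext => y; rewrite big_cons Pi.
Qed.

Lemma near_eq_derive1n f g k x : (\forall y \near x, f y = g y) ->
  \forall y \near x, f^`(k) y = g^`(k) y.
Proof.
move=> fg; elim: k => [//|k IH]; rewrite !derive1nS.
have /= := near_join IH; apply: filterS => y fgy.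
by rewrite !derive1E; exact: near_eq_derive.
Qed.

End smooth.

(** * A smooth step *)
Section smooth_step.
Context {R : realType}.
Implicit Types (P : {poly R}) (x y : R).

(** A class of functions that contains exp(-1/x), extended by 0, and is closed
    under differentiation. *)
Definition flat_fun P x : R := if 0 < x then P.[x^-1] * expR (- x^-1) else 0.

Lemma expX_bounded n : exists2 C : R, 0 < C &
  forall y, 0 <= y -> y ^+ n * expR (- y) <= C.
Proof.
exists (n`!%:R); first by rewrite ltr0n fact_gt0.
move=> y y0; rewrite expRN ler_pdivrMr ?expR_gt0//.
case: n => [|n]; first by rewrite expr0 mul1r; have := expR_ge1Dx y; lra.
have := expR_ge1Dxn n y0; set c := n.+1`!%:R => h.
have c0 : 0 < c by rewrite ltr0n fact_gt0.
rewrite mulrC -ler_pdivrMr//; apply: le_trans h.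
by rewrite lerDr.
Qed.

Lemma polyexp_bounded P : exists2 C : R, 0 < C &
  forall y, 0 <= y -> `|P.[y] * expR (- y)| <= C.
Proof.
have /choice[C HC] n : exists C : R, 0 < C /\
    forall y, 0 <= y -> y ^+ n * expR (- y) <= C.
  by have [C C0 h] := expX_bounded n; exists C.
exists (1 + \sum_(i < size P) `|P`_i| * C i).
  apply: ltr_pwDl => //; apply: sumr_ge0 => i _; apply: mulr_ge0 => //.
  by apply/ltW; case: (HC i).
move=> y y0; rewrite horner_coef mulr_suml.
apply: le_trans (ler_norm_sum _ _ _) _.
apply: le_trans (_ : \sum_(i < size P) `|P`_i| * C i <= _); last by rewrite lerDr.
apply: ler_sum => i _; rewrite -mulrA normrM; apply: ler_wpM2l => //.
rewrite ger0_norm; first by case: (HC i) => _; apply.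
by apply: mulr_ge0; [exact: exprn_ge0|exact: expR_ge0].
Qed.

Lemma flat_fun_le P : exists2 C : R, 0 < C & forall x, `|flat_fun P x| <= C * `|x|.
Proof.
have [C C0 HC] := polyexp_bounded ('X * P).
exists C => // x; rewrite /flat_fun; case: ifPn => x0; last first.
  by rewrite normr0 mulr_ge0// ltW.
have := HC x^-1 (ltW (_ : 0 < _)); rewrite invr_gt0 => /(_ x0).
rewrite hornerM hornerX -mulrA normrM normfV -ler_pdivlMl ?invr_gt0 ?normr_gt0 ?gt_eqF//.
by rewrite invrK [_ * C]mulrC.
Qed.

(** At 0 the difference quotient is the flat function of 'X * P, which tends to 0. *)
Lemma is_derive_flat_fun P x :
  is_derive x 1 (flat_fun P) (flat_fun ('X^2 * (P - deriv P)) x).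
Proof.
have [x0|x0|->] := ltgtP x 0.
- rewrite [X in is_derive _ _ _ X](_ : _ = 0); last by rewrite /flat_fun ltNge ltW.
  apply: (near_eq_is_derive (f := cst 0)).
  near=> y; rewrite /flat_fun ltNge ifF//; apply/negbTE; rewrite negbK; near: y.
  exact: lt_le_nbhsl.
- rewrite [X in is_derive _ _ _ X](_ : _ = (deriv P).[x^-1] * (- x^-2) * expR (- x^-1) + P.[x^-1] * (expR (- x^-1) * x^-2)); last first.
    by rewrite /flat_fun x0 hornerM hornerD hornerN hornerXn exprVn; ring.
  apply: (near_eq_is_derive (f := fun y => P.[y^-1] * expR (- y^-1))).
    near=> y; rewrite /flat_fun ifT//; near: y; exact: lt_nbhsr.
  have xn0 : x != 0 by rewrite gt_eqF.
  have dV : is_derive x 1 (fun y : R => y^-1) (- x^-2).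
    by have := is_deriveV xn0 (is_derive_id x 1); rewrite /GRing.scale/= mulr1.
  have dN : is_derive x 1 (fun y : R => - y^-1) (x^-2).
    by have := is_deriveN dV; rewrite opprK.
  have dE : is_derive x 1 (fun y : R => expR (- y^-1)) (expR (- x^-1) * x^-2).
    exact: (is_derive1_comp (is_derive_expR _) dN).
  have dP : is_derive x 1 (fun y : R => P.[y^-1]) ((deriv P).[x^-1] * (- x^-2)).
    exact: (is_derive1_comp (is_derive_poly _ _) dV).
  have := is_deriveM dP dE; rewrite /GRing.scale/= => h.
  apply: is_derive_eq h _; ring.
rewrite [X in is_derive _ _ _ X](_ : _ = 0); last by rewrite /flat_fun ltxx.
have [C C0 HC] := flat_fun_le ('X * P).
have cv : h^-1 *: (flat_fun P (h *: 1 + 0) - flat_fun P 0) @[h --> 0^'] --> (0:R).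
  apply/cvgrPdist_le => e e0; near=> h.
  rewrite sub0r normrN {2}/flat_fun ltxx subr0 addr0 /GRing.scale/= mulr1.
  have -> : h^-1 * flat_fun P h = flat_fun ('X * P) h.
    rewrite /flat_fun; case: ifP => _; last by rewrite mulr0.
    by rewrite hornerM hornerX mulrA.
  apply: le_trans (HC h) _; rewrite mulrC -ler_pdivlMr//.
  near: h; apply: dnbhs0_le; exact: divr_gt0.
split; first by apply/cvg_ex; exists 0; exact: cv.
exact: cvg_lim cv.
Unshelve. all: by end_near. Qed.

Lemma Ck_flat_fun n P : Ck n (flat_fun P).
Proof.
elim: n P => [//|n IH] P; apply: (Ck_is_derive (is_derive_flat_fun P)); exact: IH.
Qed.

Definition bump0 := flat_fun 1.

Lemma bump0_gt0 x : 0 < x -> 0 < bump0 x.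
Proof. by move=> x0; rewrite /bump0 /flat_fun x0 hornerC mul1r expR_gt0. Qed.

Lemma bump0_ge0 x : 0 <= bump0 x.
Proof. by rewrite /bump0 /flat_fun; case: ifP => // _; rewrite hornerC mul1r expR_ge0. Qed.

Lemma bump0_eq0 x : x <= 0 -> bump0 x = 0.
Proof. by move=> x0; rewrite /bump0 /flat_fun ltNge x0. Qed.

Definition step0 x : R := bump0 x * (bump0 x + bump0 (-1 * x + 1))^-1.

(** The affine change of variable makes the step constant near both ends of the
    unit interval, so that its derivatives vanish there for a local reason. *)
Definition smooth_step x : R := step0 (2 * x + (- (1 / 2))).

Lemma smooth_smooth_step : smooth smooth_step.
Proof.
have C1 n : Ck n bump0 by exact: Ck_flat_fun.
apply/Ck_smooth => n; apply: (Ck_affine (f := step0)).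
apply: (CkM (C1 n)); apply: CkV.
  move=> x; rewrite gt_eqF//; have [x0|x0] := ltP 0 x.
    by apply: ltr_pwDl; [exact: bump0_gt0|exact: bump0_ge0].
  by apply: ltr_wpDl; [exact: bump0_ge0|apply: bump0_gt0; lra].
by apply: (CkD (C1 n)); exact: Ck_affine.
Qed.

Lemma smooth_step_eq0 x : x <= 1 / 4 -> smooth_step x = 0.
Proof. by move=> x0; rewrite /smooth_step /step0 bump0_eq0 ?mul0r//; lra. Qed.

Lemma smooth_step_eq1 x : 3 / 4 <= x -> smooth_step x = 1.
Proof.
move=> x1; rewrite /smooth_step /step0 (@bump0_eq0 (-1 * _ + 1)); last lra.
by rewrite addr0 mulfV// gt_eqF// bump0_gt0//; lra.
Qed.

Lemma derive1n_smooth_step_le0 k x : x <= 0 -> smooth_step^`(k) x = 0.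
Proof.
move=> x0; have h : \forall y \near x, smooth_step y = cst 0 y.
  near=> y; apply: smooth_step_eq0; near: y; apply: lt_le_nbhsl; lra.
rewrite (nbhs_singleton (near_eq_derive1n k h)); case: k => [//|k].
exact: derive1n_cst.
Unshelve. all: by end_near. Qed.

Lemma derive1n_smooth_step_ge1 k x : 1 <= x ->
  smooth_step^`(k) x = (cst (1:R))^`(k) x.
Proof.
move=> x0; have h : \forall y \near x, smooth_step y = cst 1 y.
  near=> y; apply: smooth_step_eq1; near: y.
  by apply: filterS (@lt_nbhsr R (3 / 4) x _) => [y /ltW|]//; lra.
exact: nbhs_singleton (near_eq_derive1n k h).
Unshelve. all: by end_near. Qed.

Lemma derive1n_smooth_step_bounded k :
  exists2 B : R, 1 <= B & forall x, `|smooth_step^`(k) x| <= B.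
Proof.
have cS : {within `[0, 1], continuous (fun x : R => `|smooth_step^`(k) x|)}.
  apply: continuous_subspaceT => x.
  by apply: continuous_comp; [exact: smooth_continuous smooth_smooth_step x|exact: norm_continuous].
have [c _ cB] := EVT_max (@ler01 R) cS.
exists (1 + `|smooth_step^`(k) c|) => [|x]; first by rewrite lerDl.
have [x0|x0] := leP x 0; first by rewrite derive1n_smooth_step_le0// normr0 addr_ge0.
have [x1|x1] := leP 1 x.
  rewrite derive1n_smooth_step_ge1//; case: k {cS cB} => [|k].
    by rewrite derive1n0 normr1 lerDl.
  by rewrite derive1n_cst normr0 addr_ge0.
apply: le_trans (cB x _) _; first by rewrite in_itv/= !ltW.
by rewrite lerDr.
Qed.

End smooth_step.

(** * Divided differences and the mean value theorem *)
Section divided_differences.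
Context {R : realType}.
Implicit Types (f g : R -> R) (y : nat -> R) (k i m n : nat) (t : R).

Notation dd := (@divided_difference R).

Lemma dd0 f y : dd f 0 y = f (y 0).
Proof.
by rewrite /divided_difference big_ord1 big1 ?divr1// => j; rewrite ord1.
Qed.

Let w k y (i : nat) := \prod_(j < k.+1 | j != i :> nat) (y i - y j).

Lemma ddE f k y : dd f k y = \sum_(i < k.+1) f (y i) / w k y i.
Proof. by []. Qed.

Let w_recl k y i : w k.+1 y i.+1 = (y i.+1 - y 0) * w k (fun j => y j.+1) i.
Proof. by rewrite /w big_mkcond big_ord_recl/= [in RHS]big_mkcond. Qed.

Let w_recr k y i : (i <= k)%N -> w k.+1 y i = w k y i * (y i - y k.+1).
Proof.
move=> ik; rewrite /w big_mkcond big_ord_recr/= [in RHS]big_mkcond.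
by rewrite gtn_eqF.
Qed.

Lemma dd_rec f k y : (forall i j, (i < j <= k.+1)%N -> y i != y j) ->
  dd f k.+1 y * (y k.+1 - y 0) = dd f k (fun j => y j.+1) - dd f k y.
Proof.
move=> yI; rewrite !ddE.
have -> : \sum_(i < k.+1) f (y i.+1) / w k (fun j => y j.+1) i =
    \sum_(i < k.+2) f (y i) * (y i - y 0) / w k.+1 y i.
  rewrite [RHS]big_ord_recl/= subrr mulr0 mul0r add0r.
  apply: eq_bigr => i _; rewrite /bump leq0n add1n w_recl.
  by rewrite invfM mulrA mulfK// subr_eq0 eq_sym yI//= ltnS ltn_ord.
have -> : \sum_(i < k.+1) f (y i) / w k y i =
    \sum_(i < k.+2) f (y i) * (y i - y k.+1) / w k.+1 y i.
  rewrite [RHS]big_ord_recr/= subrr mulr0 mul0r addr0.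
  apply: eq_bigr => i _; have ik : (i <= k)%N by rewrite -ltnS.
  rewrite w_recr// [w k y i * _]mulrC invfM mulrA mulfK// subr_eq0 yI//.
  by rewrite leqnn andbT ltnS.
rewrite mulr_suml -sumrB; apply: eq_bigr => i _; ring.
Qed.

Let L k y (i : 'I_k.+1) : {poly R} := \prod_(j < k.+1 | j != i) ('X - (y j)%:P).

Let sizeL k y (i : 'I_k.+1) : size (L y i) = k.+1.
Proof.
rewrite /L -big_filter size_prod_XsubC; congr S.
apply: etrans (_ : #|predC1 i| = k); last by rewrite cardC1 card_ord.
by rewrite size_filter -sum1_count -sum1_card; apply: eq_bigl.
Qed.

Let coefL k y (i : 'I_k.+1) : (L y i)`_k = 1.
Proof.
have := monic_prod_XsubC [seq j <- index_enum 'I_k.+1 | j != i] xpredT (fun j => y j).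
by rewrite big_filter -/(L y i) qualifE /= lead_coefE sizeL => /eqP.
Qed.

Let hornerL k y (i l : 'I_k.+1) : (L y i).[y l] = \prod_(j < k.+1 | j != i) (y l - y j).
Proof. by rewrite /L horner_prod; apply: eq_bigr => j _; rewrite hornerXsubC. Qed.

(** In the Lagrange form the leading coefficient is visibly the divided
    difference. *)
Definition interpolant f k y : {poly R} :=
  \sum_(i < k.+1) (f (y i) / w k y i) *: L y i.

Lemma interpolantE f k y i : (forall i j, (i < j <= k)%N -> y i != y j) ->
  (i <= k)%N -> (interpolant f k y).[y i] = f (y i).
Proof.
move=> yI; rewrite -ltnS => ik; pose i' := Ordinal ik.
rewrite horner_sum (bigD1 i')//= hornerZ (hornerL y i' i') -/(w k y i) divfK.
  rewrite big1 ?addr0// => j ji; rewrite hornerZ (hornerL y j i').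
  by rewrite (bigD1 i') 1?eq_sym//= subrr mul0r mulr0.
apply/prodf_neq0 => j ji; rewrite subr_eq0; case: (ltngtP j i) => [h|h|/eqP]; last first.
- by move=> h; rewrite h in ji.
- by rewrite yI// h -ltnS ltn_ord.
- by rewrite eq_sym yI// h -ltnS.
Qed.

Lemma size_interpolant f k y : (size (interpolant f k y) <= k.+1)%N.
Proof.
apply: (leq_trans (size_sum _ _ _)); apply/bigmax_leqP => i _.
by apply: (leq_trans (size_scale_leq _ _)); rewrite sizeL.
Qed.

Lemma coef_interpolant f k y : (interpolant f k y)`_k = dd f k y.
Proof.
by rewrite ddE coef_sum; apply: eq_bigr => i _; rewrite coefZ coefL mulr1.
Qed.

Lemma derivn_interpolant f k y : derivn k (interpolant f k y) = (dd f k y *+ k`!)%:P.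
Proof.
apply/polyP => i; rewrite coef_derivn coefC; case: i => [|i]/=.
  by rewrite addn0 coef_interpolant ffactnn.
by rewrite nth_default ?mul0rn// (leq_trans (size_interpolant f k y))// addnS ltnS leq_addr.
Qed.

(** Iterated Rolle: between the zeros of f lie zeros of its derivative, one fewer. *)
Lemma generalized_Rolle k f y :
  (forall j x, (j < k)%N -> derivable f^`(j) x 1) ->
  (forall i, (i < k)%N -> y i < y i.+1) -> (forall i, (i <= k)%N -> f (y i) = 0) ->
  exists2 x, y 0%N <= x <= y k & f^`(k) x = 0.
Proof.
elim: k f y => [|k IH] f y df yS f0.
  by exists (y 0%N); rewrite ?lexx//; exact: f0.
have d1 x : derivable f x 1 by exact: (df 0).
have R1 i : exists x, (i <= k)%N -> y i < x < y i.+1 /\ f^`() x = 0.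
  have [ik|ik] := leqP i k; last by exists 0.
  have [||||x xy dx] := @Rolle R f (y i) (y i.+1).
  - by apply: yS; rewrite ltnS.
  - by move=> x _; exact: d1.
  - apply: derivable_within_continuous => x _; exact: d1.
  - by rewrite !f0// leqW.
  exists x => _; split; first by move: xy; rewrite in_itv.
  by rewrite (is_derive1E dx).
have [z Hz] := choice R1.
have [|||x xz fx] := IH f^`() z.
- by move=> j x jk; rewrite -derive1Sn; apply: df.
- move=> i ik; have [/andP[_ h1] _] := Hz i (ltnW ik).
  by have [/andP[h2 _] _] := Hz i.+1 ik; exact: lt_trans h1 h2.
- by move=> i ik; have [] := Hz i ik.
exists x; last by rewrite derive1Sn.
have [/andP[h1 _] _] := Hz 0 isT; have [/andP[_ h2] _] := Hz k (leqnn k).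
by case/andP: xz => a b; rewrite (le_trans (ltW h1) a) (le_trans b (ltW h2)).
Qed.

Lemma derive1n_horner (p : {poly R}) k : (horner p)^`(k) = horner (derivn k p).
Proof. by elim: k => [//|k IH]; rewrite derive1nS IH -derivE. Qed.

(** The difference with the interpolation polynomial has one zero more than
    the order of the derivative. *)
Lemma dd_mean_value k f y :
  (forall j x, (j < k)%N -> derivable f^`(j) x 1) ->
  (forall i j, (i < j <= k)%N -> y i < y j) ->
  exists2 x, y 0%N <= x <= y k & dd f k y = f^`(k) x / k`!%:R.
Proof.
move=> df yS; pose p := interpolant f k y.
have sp : smooth (fun x => -1 * p.[x]).
  apply/Ck_smooth => n; apply: CkM; first exact: Ck_cst.
  by move=> j _ x; rewrite derive1n_horner.
have E j x : (j <= k)%N ->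
    (fun x => f x + -1 * p.[x])^`(j) x = f^`(j) x + -1 * (derivn j p).[x].
  elim: j x => [//|j IH] x jk; rewrite !derive1nS.
  have -> : (fun x => f x + -1 * p.[x])^`(j) = fun x => f^`(j) x + -1 * (derivn j p).[x].
    by apply/funext => z; exact: IH (ltnW jk).
  apply: is_derive1E; apply: is_deriveD; first by apply: derivable_is_derive1; exact: df.
have yI : forall i j, (i < j <= k)%N -> y i != y j.
  by move=> i j /yS /lt_eqF ->.
have [|||x xy] := @generalized_Rolle k (fun x => f x + -1 * p.[x]) y.
- move=> j x jk; have -> : (fun x => f x + -1 * p.[x])^`(j) = fun x => f^`(j) x + -1 * (derivn j p).[x].
    by apply/funext => z; exact: E (ltnW jk).
  apply: derivableD; first exact: df.
  by apply: derivableZ.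
- by move=> i ik; apply: yS; rewrite ltnSn.
- by move=> i ik; rewrite interpolantE// mulN1r subrr.
rewrite E// derivn_interpolant hornerC mulN1r => /eqP; rewrite subr_eq0 => /eqP fx.
exists x => //; rewrite fx -[dd f k y *+ _]mulr_natr mulfK// pnatr_eq0 -lt0n; exact: fact_gt0.
Qed.

End divided_differences.

(** * Bounds on derivatives in a unit of length *)
Section scaled_bounds.
Context {R : realType}.
Implicit Types (u v f : R -> R) (y : nat -> R) (k i l m n r s : nat) (x t d a b : R).

(** The powers of d amount to measuring lengths in the unit d; with them the bound
    is multiplicative, whatever the length of the window. *)
Definition scaled_bound m d a x u :=
  forall k, (k <= m)%N -> d ^+ k * `|u^`(k) x| <= a.

(** The factor 2 ^+ m counts the terms of the Leibniz rule. *)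
Lemma scaled_boundM m d a b x u v : 0 <= d -> smooth u -> smooth v ->
  scaled_bound m d a x u -> scaled_bound m d b x v ->
  scaled_bound m d (2 ^+ m * (a * b)) x (fun t => u t * v t).
Proof.
move=> d0; suff H k u' v' a' b' : smooth u' -> smooth v' ->
    scaled_bound k d a' x u' -> scaled_bound k d b' x v' ->
    d ^+ k * `|(fun t => u' t * v' t)^`(k) x| <= 2 ^+ k * (a' * b').
  move=> su sv Hu Hv k km.
  have a0 : 0 <= a by apply: le_trans (Hu 0%N _); rewrite // mulr_ge0.
  have b0 : 0 <= b by apply: le_trans (Hv 0%N _); rewrite // mulr_ge0.
  apply: le_trans (H k u v a b su sv _ _) _.
  - by move=> j jk; apply: Hu; exact: leq_trans jk km.
  - by move=> j jk; apply: Hv; exact: leq_trans jk km.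
  by apply: ler_wpM2r; [exact: mulr_ge0|rewrite ler_weXn2l// ler1n].
elim: k u' v' a' b' => [|k IH] u1 v1 a1 b1 su sv Hu Hv.
  rewrite !expr0 !mul1r derive1n0 normrM; apply: ler_pM => //.
    by have := Hu 0 isT; rewrite expr0 mul1r.
  by have := Hv 0 isT; rewrite expr0 mul1r.
have E1 : (fun t => u1 t * v1 t)^`() = fun t => u1 t * v1^`(1) t + v1 t * u1^`(1) t.
  apply/funext => t; apply: is_derive1E; apply: is_deriveM.
    exact: (smooth_is_derive 0 t su).
  exact: (smooth_is_derive 0 t sv).
have su1 := smooth_derive (k := 1) su; have sv1 := smooth_derive (k := 1) sv.
have P (f g : R -> R) (a2 b2 : R) : smooth f -> smooth g -> scaled_bound k.+1 d a2 x f ->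
    scaled_bound k.+1 d b2 x g ->
    d ^+ k.+1 * `|(fun t => f t * g^`(1) t)^`(k) x| <= 2 ^+ k * (a2 * b2).
  move=> sf sg Hf Hg; have sg1 := smooth_derive (k := 1) sg.
  have := IH f (fun t => d * g^`(1) t) a2 b2 sf (smoothZ sg1) _ _.
  have -> : (fun t => f t * (d * g^`(1) t)) = fun t => d * (f t * g^`(1) t).
    by apply/funext => t; ring.
  rewrite smooth_derive1nZ; last exact: smoothM.
  rewrite normrM (ger0_norm d0) exprSr -mulrA; apply.
    by move=> j jk; apply: Hf; exact: leqW.
  move=> j jk; rewrite smooth_derive1nZ// normrM (ger0_norm d0) mulrA -exprSr.
  by rewrite -[_^`(j)]/(iter j _ _) /derive1n -iterD addn1; exact: Hg.
rewrite derive1Sn E1 smooth_derive1nD; [|exact: smoothM..].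
apply: le_trans (_ : d ^+ k.+1 * (`|(fun t => u1 t * v1^`(1) t)^`(k) x| +
   `|(fun t => v1 t * u1^`(1) t)^`(k) x|) <= _).
  by apply: ler_wpM2l; [exact: exprn_ge0|exact: ler_normD].
rewrite mulrDr; apply: le_trans (lerD (P _ _ _ _ su sv Hu Hv) (P _ _ _ _ sv su Hv Hu)) _.
by rewrite exprS; lra.
Qed.

Lemma smooth_lin (c : R) : smooth (fun t : R => t - c).
Proof.
by apply/Ck_smooth => n; apply: (CkD (g := fun=> - c)); [exact: Ck_id|exact: Ck_cst].
Qed.

Lemma scaled_bound_lin m d a (c : R) x : d <= a -> `|x - c| <= a ->
  scaled_bound m d a x (fun t => t - c).
Proof.
move=> da xa k km.
have dl t : is_derive t 1 (fun t : R => t - c) 1.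
  by have := is_deriveB (is_derive_id t 1) (is_derive_cst c t 1); rewrite subr0.
have dE : (fun t : R => t - c)^`() = cst 1 by apply/funext => t; exact: is_derive1E.
case: k km => [|[|k]] km; first by rewrite expr0 mul1r.
  by rewrite derive1n1 dE normr1 mulr1.
by rewrite derive1Sn dE derive1n_cst normr0 mulr0 (le_trans _ xa).
Qed.

Definition prodlin y n t : R := \prod_(s < n) (t - y s).

Lemma prodlinS y n t : prodlin y n.+1 t = prodlin y n t * (t - y n).
Proof. by rewrite /prodlin big_ord_recr. Qed.

Lemma prodlinSl y n t : prodlin y n.+1 t = (t - y 0%N) * prodlin (fun s => y s.+1) n t.
Proof. by rewrite /prodlin big_ord_recl. Qed.

Lemma smooth_prodlin y n : smooth (prodlin y n).
Proof.
apply/Ck_smooth => k; elim: n => [|n IH].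
  by rewrite (_ : prodlin y 0 = fun=> 1); [exact: Ck_cst|apply/funext => t; rewrite /prodlin big_ord0].
rewrite (_ : prodlin y n.+1 = fun t => prodlin y n t * (t - y n)); last first.
  by apply/funext => t; exact: prodlinS.
by apply: CkM; [exact: IH|exact: ((Ck_smooth (fun t => t - y n)).1 (@smooth_lin (y n)) k)].
Qed.

Lemma scaled_bound_prodlin m d a y n x : 0 <= d -> d <= a ->
  (forall s, (s < n)%N -> `|x - y s| <= a) ->
  scaled_bound m d ((2 ^+ m * a) ^+ n) x (prodlin y n).
Proof.
move=> d0 da; elim: n => [_|n IH xy].
  rewrite (_ : prodlin y 0 = cst 1); last by apply/funext => t; rewrite /prodlin big_ord0.
  rewrite expr0; case=> [|k] _; first by rewrite expr0 mul1r derive1n0 normr1.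
  by rewrite derive1n_cst normr0 mulr0.
rewrite (_ : prodlin y n.+1 = fun t => prodlin y n t * (t - y n)); last first.
  by apply/funext => t; exact: prodlinS.
rewrite exprSr mulrCA; apply: scaled_boundM => //.
- exact: smooth_prodlin.
- exact: smooth_lin.
- by apply: IH => s sn; apply: xy; exact: leqW.
- by apply: scaled_bound_lin => //; exact: xy.
Qed.

End scaled_bounds.

(** * The interpolating spline *)
(** The first summand bounds the Newton interpolant (newton_bound), the second one
    the terms cut off by a step (phi_bound). *)
Definition spline_const {R : realType} (m : nat) (B : R) : R :=
  (2 ^+ m * (2 * m%:R)) ^+ m +
  2 ^+ m * ((2 ^+ m) ^+ m.-1 * (m%:R ^+ m * B)) * (2 * m%:R) ^+ m.

Section spline.
Context {R : realType} (m' : nat) (y : nat -> R) (f : R -> R).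
Implicit Types (k i l n r s j : nat) (x t : R).
Local Notation m := m'.+1.
Hypothesis yS : forall i, y i < y i.+1.

Let y_lt i j : (i < j)%N -> y i < y j.
Proof. by move=> ij; apply: (homo_ltn lt_trans yS). Qed.

Let y_le i j : (i <= j)%N -> y i <= y j.
Proof. by rewrite leq_eqVlt => /predU1P[->//|/y_lt/ltW]. Qed.

Let D k i := divided_difference f k (fun j => y (i + j)%N).

Let D_rec k i : D k.+1 i * (y (i + k.+1)%N - y i) = D k i.+1 - D k i.
Proof.
rewrite /D -[in y i](addn0 i) (@dd_rec _ f k (fun j => y (i + j)%N)).
  by congr (divided_difference _ _ _ - _); apply/funext => j; rewrite addnS.
by move=> a b /andP[ab _]; rewrite lt_eqF// y_lt// ltn_add2l.
Qed.

(** The Newton form of the interpolation polynomial at y i, ..., y (i + n - 1). *)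
Let newton n i t := \sum_(r < n) D r i * prodlin (fun s => y (i + s)%N) r t.

Let psi i t := prodlin (fun s => y (i + s.+1)%N) m' t.

Let c i := (y (i + m)%N - y i) * D m i.

Let newton_rec n i t : newton n.+1 i.+1 t - newton n.+1 i t =
  D n.+1 i * (y (i + n.+1)%N - y i) * prodlin (fun s => y (i + s.+1)%N) n t.
Proof.
elim: n => [|n IH].
  by rewrite /newton !big_ord1 D_rec /prodlin !big_ord0 !mulr1.
have E a : newton n.+2 a t = newton n.+1 a t + D n.+1 a * prodlin (fun s => y (a + s)%N) n.+1 t.
  by rewrite /newton big_ord_recr.
have -> : newton n.+2 i.+1 t - newton n.+2 i t = (newton n.+1 i.+1 t - newton n.+1 i t) +
    (D n.+1 i.+1 * prodlin (fun s => y (i.+1 + s)%N) n.+1 t -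
     D n.+1 i * prodlin (fun s => y (i + s)%N) n.+1 t) by rewrite !E; ring.
rewrite IH (D_rec n.+1) [prodlin (fun s => y (i + s)%N) n.+1 t]prodlinSl addn0.
have -> : (fun s => y (i.+1 + s)%N) = (fun s => y (i + s.+1)%N).
  by apply/funext => s; rewrite addSnnS.
rewrite !prodlinS; ring.
Qed.

Let newtonE i t : newton m i.+1 t - newton m i t = c i * psi i t.
Proof. by rewrite newton_rec /c /psi [D _ _ * _]mulrC. Qed.

Let newton_sum n t : newton m n t = newton m 0 t + \sum_(i < n) c i * psi i t.
Proof.
elim: n => [|n IH]; first by rewrite big_ord0 addr0.
by rewrite big_ord_recr/= addrA -IH -newtonE; ring.
Qed.

Let newton_interp i : newton m i (y i) = f (y i).
Proof.
rewrite /newton big_ord_recl/= big1 ?addr0 => [|r _].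
  by rewrite /D dd0 /prodlin big_ord0 mulr1 addn0.
by rewrite prodlinSl addn0 subrr mul0r mulr0.
Qed.

Let psi0 i l : (i < l < i + m)%N -> psi i (y l) = 0.
Proof.
move=> /andP[il lim]; have h : (l - i.+1 < m')%N by rewrite ltn_subLR// addSnnS.
rewrite /psi /prodlin (bigD1 (Ordinal h))//= -subSn// subSS subnKC ?subrr ?mul0r//.
exact: ltnW.
Qed.

(** The step number i is placed in the longest gap of its window, since its
    derivatives grow like powers of the inverse length of the gap. *)
Let long_gap i : exists r, (r < m)%N /\
  y (i + m)%N - y i <= m%:R * (y (i + r.+1)%N - y (i + r)%N).
Proof.
apply: contrapT => h; suff : y (i + m)%N - y i < y (i + m)%N - y i by rewrite ltxx.
have -> : y (i + m)%N - y i = \sum_(0 <= r < m) (y (i + r.+1)%N - y (i + r)%N).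
  by rewrite telescope_sumr// addn0.
have hr r : (0 <= r < m)%N -> y (i + r.+1)%N - y (i + r)%N < (y (i + m)%N - y i) / m%:R.
  move=> rm; rewrite ltNge; apply/negP => h'; apply: h; exists r; split => //.
  by rewrite mulrC -ler_pdivrMr.
apply: lt_le_trans (ltr_sum_nat _ hr) _ => //.
rewrite sumr_const_nat subn0 -[_ *+ _]mulr_natr divfK ?pnatr_eq0//.
by rewrite telescope_sumr// addn0.
Qed.

Let rr i := sval (cid (long_gap i)).
Let ja i := y (i + rr i)%N.
Let jb i := y (i + (rr i).+1)%N.
Let len i := jb i - ja i.

Let rr_lt i : (rr i < m)%N.
Proof. by rewrite /rr; case: cid => r []. Qed.

Let len_ge i : y (i + m)%N - y i <= m%:R * len i.
Proof. by rewrite /len /ja /jb /rr; case: cid => r []. Qed.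

Let len_gt0 i : 0 < len i.
Proof. by rewrite subr_gt0 y_lt// ltn_add2l. Qed.

Let step i t : R := smooth_step ((len i)^-1 * t + (- ((len i)^-1 * ja i))).

Let smooth_step_i i : smooth (step i).
Proof. by apply: smooth_affine; exact: smooth_smooth_step. Qed.

Let step0 i t : t <= ja i + len i / 4 -> step i t = 0.
Proof.
move=> h; apply: smooth_step_eq0; rewrite -mulrBr mulrC ler_pdivrMr//; lra.
Qed.

Let step1 i t : jb i - len i / 4 <= t -> step i t = 1.
Proof.
move=> h; apply: smooth_step_eq1; rewrite -mulrBr [(len i)^-1 * _]mulrC ler_pdivlMr//.
move: h; rewrite /len; lra.
Qed.

Let phi i t := psi i t * step i t.

Let smooth_psi i : smooth (psi i).
Proof. exact: smooth_prodlin. Qed.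

Let smooth_phi i : smooth (phi i).
Proof. exact: smoothM. Qed.

Let phi_left i k t : t <= y i -> (phi i)^`(k) t = 0.
Proof.
move=> ti; have tj : t < ja i + len i / 4.
  have : y i <= ja i by rewrite y_le// leq_addr.
  by have := len_gt0 i; lra.
have h : \forall x \near t, phi i x = cst 0 x.
  near=> x; rewrite /phi step0 ?mulr0//; near: x; exact: lt_le_nbhsl.
rewrite (nbhs_singleton (near_eq_derive1n k h)); case: k => [//|k].
exact: derive1n_cst.
Unshelve. all: by end_near. Qed.

Let phi_right i k t : y (i + m)%N <= t -> (phi i)^`(k) t = (psi i)^`(k) t.
Proof.
move=> ti; have tj : jb i - len i / 4 < t.
  have : jb i <= y (i + m)%N by rewrite y_le// leq_add2l rr_lt.
  by have := len_gt0 i; lra.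
have h : \forall x \near t, phi i x = psi i x.
  near=> x; rewrite /phi step1 ?mulr1//; near: x.
  by apply: filterS (lt_nbhsr tj) => z /ltW.
exact: (nbhs_singleton (near_eq_derive1n k h)).
Unshelve. all: by end_near. Qed.

Variables (N : nat).
Hypothesis c0 : forall i, (N <= i)%N -> c i = 0.
Hypothesis f0 : forall i, (i < m)%N -> f (y i) = 0.

(** Without the steps, the first n summands would add up to the interpolation
    polynomial at y n, ..., y (n + m - 1) (newton_sum): each summand corrects the
    interpolant by one knot, and the step delays the correction until it is
    needed. *)
Definition spline t := \sum_(i < N) c i * phi i t.

Lemma smooth_spline : smooth spline.
Proof. by apply: smooth_sum => i; exact: smoothZ. Qed.

Let D0 k : (k < m)%N -> D k 0 = 0.
Proof.
move=> km; rewrite /D /divided_difference big1// => i _.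
by rewrite f0 ?mul0r// add0n (leq_trans (ltn_ord i)).
Qed.

Let newton0 t : newton m 0 t = 0.
Proof. by rewrite /newton big1// => i _; rewrite D0// mul0r. Qed.

Let derive1n_spline n k t : (N <= n)%N ->
  spline^`(k) t = \sum_(i < n) c i * (phi i)^`(k) t.
Proof.
move=> Nn; rewrite derive1n_sum; last by move=> i; exact: smoothZ.
under eq_bigr do rewrite smooth_derive1nZ//.
rewrite -!(big_mkord xpredT (fun i => c i * (phi i)^`(k) t)).
rewrite [RHS](big_cat_nat (leq0n N) Nn)//= [X in _ + X]big_nat_cond [X in _ + X]big1 ?addr0//.
by move=> i /andP[/andP[Ni _] _]; rewrite c0// mul0r.
Qed.

(** At y l the step number i is 0 for l <= i and 1 for i + m <= l; in between it
    does not matter, because psi i vanishes at y l. *)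
Lemma spline_interpolates l : spline (y l) = f (y l).
Proof.
have := @derive1n_spline (N + l)%N 0 (y l) (leq_addr _ _); rewrite derive1n0 => ->.
rewrite -newton_interp newton_sum newton0 add0r.
rewrite -(big_mkord xpredT (fun i => c i * (phi i)^`(0) (y l))) -(big_mkord xpredT (fun i => c i * psi i (y l))).
rewrite (big_cat_nat (leq0n l) (leq_addl N l))//= [X in _ + X]big_nat_cond [X in _ + X]big1 ?addr0.
  apply: eq_big_nat => i /andP[_ il]; congr (_ * _).
  have [h|h] := leqP (i + m) l; first exact: (@phi_right i 0 (y l) (y_le h)).
  by rewrite /phi psi0 ?mul0r// il h.
move=> i /andP[/andP[li _] _]; have H := @phi_left i 0 (y l) (y_le li).
by rewrite [phi i (y l)]H mulr0.
Qed.

Lemma spline_left k t : t <= y 0%N -> spline^`(k) t = 0.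
Proof.
move=> t0; rewrite (derive1n_spline _ _ (leqnn N)) big1// => i _.
by rewrite phi_left ?mulr0// (le_trans t0)// y_le.
Qed.

Let smooth_newton n i : smooth (newton n i).
Proof. by apply: smooth_sum => r; apply: smoothZ; exact: smooth_prodlin. Qed.

Let derive1n_spline_local l k t : y l <= t -> t <= y l.+1 ->
  spline^`(k) t = (newton m (l.+1 - m))^`(k) t +
    \sum_(l.+1 - m <= i < l.+1) c i * (phi i)^`(k) t.
Proof.
move=> lt tl; rewrite (@derive1n_spline (N + l.+1)) ?leq_addr//.
rewrite -(big_mkord xpredT (fun i => c i * (phi i)^`(k) t)).
rewrite (big_cat_nat (leq0n l.+1) (leq_addl N l.+1))//=.
rewrite [X in _ + X]big_nat_cond [X in _ + X]big1 ?addr0; last first.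
  move=> i /andP[/andP[li _] _]; rewrite phi_left ?mulr0//.
  exact: le_trans tl (y_le li).
rewrite (big_cat_nat (leq0n (l.+1 - m)) (leq_subr m l.+1))/=; congr (_ + _).
have -> : newton m (l.+1 - m) = fun t => \sum_(i < l.+1 - m) c i * psi i t.
  by apply/funext => z; rewrite newton_sum newton0 add0r.
rewrite derive1n_sum; last by move=> i; exact: smoothZ.
rewrite big_mkord; apply: eq_bigr => i _; rewrite smooth_derive1nZ// phi_right//.
apply: le_trans lt; apply: y_le; have := ltn_ord i; lia.
Qed.

Variable B : R.
Hypothesis B1 : 1 <= B.
Hypothesis stepB : forall k x, (k <= m)%N -> `|smooth_step^`(k) x| <= B.
Hypothesis gap : forall i, y i.+1 - y i <= 2.

Let y_dist i n : y (i + n)%N - y i <= 2 * n%:R.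
Proof.
elim: n => [|n IH]; first by rewrite addn0 subrr mulr0.
by rewrite addnS -natr1; have := gap (i + n); lra.
Qed.

Let y_itv_dist a b x x' : y a <= x <= y (a + b)%N -> y a <= x' <= y (a + b)%N ->
  `|x - x'| <= y (a + b)%N - y a.
Proof. by move=> /andP[h1 h2] /andP[h3 h4]; rewrite ler_norml; lra. Qed.

Let K : R := 2 ^+ m * ((2 ^+ m) ^+ m' * (m%:R ^+ m * B)).

Let K0 : 0 <= K.
Proof. by rewrite /K !mulr_ge0 ?exprn_ge0// (le_trans ler01). Qed.

(** With d the length of the window, c i contributes d, psi i contributes d ^ (m - 1)
    and the differentiation d ^- k; the result is bounded since d <= 2 m. *)
Let phi_bound i k t : (k <= m)%N -> y i <= t <= y (i + m)%N ->
  `|c i * (phi i)^`(k) t| <= K * (2 * m%:R) ^+ m * `|D m i|.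
Proof.
move=> km it; pose d := y (i + m)%N - y i.
have d0 : 0 < d by rewrite subr_gt0 y_lt// -addSnnS leq_addr.
have Hstep : scaled_bound m d (m%:R ^+ m * B) t (step i).
  move=> j jm; rewrite /step derive1n_affine; last exact: smooth_smooth_step.
  rewrite normrM mulrA; apply: ler_pM => //; last exact: stepB.
    by rewrite mulr_ge0// exprn_ge0// ltW.
  have l0 : 0 <= (len i)^-1 by rewrite invr_ge0 ltW.
  rewrite normrX (ger0_norm l0) -exprMn.
  apply: le_trans (_ : m%:R ^+ j <= _); last by rewrite ler_weXn2l// ler1n.
  have dl0 : 0 <= d / len i by rewrite mulr_ge0// ltW.
  rewrite lerXn2r// ?nnegrE//.
  by rewrite ler_pdivrMr//; exact: len_ge.
have Hpsi : scaled_bound m d ((2 ^+ m * d) ^+ m') t (psi i).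
  apply: scaled_bound_prodlin => //; first exact: ltW.
  move=> s sm; apply: y_itv_dist => //.
  by rewrite !y_le// ?leq_addr// leq_add2l// ltnW.
have := scaled_boundM (ltW d0) (@smooth_psi i) (@smooth_step_i i) Hpsi Hstep km.
rewrite -/(phi i) => h.
have {}h : d * `|(phi i)^`(k) t| <= K * d ^+ (m - k).
  rewrite -(ler_pM2l (exprn_gt0 m' d0)) mulrA -exprSr.
  rewrite -[in leLHS](subnKC km) exprD mulrAC.
  apply: le_trans (ler_wpM2r (exprn_ge0 _ (ltW d0)) h) _.
  rewrite /K exprMn le_eqVlt; apply/orP; left; apply/eqP.
  by move: (d ^+ m') (d ^+ _) ((_ ^+ _) ^+ m') => *; ring.
rewrite /c -/d !normrM (gtr0_norm d0) mulrAC.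
apply: ler_wpM2r => //; apply: le_trans h _; apply: ler_wpM2l => //.
have dm : d <= 2 * m%:R by exact: y_dist.
apply: le_trans (_ : (2 * m%:R) ^+ (m - k) <= _).
  by rewrite lerXn2r// nnegrE ?mulr_ge0// ltW.
rewrite ler_weXn2l// ?leq_subr//; have : (1:R) <= m%:R by rewrite ler1n.
lra.
Qed.

Let newton_bound a k t : (k <= m)%N -> y a <= t <= y (a + m)%N ->
  `|(newton m a)^`(k) t| <= (2 ^+ m * (2 * m%:R)) ^+ m * \sum_(r < m) `|D r a|.
Proof.
move=> km at_; have m1 : (1:R) <= m%:R by rewrite ler1n.
rewrite derive1n_sum; last by move=> r; apply: smoothZ; exact: smooth_prodlin.
apply: le_trans (ler_norm_sum _ _ _) _; rewrite mulr_sumr; apply: ler_sum => r _.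
rewrite smooth_derive1nZ; last exact: smooth_prodlin.
rewrite normrM mulrC; apply: ler_wpM2r => //.
have H : scaled_bound m 1 ((2 ^+ m * (2 * m%:R)) ^+ r) t (prodlin (fun s => y (a + s)%N) r).
  apply: scaled_bound_prodlin => //; first lra.
  move=> s sr; apply: le_trans (y_dist a m); apply: y_itv_dist => //.
  by rewrite !y_le// ?leq_addr// leq_add2l (leq_trans (ltnW sr))// ltnW.
have := H k km; rewrite expr1n mul1r => /le_trans; apply.
have p1 : (1:R) <= 2 ^+ m by rewrite exprn_ege1// ler1n.
have q1 : (1:R) <= 2 * m%:R by lra.
have pq : 1 <= 2 ^+ m * (2 * m%:R) :> R.
  by rewrite -[leLHS]mulr1; apply: ler_pM.
by apply: ler_weXn2l => //; apply: ltnW; exact: ltn_ord.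
Qed.

(** Around [y l, y l.+1] only the steps of index l.+1 - m, ..., l are neither 0 nor
    1; the earlier summands form one interpolation polynomial. *)
Lemma spline_bound l k t : (k <= m)%N -> y l <= t -> t <= y l.+1 ->
  `|spline^`(k) t| <= spline_const m B *
    \sum_(l.+1 - m <= i < l.+1)
      \sum_(r < m.+1) `|divided_difference f r (fun j => y (i + j)%N)|.
Proof.
move=> km lt tl; rewrite (derive1n_spline_local k lt tl).
have bl i : (l.+1 - m <= i < l.+1)%N -> y i <= t <= y (i + m)%N.
  move=> h; rewrite (le_trans _ lt) ?y_le//=; last lia.
  by apply: le_trans tl _; apply: y_le; lia.
rewrite /spline_const mulrDl; apply: le_trans (ler_normD _ _) _; apply: lerD.
  apply: le_trans (newton_bound km (bl _ _)) _; first lia.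
  apply: ler_wpM2l; first by rewrite exprn_ge0// !mulr_ge0// exprn_ge0.
  rewrite big_ltn; last lia.
  apply: le_trans (_ : \sum_(r < m.+1) `|D r (l.+1 - m)| <= _).
    by rewrite [leRHS]big_ord_recr/= lerDl.
  by rewrite lerDl; apply: sumr_ge0 => i _; apply: sumr_ge0.
apply: le_trans (ler_norm_sum _ _ _) _; rewrite mulr_sumr.
rewrite big_nat [leRHS]big_nat; apply: ler_sum => i il.
apply: le_trans (phi_bound km (bl _ il)) _.
apply: ler_wpM2l; first by rewrite mulr_ge0// exprn_ge0.
by rewrite big_ord_recr/= lerDr; apply: sumr_ge0.
Qed.

End spline.

(** * Knots *)
Section knots.
Context {R : realType}.
Implicit Types (s : seq R) (t x z : R) (l n : nat).

Lemma seq_has_min s : s != [::] -> exists2 z, z \in s & forall x, x \in s -> z <= x.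
Proof.
elim: s => [//|a [|b s] IH] _.
  by exists a; rewrite ?inE// => x; rewrite inE => /eqP ->.
have [z zs zmin] := IH isT; have [az|za] := leP a z.
  exists a; first by rewrite inE eqxx.
  by move=> x; rewrite inE => /predU1P[->//|/zmin]; exact: le_trans.
exists z; first by rewrite inE zs orbT.
by move=> x; rewrite inE => /predU1P[->|/zmin//]; exact: ltW.
Qed.

Let next_knot s t : exists t', [/\ t < t', t' < t + 2,
    forall x, x \in s -> t < x -> t' <= x &
    t' \in s \/ t' = t + 1 /\ (forall x, x \in s -> t < x -> t + 2 <= x)].
Proof.
pose u := [seq x <- s | t < x < t + 2].
have [u0|/seq_has_min[z]] := eqVneq u [::].
  have far x : x \in s -> t < x -> t + 2 <= x.
    move=> xs tx; rewrite leNgt; apply/negP => xt.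
    have : x \in u by rewrite mem_filter tx xt xs.
    by rewrite u0.
  exists (t + 1); split; [lra|lra| |by right].
  by move=> x xs tx; have := far x xs tx; lra.
rewrite mem_filter => /andP[/andP[tz zt] zs] zmin; exists z; split => //; last by left.
move=> x xs tx; have [xt|] := ltP x (t + 2); last by move=> h; apply: le_trans h; exact: ltW.
by apply: zmin; rewrite mem_filter tx xt xs.
Qed.

(** From a knot outside s the next one is at distance 1 unless an element of s is
    closer than 2; the steps between knots that are not both in s thus stay
    between 1 and 2. *)
Lemma knot_sequence m s : (0 < m)%N -> s != [::] ->
  exists (y : nat -> R) (N : nat), [/\ (forall l, y l < y l.+1),
    (forall l, y l.+1 - y l <= 2),
    (forall l, ~~ ((y l \in s) && (y l.+1 \in s)) -> 1 <= y l.+1 - y l),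
    (forall l, (l < m)%N \/ (N <= l)%N -> y l \notin s) &
    (forall x, x \in s -> exists l, y l = x)].
Proof.
move=> m0 s0; have [a as_ amin] := seq_has_min s0.
have [nxt Hn] := choice (next_knot s).
pose y l := iter l nxt (a - m%:R).
have yS l : y l.+1 = nxt (y l) by [].
have ylt l : y l < y l.+1 by case: (Hn (y l)).
have m1 : (1:R) <= m%:R by rewrite ler1n.
have inv l : y l \notin s -> forall x, x \in s -> y l < x -> y l + 1 <= x.
  case: l => [|l] ys x xs yx; first by have := amin x xs; rewrite /y/=; lra.
  have [tt' _ _ [|[yE far]]] := Hn (y l); first by rewrite -yS (negbTE ys).
  have := far x xs (lt_trans tt' yx); rewrite yS yE; lra.
have yfirst l : (l <= m)%N -> y l = a - m%:R + l%:R.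
  elim: l => [|l IH] lm; first by rewrite addr0.
  have yl := IH (ltnW lm); have [tt' t2 skip [tin|[yE _]]] := Hn (y l).
    have h1 := amin _ tin; have lm' : l%:R + 1 <= m%:R :> R by rewrite natr1 ler_nat.
    have /skip h2 : a \in s by []; have {}h2 : nxt (y l) <= a by apply: h2; rewrite yl; lra.
    have e : nxt (y l) = a by apply/eqP; rewrite eq_le h2 h1.
    rewrite yS e -natr1; move: t2; rewrite e yl => t2.
    have : m%:R < (l.+2)%:R :> R by rewrite -!natr1; lra.
    rewrite ltr_nat ltnS => ml; have -> : m = l.+1 by apply/eqP; rewrite eqn_leq ml lm.
    by rewrite -natr1; lra.
  by rewrite yS yE yl -natr1 addrA.
pose c l := count (fun x => x <= y l) s.
have ybig l : y 0%N + l%:R - (size s)%:R <= y l.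
  suff : y 0%N + l%:R <= y l + (c l)%:R.
    have : (c l)%:R <= (size s)%:R :> R by rewrite ler_nat /c count_size.
    lra.
  elim: l => [|l IH]; first by rewrite addr0 lerDl.
  have cle : (c l <= c l.+1)%N.
    by apply: sub_count => x /le_trans; apply; exact: ltW.
  have [tt' t2 skip [tin|[yE _]]] := Hn (y l); last first.
    have : (c l)%:R <= (c l.+1)%:R :> R by rewrite ler_nat.
    by rewrite -(natr1 l) (yS l) yE; lra.
  have : (c l).+1%:R <= (c l.+1)%:R :> R.
    pose P x := (y l < x) && (x <= y l.+1).
    rewrite ler_nat; have -> : c l.+1 = (c l + count P s)%N.
      rewrite /c -count_predUI /P (eq_count (a2 := fun x => x <= y l.+1)) => [|x /=].
        rewrite [X in (_ + X)%N](_ : _ = 0%N) ?addn0//.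
        by rewrite -(count_pred0 s); apply: eq_count => x /=; case: (leP x (y l)).
      by case: (leP x (y l)) => //= h; rewrite (le_trans h)// ltW.
    rewrite -addn1 leq_add2l -has_count; apply/hasP; exists (y l.+1) => //.
    by rewrite /P lexx ylt.
  by rewrite -!natr1; have := ylt l; lra.
have sbd : exists M : R, forall x, x \in s -> x <= M.
  exists (\sum_(x <- s) `|x|) => x xs; apply: le_trans (ler_norm x) _.
  by rewrite (big_rem x)//= lerDl; apply: sumr_ge0.
have [M sM] := sbd.
pose N := Num.bound `|M - y 0%N + (size s)%:R|.
have NM l : (N <= l)%N -> M < y l.
  move=> Nl; apply: lt_le_trans (ybig l).
  have := archi_boundP (normr_ge0 (M - y 0%N + (size s)%:R)); rewrite -/N => h.
  have : N%:R <= l%:R :> R by rewrite ler_nat.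
  by have := ler_norm (M - y 0%N + (size s)%:R); lra.
exists y, N; split => // [l|l|l|x xs].
- by have [_ + _ _] := Hn (y l); rewrite yS; lra.
- have [yin|ynin] := boolP (y l.+1 \in s); last first.
    have [_ _ _ [|[yE _]]] := Hn (y l); first by rewrite -yS (negbTE ynin).
    by rewrite yS yE; lra.
  by rewrite andbT => ynin; have := inv l ynin _ yin (ylt l); lra.
- move=> [lm|/NM My]; last by apply/negP => /sM; rewrite leNgt My.
  apply/negP => /amin; rewrite yfirst; last exact: ltnW.
  have : l%:R + 1 <= m%:R :> R by rewrite natr1 ler_nat.
  lra.
have ex : exists l, x <= y l by exists N; rewrite ltW// (le_lt_trans (sM x xs))// NM.
case: (ex_minnP ex) => -[|l] xl lmin.
  by move: xl; rewrite /y/=; have := amin x xs; lra.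
exists l.+1; apply/eqP; rewrite eq_le xl andbT.
have [_ _ skip _] := Hn (y l); apply: skip => //.
by rewrite ltNge; apply/negP => /lmin; rewrite ltnn.
Qed.

End knots.

(** * The variation along a subsequence of the knots *)
Section variation.
Context {R : realType}.
Implicit Types (f : R -> R) (x y : nat -> R) (k i l m n : nat) (p V : R).

(** The second case is the convention that the points after x n are infinite. *)
Definition min_weight m n x i : R :=
  if (i + m <= n)%N then Num.min 1 (x (i + m)%N - x i) else 1.

Definition consecutive_dd f y k i : R := divided_difference f k (fun j => y (i + j)%N).

Lemma variation_sumE m p f n x : variation_sum m p f n x =
  (\sum_(k < m.+1) \sum_(i < (n - k).+1)
    min_weight m n x i * `|consecutive_dd f x k i| `^ p)%:E.
Proof.
rewrite /variation_sum -sumEFin; apply: eq_bigr => k _.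
rewrite -sumEFin; apply: eq_bigr => i _; rewrite EFinM; congr (_ * _)%E.
have ik : (i <= n)%N by have := ltn_ord i; lia.
rewrite /extended_point /min_weight ik; case: ifP => _.
  by rewrite -EFinB -EFin_min.
by rewrite addye// min_l// leey.
Qed.

Section selection.
Variables (E : set R) (f : R -> R) (m : nat) (p V : R).
Hypothesis HV : forall n x, (m <= n)%N -> increasing_in E n x ->
  \sum_(k < m.+1) \sum_(i < (n - k).+1)
    min_weight m n x i * `|consecutive_dd f x k i| `^ p <= V.
Variables (y : nat -> R) (A : pred nat) (L : nat) (w : nat -> R).
Hypothesis yS : forall l, y l < y l.+1.
Hypothesis AL : forall l, A l -> (l < L)%N.
Hypothesis AE : forall l, A l -> E (y l).
Hypothesis Am : (m < count A (iota 0 L))%N.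
Hypothesis w1 : forall l, w l <= 1.
Hypothesis wA : forall l l', A l -> A l' ->
  count A (iota 0 l') = (count A (iota 0 l) + m)%N -> w l <= y l' - y l.

Let idx := [seq l <- iota 0 L | A l].
Let cnt l := count A (iota 0 l).
Let x j := y (nth 0%N idx j).

Let nth_cnt l : A l -> nth 0%N idx (cnt l) = l.
Proof.
move=> Al; rewrite /idx /cnt -(subnKC (ltnW (AL Al))) iotaD filter_cat nth_cat.
rewrite size_filter ltnn subnn add0n; have : (0 < L - l)%N by rewrite subn_gt0 AL.
by case: (L - l)%N => //= n _; rewrite Al.
Qed.

Let cntS l : A l -> cnt l.+1 = (cnt l).+1.
Proof. by move=> Al; rewrite /cnt -addn1 iotaD count_cat/= Al !addn0 addn1. Qed.

Let size_idx : size idx = cnt L. Proof. by rewrite size_filter. Qed.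

Let idx_A j : (j < cnt L)%N -> A (nth 0%N idx j).
Proof.
by rewrite -size_idx => /(mem_nth 0); rewrite mem_filter => /andP[].
Qed.

Let cnt_nth j : (j < cnt L)%N -> cnt (nth 0%N idx j) = j.
Proof.
move=> jL; have ujx : uniq idx by rewrite filter_uniq// iota_uniq.
have h := nth_cnt (idx_A jL); have Aj := idx_A jL.
have cl : (cnt (nth 0%N idx j) < size idx)%N.
  rewrite size_idx; have := cntS Aj; have : (cnt (nth 0%N idx j).+1 <= cnt L)%N.
    by rewrite /cnt -(subnKC (AL Aj)) iotaD count_cat leq_addr.
  by move=> + hh; rewrite hh.
by apply/eqP; rewrite -(nth_uniq 0 cl _ ujx) ?size_idx// h.
Qed.

(** The knots selected by A form a subsequence x of y. A window of consecutive
    knots that are all selected is also a window of x, where its weight is 1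
    or the distance to the m-th next selected knot, hence at least w. *)
Lemma selection_sum : \sum_(k < m.+1) \sum_(0 <= l < L | all A (iota l k.+1))
    w l * `|consecutive_dd f y k l| `^ p <= V.
Proof.
have cL0 : (0 < cnt L)%N by exact: leq_trans Am.
have [ylt yle] : (forall i j, (i < j)%N -> y i < y j) /\ (forall i j, (i <= j)%N -> y i <= y j).
  have h i j : (i < j)%N -> y i < y j by move=> ij; apply: (homo_ltn lt_trans yS).
  by split=> // i j; rewrite leq_eqVlt => /predU1P[->//|/h/ltW].
have idx_lt i j : (i < j)%N -> (j < cnt L)%N -> (nth 0%N idx i < nth 0%N idx j)%N.
  move=> ij jL; have si : sorted ltn idx by apply: sorted_filter (iota_ltn_sorted 0 L); exact: ltn_trans.
  by apply: (sorted_ltn_nth ltn_trans 0 si) => //; rewrite inE size_idx// (ltn_trans ij).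
have xE : increasing_in E (cnt L).-1 x.
  split=> [i j /andP[ij jL]|i iL].
    by apply/ylt/idx_lt => //; rewrite -(prednK cL0) ltnS.
  by apply/AE/idx_A; rewrite -(prednK cL0) ltnS.
have mn : (m <= (cnt L).-1)%N by rewrite -ltnS prednK.
apply: le_trans (HV mn xE); apply: ler_sum => k _.
have run l : all A (iota l k.+1) -> forall j, (j <= k)%N -> cnt (l + j) = (cnt l + j)%N.
  move=> /allP h; elim=> [|j IH] jk; first by rewrite !addn0.
  by rewrite !addnS cntS ?IH// 1?ltnW//; apply: h; rewrite mem_iota; lia.
rewrite -(big_mkord xpredT (fun i => min_weight m (cnt L).-1 x i * `|consecutive_dd f x k i| `^ p)).
pose G l := w l * `|consecutive_dd f y k l| `^ p.
pose P l := all A (iota l k.+1).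
have -> : \sum_(0 <= l < L | all A (iota l k.+1)) w l * `|consecutive_dd f y k l| `^ p =
    \sum_(0 <= j < cnt L | P (nth 0%N idx j)) G (nth 0%N idx j).
  rewrite -size_idx -(big_nth 0 P G) /idx big_filter_cond /index_iota subn0.
  by apply: eq_bigl => l; rewrite /P/=; case: (A l).
have Pk j : (j < cnt L)%N -> P (nth 0%N idx j) -> (j < ((cnt L).-1 - k).+1)%N.
  move=> jL Pj; have /allP h := Pj; have Ajk : A (nth 0%N idx j + k)%N.
    by apply: h; rewrite mem_iota leq_addr addnS ltnSn.
  have := run _ Pj k (leqnn k); rewrite cnt_nth// => cE.
  have := nth_cnt Ajk; have : (cnt (nth 0%N idx j + k) < cnt L)%N.
    have h2 : (cnt (nth 0%N idx j + k).+1 <= cnt L)%N.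
      by rewrite /cnt -(subnKC (AL Ajk)) iotaD count_cat leq_addr.
    by move: h2; rewrite cntS.
  rewrite cE; lia.
rewrite (bigID (fun j => (j < ((cnt L).-1 - k).+1)%N))/= [X in _ + X]big_nat_cond.
rewrite [X in _ + X]big1 ?addr0 => [|j /andP[/andP[_ jL] /andP[Pj]]]; last first.
  by rewrite Pk.
rewrite -(big_nat_widen 0 ((cnt L).-1 - k).+1 (cnt L)); last lia.
rewrite big_mkcond/= big_nat [leRHS]big_nat; apply: ler_sum => j jk.
have jL : (j < cnt L)%N by move: jk => /andP[_]; lia.
have mw0 : 0 <= min_weight m (cnt L).-1 x j.
  rewrite /min_weight; case: ifP => // jm; rewrite le_min ler01 subr_ge0 /x.
  rewrite yle//; case: (posnP m) => [->|m0]; first by rewrite addn0.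
  by apply/ltnW/idx_lt; lia.
case: ifPn => Pj; last by rewrite mulr_ge0// powR_ge0.
have Aj := idx_A jL.
have -> : consecutive_dd f x k j = consecutive_dd f y k (nth 0%N idx j).
  rewrite /consecutive_dd /divided_difference.
  have xy i : (i <= k)%N -> x (j + i)%N = y (nth 0%N idx j + i)%N.
    move=> ik; rewrite /x; congr y; rewrite -{1}(cnt_nth jL) -(run _ Pj)// nth_cnt//.
    by have /allP := Pj; apply; rewrite mem_iota; lia.
  apply: eq_bigr => i _; rewrite (xy i (leq_ord i)); congr (_ / _).
  by apply: eq_bigr => i' _; rewrite (xy i' (leq_ord i')).
rewrite /G; apply: ler_wpM2r; first exact: powR_ge0.
rewrite /min_weight; case: ifP => jm; last exact: w1.
rewrite le_min w1/=; have jmL : (j + m < cnt L)%N by lia.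
by apply: wA; rewrite ?idx_A// -!/(cnt _) !cnt_nth.
Qed.

End selection.
End variation.

(** * Divided differences of the padded function *)
Lemma le_term_sum (R : realType) (F : nat -> R) (n j : nat) :
  (forall l, 0 <= F l) -> (j < n)%N -> F j <= \sum_(l < n) F l.
Proof.
move=> F0 jn; rewrite (bigD1 (Ordinal jn))//= lerDl.
by apply: sumr_ge0 => l _; exact: F0.
Qed.

Lemma maximal_run (A : pred nat) (l : nat) : ~~ A 0%N -> A l ->
  exists b, [/\ (0 < b <= l)%N, ~~ A b.-1 & forall j, (b <= j <= l)%N -> A j].
Proof.
move=> A0; elim: l => [|l IH] Al; first by rewrite Al in A0.
have [/IH[b [bl pb h]]|nl] := boolP (A l); last first.
  by exists l.+1; split=> [||j jl]//; [lia|have -> : j = l.+1 by lia].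
exists b; split=> [|//|j jl]; first by lia.
by have [->//|jn] := eqVneq j l.+1; apply: h; lia.
Qed.

Lemma powR_sum_le (R : realType) (p : R) (n : nat) (F : nat -> R) : 0 < p ->
  (forall i, 0 <= F i) ->
  (\sum_(i < n) F i) `^ p <= n%:R `^ p * \sum_(i < n) F i `^ p.
Proof.
move=> p0 F0; set S := \sum_(i < n) F i `^ p.
have S0 : 0 <= S by apply: sumr_ge0 => i _; exact: powR_ge0.
have h i : (i < n)%N -> F i <= S `^ p^-1.
  move=> im; have -> : F i = (F i `^ p) `^ p^-1 by rewrite -powRrM mulfV ?gt_eqF// powRr1.
  apply: ge0_ler_powR; rewrite ?nnegrE ?powR_ge0 ?invr_ge0// ?(ltW p0)//.
  by apply: (@le_term_sum _ (fun i => F i `^ p)) => // l; exact: powR_ge0.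
apply: le_trans (_ : (n%:R * S `^ p^-1) `^ p <= _).
  apply: ge0_ler_powR; rewrite ?nnegrE ?mulr_ge0 ?powR_ge0 ?(ltW p0)//; first by apply: sumr_ge0.
  rewrite mulr_natl -[X in _ *+ X]card_ord -sumr_const.
  by apply: ler_sum => i _; exact: h.
by rewrite powRM// ?powR_ge0// -powRrM mulVf ?gt_eqF// powRr1.
Qed.

Definition variation_const (R : realType) (m : nat) : R :=
  m.+1%:R * 2 ^+ m * m.+1%:R * (m.+1%:R * (2 * m%:R) * m.+1%:R * (2 + (m * m.+1)%:R)).

Section padded_differences.
Context {R : realType} (E : set R) (f : R -> R) (m : nat) (s : seq R).
Implicit Types (i j k l n a b : nat) (p V M : R).
Hypothesis m0 : (0 < m)%N.
Hypothesis sE : forall x, x \in s -> E x.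
Hypothesis us : uniq s.
Hypothesis ms : (m < size s)%N.

(** The padding knots are those outside s. *)
Definition zero_outside (t : R) : R := if t \in s then f t else 0.

Variables (y : nat -> R) (N : nat).
Hypothesis yS : forall l, y l < y l.+1.
Hypothesis y2 : forall l, y l.+1 - y l <= 2.
Hypothesis y1 : forall l, ~~ ((y l \in s) && (y l.+1 \in s)) -> 1 <= y l.+1 - y l.
Hypothesis yout : forall l, (l < m)%N \/ (N <= l)%N -> y l \notin s.
Hypothesis ysurj : forall x, x \in s -> exists l, y l = x.

Let ylt i j : (i < j)%N -> y i < y j.
Proof. by move=> ij; apply: (homo_ltn lt_trans yS). Qed.

Let yle i j : (i <= j)%N -> y i <= y j.
Proof. by rewrite leq_eqVlt => /predU1P[->//|/ylt/ltW]. Qed.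

Let D k i := consecutive_dd zero_outside y k i.

Let D_rec k i : D k.+1 i * (y (i + k.+1)%N - y i) = D k i.+1 - D k i.
Proof.
rewrite /D /consecutive_dd -[in y i](addn0 i) (@dd_rec _ _ k (fun j => y (i + j)%N)).
  by congr (divided_difference _ _ _ - _); apply/funext => j; rewrite addnS.
by move=> a b /andP[ab _]; rewrite lt_eqF// ylt// ltn_add2l.
Qed.

Let inS l := y l \in s.
Let pure k i := all inS (iota i k.+1).

Let pureP k i : reflect (forall j, (i <= j <= i + k)%N -> y j \in s) (pure k i).
Proof.
apply: (iffP allP) => h j; last by rewrite mem_iota addnS ltnS; exact: h.
by move=> jk; apply: h; rewrite mem_iota addnS ltnS.
Qed.

Let pure_dd k i : pure k i -> D k i = consecutive_dd f y k i.
Proof.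
move=> /pureP h; apply: eq_bigr => j _; rewrite /zero_outside h//.
by rewrite leq_addr leq_add2l leq_ord.
Qed.

(** A window with a padding knot is at least 1 long, so that the recurrence bounds
    its divided difference by the sum of two differences of lower order; after k
    such steps only windows contained in s are left. *)
Let impure_dd k i M : 0 <= M ->
  (forall a j, (i <= a)%N -> (a + j <= i + k)%N -> pure j a -> `|D j a| <= M) ->
  `|D k i| <= 2 ^+ k * M.
Proof.
move=> M0; elim: k i => [|k IH] i H; rewrite ?expr0 ?mul1r.
  have [pi|pi] := boolP (pure 0 i); first by apply: H => //; rewrite addn0.
  suff -> : D 0 i = 0 by rewrite normr0.
  rewrite /D /consecutive_dd dd0 addn0 /zero_outside.
  by move: pi; rewrite /pure/= andbT /inS => /negbTE ->.
have e1 : (1:R) <= 2 ^+ k.+1 by rewrite exprn_ege1// ler1n.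
have [pi|pi] := boolP (pure k.+1 i).
  by apply: le_trans (H i k.+1 _ _ pi) _ => //; rewrite ler_peMl.
have len1 : 1 <= y (i + k.+1)%N - y i.
  have [g /andP[ig gk] gs] : exists2 g, (i <= g <= i + k.+1)%N & y g \notin s.
    move: pi => /allPn[g]; rewrite mem_iota addnS ltnS => h gs; exists g => //.
  have [gi|gi] := leqP g i.
    have gE : g = i by lia.
    have := @y1 i _; rewrite -{1}gE (negbTE gs) => /(_ isT) h.
    have : y i.+1 <= y (i + k.+1)%N by apply: yle; lia.
    lra.
  have gE : g = g.-1.+1 by lia.
  have := @y1 g.-1 _; rewrite -gE (negbTE gs) andbF => /(_ isT) h.
  have h1 : y i <= y g.-1 by apply: yle; lia.
  have : y g <= y (i + k.+1)%N by exact: yle.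
  lra.
have h1 : `|D k i| <= 2 ^+ k * M.
  by apply: IH => a j ia aj; apply: H => //; lia.
have h2 : `|D k i.+1| <= 2 ^+ k * M.
  by apply: IH => a j ia aj; apply: H => //; lia.
have : `|D k.+1 i| <= `|D k i.+1 - D k i|.
  rewrite -D_rec normrM ler_peMr// ger0_norm//; lra.
move=> /le_trans; apply; apply: le_trans (ler_normB _ _) _.
by rewrite exprS; lra.
Qed.

Lemma padded_dd_bound (w : R) i : 0 <= w ->
  (forall k x, (k <= m)%N -> increasing_in E k x ->
    `|divided_difference f k x| <= w) ->
  \sum_(r < m.+1) `|D r i| <= m.+1%:R * (2 ^+ m * w).
Proof.
move=> w0 H; apply: le_trans (_ : \sum_(r < m.+1) 2 ^+ m * w <= _); last first.
  by rewrite sumr_const card_ord -[leLHS]mulr_natl.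
apply: ler_sum => r _; apply: le_trans (impure_dd w0 _) _.
  move=> a j ia aj /[dup] pa /pure_dd ->; apply: H; first by have := leq_ord r; lia.
  split=> [b c /andP[bc _]|b bj]; first by rewrite ylt// ltn_add2l.
  by apply/sE/(pureP _ _ pa); rewrite leq_addr leq_add2l.
by apply: ler_wpM2r => //; rewrite ler_weXn2l// ?ler1n// leq_ord.
Qed.

Section finite_exponent.
Variables (p w : R).
Hypothesis p1 : 1 < p.
Hypothesis w0 : 0 <= w.
Hypothesis HV : forall n x, (m <= n)%N -> increasing_in E n x ->
  \sum_(k < m.+1) \sum_(i < (n - k).+1)
    min_weight m n x i * `|consecutive_dd f x k i| `^ p <= w `^ p.

Let p0 : 0 < p. Proof. exact: lt_trans p1. Qed.

(** The knots of s with a padding knot among the m knots before them. Two of them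
    that are m left ends apart are separated by a padding knot, so that windows
    made of left ends have weight 1 in the sequence of all left ends. *)
Let left_end l := inS l && ~~ all inS (iota (l - m) (minn l m)).

(** A window of m + 1 knots of s keeps its length, which is at most 2 m, in the
    sequence of all knots of s; otherwise a padding knot separates y l from the
    m-th next knot of s, so that the weight is 1. *)
Let w1 l : R := if pure m l then (y (l + m)%N - y l) / (2 * m%:R) else 1.

Let T l := \sum_(j < m.+1) (if pure j l then w1 l * `|D j l| `^ p else 0) +
  \sum_(j < m.+1) (if all left_end (iota l j.+1) then `|D j l| `^ p else 0).

Let y_dist i n : y (i + n)%N - y i <= 2 * n%:R.
Proof.
elim: n => [|n IH]; first by rewrite addn0 subrr mulr0.
by rewrite addnS -natr1; have := y2 (i + n); lra.
Qed.

Let m1 : (1:R) <= m%:R. Proof. by rewrite ler1n. Qed.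

Let w1_bounds l : 0 <= w1 l /\ w1 l <= 1.
Proof.
rewrite /w1; case: ifP => _; last by split.
split; first by rewrite divr_ge0 ?subr_ge0 ?yle ?leq_addr// mulr_ge0.
by rewrite ler_pdivrMr ?mul1r ?y_dist// mulr_gt0// ltr0n.
Qed.

Let T0 l : 0 <= T l.
Proof.
rewrite /T addr_ge0//; apply: sumr_ge0 => j _; case: ifP => // _.
by rewrite mulr_ge0 ?powR_ge0//; case: (w1_bounds l).
Qed.

(** If the padding knot lies to the right of the small window, the weight w1 at its
    first knot is 1; if it lies to the left, the small window is made of left
    ends. *)
Let sub_le_T k i a j : (k <= m)%N -> ~~ pure k i -> (i <= a)%N ->
  (a + j <= i + k)%N -> pure j a -> `|D j a| `^ p <= T a.
Proof.
move=> km pk ia aj pj.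
have [g /andP[ig gk] gs] : exists2 g : nat, (i <= g <= i + k)%N & ~~ inS g.
  by move: pk => /allPn[g]; rewrite mem_iota addnS ltnS => h gs; exists g.
have jm : (j < m.+1)%N by move: aj km ia; clear; lia.
have ge1 l : 0 <= (if pure l a then w1 a * `|D l a| `^ p else 0).
  by case: ifP => // _; rewrite mulr_ge0 ?powR_ge0//; case: (w1_bounds a).
have ge2 l : 0 <= (if all left_end (iota a l.+1) then `|D l a| `^ p else 0).
  by case: ifP => // _; exact: powR_ge0.
have [ga|ag] := ltnP g a.
  apply: le_trans (_ : \sum_(j < m.+1) (if all left_end (iota a j.+1) then `|D j a| `^ p else 0) <= _); last first.
    by rewrite /T lerDr; apply: sumr_ge0.
  apply: le_trans (le_term_sum ge2 jm); rewrite ifT//.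
  apply/allP => c0; rewrite mem_iota addnS ltnS; move: (c0 : nat) => c /andP[ac].
  move=> cj.
  rewrite /left_end /inS (pureP _ _ pj) ?ac ?cj//=.
  apply/allPn; exists g => //; rewrite mem_iota; move: ga ig aj km ac cj; clear; lia.
have {}ag : (a + j < g)%N.
  rewrite ltnNge; apply/negP => gaj; move: gs; rewrite /inS (pureP _ _ pj)//.
  by rewrite ag gaj.
apply: le_trans (_ : \sum_(j < m.+1) (if pure j a then w1 a * `|D j a| `^ p else 0) <= _); last first.
  by rewrite /T lerDl; apply: sumr_ge0.
apply: le_trans (le_term_sum ge1 jm); rewrite pj.
have -> : w1 a = 1.
  rewrite /w1 ifF//; apply/negbTE/allPn; exists g => //; rewrite mem_iota.
  by move: ag gk ia km; clear; lia.
by rewrite mul1r.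
Qed.

(** A window with a padding knot has lost its own weight, but the windows in s to
    which it reduces appear in T with at least the weight 1. *)
Let term_le_T k i : (k <= m)%N ->
  (y (i + m)%N - y i) * `|D k i| `^ p <= 2 * m%:R * 2 `^ (m%:R * p) * \sum_(e < m.+1) T (i + e)%N.
Proof.
move=> km; set S := \sum_(e < m.+1) T (i + e)%N.
have S0 : 0 <= S by apply: sumr_ge0.
have TS a : (i <= a <= i + m)%N -> T a <= S.
  move=> /andP[ia am]; have h : (a - i < m.+1)%N by lia.
  have := le_term_sum (F := fun e => T (i + e)%N) (fun e => T0 _) h.
  by rewrite /= subnKC.
have two1 : (1:R) <= 2 `^ (m%:R * p).
  by rewrite -[leLHS](powRr0 2) ler_powR// ?mulr_ge0 ?(ltW p0)// ler1n.
have d0 : 0 <= y (i + m)%N - y i by rewrite subr_ge0 yle// leq_addr.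
have mm0 : 0 <= 2 * m%:R :> R by rewrite mulr_ge0.
have [pi|pi] := boolP (pure k i).
  have h1 : w1 i * `|D k i| `^ p <= S.
    apply: le_trans (TS i _); last by rewrite leqnn leq_addr.
    have ge1 l : 0 <= (if pure l i then w1 i * `|D l i| `^ p else 0).
      by case: ifP => // _; rewrite mulr_ge0 ?powR_ge0//; case: (w1_bounds i).
    have := @le_term_sum _ _ m.+1 k ge1 km; rewrite pi => /le_trans; apply.
    by rewrite /T lerDl; apply: sumr_ge0 => j _; case: ifP => // _; exact: powR_ge0.
  have h2 : y (i + m)%N - y i <= 2 * m%:R * w1 i.
    rewrite /w1; case: ifP => _; last by rewrite mulr1 y_dist.
    by rewrite [leRHS]mulrC divfK// mulf_neq0// pnatr_eq0 -lt0n.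
  apply: le_trans (ler_wpM2r (powR_ge0 _ _) h2) _.
  rewrite -[leLHS]mulrA -[leRHS]mulrA; apply: ler_wpM2l => //.
  by apply: le_trans h1 _; rewrite ler_peMl.
pose M := S `^ p^-1.
have M0 : 0 <= M by exact: powR_ge0.
have DM : `|D k i| <= 2 ^+ k * M.
  apply: impure_dd => // a j ia aj pj.
  have h := sub_le_T km pi ia aj pj.
  have {}h : `|D j a| `^ p <= S by apply: le_trans h (TS _ _); rewrite ia; move: aj km; clear; lia.
  have -> : `|D j a| = (`|D j a| `^ p) `^ p^-1.
    by rewrite -powRrM mulfV ?gt_eqF// powRr1.
  by apply: ge0_ler_powR; rewrite ?nnegrE ?powR_ge0 ?invr_ge0// ltW.
have DMp : `|D k i| `^ p <= 2 `^ (m%:R * p) * S.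
  apply: le_trans (_ : (2 ^+ m * M) `^ p <= _).
    apply: ge0_ler_powR; rewrite ?nnegrE ?mulr_ge0// ?(ltW p0)//.
    apply: le_trans DM _; apply: ler_wpM2r => //.
    by rewrite ler_weXn2l// ler1n.
  rewrite powRM// -powR_mulrn// -powRrM /M -powRrM mulVf ?gt_eqF// powRr1//.
rewrite -2!mulrA; apply: le_trans (ler_wpM2l d0 DMp) _.
rewrite mulrA; apply: ler_wpM2r; first by rewrite mulr_ge0// (le_trans ler01).
exact: y_dist.
Qed.

Variable L : nat.
Hypothesis NL : (N <= L)%N.

Let inS_lt l : inS l -> (l < L)%N.
Proof.
move=> ls; rewrite ltnNge; apply/negP => Ll.
by have := @yout l (or_intror (leq_trans NL Ll)); rewrite -[_ \in _]/(inS l) ls.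
Qed.

Let count_inS : (m < count inS (iota 0 L))%N.
Proof.
apply: leq_trans ms _; rewrite -size_filter -(size_map y).
apply: uniq_leq_size => // x xs; have [l yl] := ysurj xs.
have ls : inS l by rewrite /inS yl.
by rewrite -yl; apply: map_f; rewrite mem_filter ls mem_iota/= add0n inS_lt.
Qed.

Let count_step (A : pred nat) l l' :
  count A (iota 0 l') = (count A (iota 0 l) + m)%N -> (l + m <= l')%N.
Proof.
have [ll|ll] := leqP l l'; last first.
  by rewrite -[in count A (iota 0 l)](subnKC (ltnW ll)) iotaD count_cat; lia.
rewrite -[in count A (iota 0 l')](subnKC ll) iotaD count_cat => /addnI e.
by have := count_size A (iota (0 + l) (l' - l)); rewrite e size_iota; lia.
Qed.

Let far l g l' : (l < g)%N -> (g <= l')%N -> ~~ inS g -> 1 <= y l' - y l.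
Proof.
move=> lg gl gs; have gE : g = g.-1.+1 by lia.
have := @y1 g.-1 _; rewrite -gE -[y g \in s]/(inS g) (negbTE gs) andbF => /(_ isT) h.
have h1 : y l <= y g.-1 by apply: yle; lia.
have h2 : y g <= y l' by exact: yle.
lra.
Qed.

(** Here all knots of s are selected. *)
Let sum_T1 : \sum_(0 <= l < L) \sum_(j < m.+1)
  (if pure j l then w1 l * `|D j l| `^ p else 0) <= w `^ p.
Proof.
have := @selection_sum _ E f m p (w `^ p) HV y inS L w1 yS inS_lt _ count_inS _ _.
rewrite exchange_big => h; apply: le_trans (h _ _ _) => [|l ls|l|l l' ls ls' /count_step lm].
- apply: ler_sum => k _; rewrite [leRHS]big_mkcond; apply: ler_sum => l _.
  by rewrite -/(pure k l); case: ifP => // pk; rewrite pure_dd.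
- exact: sE.
- by case: (w1_bounds l).
have yy := yle lm; rewrite /w1; case: ifPn => [pm|/allPn[g0]].
  have h0 : 0 <= y (l + m)%N - y l by rewrite subr_ge0 yle// leq_addr.
  apply: le_trans (_ : y (l + m)%N - y l <= _); last lra.
  have mm : (1:R) <= 2 * m%:R by have := m1; lra.
  by rewrite ler_pdivrMr ?(lt_le_trans ltr01 mm)// ler_peMr.
rewrite mem_iota addnS ltnS; move: (g0 : nat) => g /andP[lg gm] gs.
have lg' : (l < g)%N by rewrite ltn_neqAle lg andbT; apply/eqP => e; rewrite -e ls in gs.
apply: far lg' _ gs; move: gm lm; clear; lia.
Qed.

Let T2 l := \sum_(j < m.+1) (if all left_end (iota l j.+1) then `|D j l| `^ p else 0).

Let left_endS l : left_end l -> inS l. Proof. by case/andP. Qed.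

Let all_left_end_pure j l : all left_end (iota l j.+1) -> pure j l.
Proof. exact/sub_all/left_endS. Qed.

(** Here the left ends are selected; they must be more than m to form an
    admissible sequence. *)
Let sum_T2_many : (m < count left_end (iota 0 L))%N ->
  \sum_(0 <= l < L) T2 l <= w `^ p.
Proof.
move=> cm; have := @selection_sum _ E f m p (w `^ p) HV y left_end L (fun=> 1) yS _ _ cm _ _.
rewrite exchange_big => h; apply: le_trans (h _ _ _ _) => [|l /left_endS/inS_lt//|l /left_endS|//|l l' ls ls' /count_step lm].
- apply: ler_sum => k _; rewrite [leRHS]big_mkcond; apply: ler_sum => l _.
  by case: ifP => // pk; rewrite mul1r pure_dd//; exact: all_left_end_pure.
- exact: sE.
move: ls' => /andP[_ /allPn[g0]]; rewrite mem_iota; move: (g0 : nat) => g gl gs.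
have lg : (l < g)%N.
  rewrite ltn_neqAle; apply/andP; split; last by move: gl lm; clear; lia.
  by apply/eqP => e; rewrite -e left_endS in gs.
by apply: far lg _ gs; move: gl; clear; lia.
Qed.

(** If there are at most m left ends, they are exactly the first m knots of one run
    of consecutive knots of s. The m + 1 first knots of the run are an admissible
    sequence in which all windows but those starting at the first knot have
    weight 1; for these, the recurrence goes down from the order m, where the
    weight is the length of the window. *)
Let sum_T2_few : (count left_end (iota 0 L) <= m)%N ->
  \sum_(0 <= l < L) T2 l <= (m * m.+1)%:R * (m.+1%:R * w) `^ p.
Proof.
move=> cm.
have Q0 : 0 <= (m.+1%:R * w) `^ p by exact: powR_ge0.
suff Dw j0 l0 : all left_end (iota l0 j0.+1) -> `|D j0 l0| <= m.+1%:R * w.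
  apply: le_trans (_ : \sum_(0 <= l < L | left_end l) m.+1%:R * (m.+1%:R * w) `^ p <= _).
    rewrite [leRHS]big_mkcond/=; apply: ler_sum => l _; rewrite /T2; case: ifPn => ll.
      rewrite [leRHS]mulr_natl -[X in _ *+ X]card_ord -sumr_const; apply: ler_sum => j _.
      case: ifPn => // h; apply: ge0_ler_powR; rewrite ?nnegrE ?mulr_ge0 ?(ltW p0)//.
      exact: Dw.
    by rewrite big1// => j _; rewrite /= (negbTE ll).
  rewrite big_const_seq iter_addr_0 -[leLHS]mulr_natl mulrA -natrM; apply: ler_wpM2r => //.
  by rewrite ler_nat leq_mul2r /index_iota subn0 cm orbT.
(* A knot of s that is not a left end, and the run of knots of s that ends there. *)
have [l /andP[ls lnl]] : exists l, inS l && ~~ left_end l.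
  apply: contrapT => h; have : (count inS (iota 0 L) <= count left_end (iota 0 L))%N.
    apply: sub_count => l ls; apply/negPn/negP => nl; apply: h; exists l.
    by rewrite ls nl.
  by move: count_inS cm; clear; lia.
have lm : (m <= l)%N.
  rewrite leqNgt; apply/negP => lm; move: (@yout l (or_introl lm)).
  by rewrite -[_ \in _]/(inS l) ls.
have run_l c : (l - m <= c <= l)%N -> inS c.
  move: lnl; rewrite /left_end ls/= negbK (minn_idPr lm) => h.
  move=> /andP[lc]; rewrite leq_eqVlt => /predU1P[->//|cl].
  by apply: (allP h); rewrite mem_iota; move: lc cl; clear; lia.
have iS0 : ~~ inS 0%N by apply: yout; left.
have [b [/andP[b0 bl] pb bs]] := maximal_run iS0 ls.
have blm : (b <= l - m)%N.
  by rewrite leqNgt; apply/negP => lb; move: pb; rewrite run_l//; move: lb b0 bl; clear; lia.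
have le_run j : (b <= j < b + m)%N -> left_end j.
  move=> jb; rewrite /left_end bs/=; last by move: jb blm lm; clear; lia.
  by apply/allPn; exists b.-1 => //; rewrite mem_iota; move: jb blm lm b0; clear; lia.
have run_le j : left_end j -> (b <= j < b + m)%N.
  move=> jl; apply: contrapT => nj; move: cm; apply/negP; rewrite -ltnNge.
  have u : uniq (j :: iota b m) by rewrite /= iota_uniq mem_iota andbT; apply/negP.
  rewrite -size_filter -(_ : size (j :: iota b m) = m.+1); last by rewrite /= size_iota.
  apply: uniq_leq_size => // i; rewrite inE mem_iota mem_filter => /predU1P[->|ib].
    by rewrite jl mem_iota/= add0n inS_lt// left_endS.
  by rewrite le_run// mem_iota/= add0n inS_lt// left_endS// le_run.
have xE : increasing_in E m (fun i => y (b + i)%N).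
  split=> [i j /andP[ij _]|i im]; first by rewrite ylt// ltn_add2l.
  by apply: sE; apply: bs; move: im blm lm; clear; lia.
have term k i : (k <= m)%N -> (i <= m - k)%N ->
    min_weight m m (fun i => y (b + i)%N) i * `|D k (b + i)| `^ p <= w `^ p.
  move=> km im; apply: le_trans (HV (leqnn m) xE).
  have mw0 i' : 0 <= min_weight m m (fun i => y (b + i)%N) i'.
    rewrite /min_weight; case: ifP => // _; rewrite le_min ler01 subr_ge0 yle//.
    by rewrite leq_add2l leq_addr.
  pose G k' := \sum_(i' < (m - k').+1) min_weight m m (fun i => y (b + i)%N) i' *
    `|consecutive_dd f (fun i => y (b + i)%N) k' i'| `^ p.
  have G0 k' : 0 <= G k' by apply: sumr_ge0 => i' _; rewrite mulr_ge0// powR_ge0.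
  have k1 : (k < m.+1)%N by [].
  apply: le_trans (le_term_sum G0 k1).
  have F0 i' : 0 <= min_weight m m (fun i => y (b + i)%N) i' *
    `|consecutive_dd f (fun i => y (b + i)%N) k i'| `^ p by rewrite mulr_ge0// powR_ge0.
  have i1 : (i < (m - k).+1)%N by [].
  apply: le_trans (le_term_sum F0 i1).
  have -> : D k (b + i) = consecutive_dd f (fun i => y (b + i)%N) k i.
    rewrite pure_dd; last by apply/pureP => j jb; apply: bs; move: jb km im blm lm; clear; lia.
    by congr divided_difference; apply/funext => j; rewrite /= addnA.
  by [].
have powR_inj_le (x z : R) : 0 <= x -> 0 <= z -> x `^ p <= z `^ p -> x <= z.
  move=> x0 z0; apply: contraTT; rewrite -!ltNge => zx.
  by apply: gt0_ltr_powR; rewrite ?nnegrE.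
(* Windows not starting at the first knot of the run. *)
have Dright k i : (0 < i)%N -> (k <= m)%N -> (i <= m - k)%N -> `|D k (b + i)| <= w.
  move=> i0 km im; apply: powR_inj_le => //; move: (term k i km im).
  by rewrite /min_weight ifF ?mul1r//; move: i0; clear; lia.
(* Windows starting there, by induction on how far their order is below m. *)
have Dleft r : (r < m)%N -> `|D (m - r.+1) b| <= r.+2%:R * w.
  have [d1|d1] := leP 1 (y (b + m)%N - y b).
    move=> rm; have rm1 : (m - r.+1 <= m)%N by exact: leq_subr.
    have := term (m - r.+1)%N 0%N rm1 (leq0n _).
    rewrite /min_weight/= leqnn addn0 (min_idPl d1) mul1r => /powR_inj_le h.
    by apply: le_trans (h _ _) _ => //; rewrite ler_peMl// ler1n.
  have step k : (k < m)%N -> `|D k b| <= w + `|D k.+1 b| * (y (b + k.+1)%N - y b).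
    move=> km; have -> : D k b = D k b.+1 - D k.+1 b * (y (b + k.+1)%N - y b).
      by rewrite D_rec; ring.
    have dk : 0 <= y (b + k.+1)%N - y b by rewrite subr_ge0 yle// leq_addr.
    apply: le_trans (ler_normB _ _) _; rewrite normrM (ger0_norm dk) lerD2r.
    by rewrite -addn1; apply: Dright => //; move: km; clear; lia.
  have dk_le k : (k <= m)%N -> 0 <= y (b + k)%N - y b <= y (b + m)%N - y b.
    by move=> km; rewrite subr_ge0 yle ?leq_addr//= lerD2r yle// leq_add2l.
  elim: r => [|r IH] rm.
    have m1m : (m - 1).+1 = m by move: rm; clear; lia.
    have := step (m - 1)%N; rewrite m1m => /(_ _)/le_trans; apply; first by move: rm; clear; lia.
    (* As d < 1 and p > 1, the p-th power of d is at most the weight d. *)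
    suff : `|D m b| * (y (b + m)%N - y b) <= w by lra.
    have d0 := dk_le m (leqnn m); set d := _ - _ in d0 d1 *.
    have {}d0 : 0 <= d by lra.
    apply: powR_inj_le; rewrite ?mulr_ge0// powRM//.
    have := term m 0%N (leqnn m) (leq0n _).
    rewrite /min_weight/= leqnn addn0 -/d (min_idPr (ltW d1)) [X in X <= _ -> _]mulrC.
    apply: le_trans; apply: ler_wpM2l; first exact: powR_ge0.
    rewrite -[leRHS](powRr1 d0); have [->|dn0] := eqVneq d 0.
      by rewrite !powR0 ?gt_eqF.
    by rewrite ger_powR ?(ltW p1)// lt_neqAle eq_sym dn0 d0 ltW.
  have rE : (m - r.+1 = (m - r.+2).+1)%N by move: rm; clear; lia.
  have := step (m - r.+2)%N; rewrite -rE => /(_ _)/le_trans; apply; first by move: rm; clear; lia.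
  have {}IH := IH (ltnW rm).
  have rm1 : (m - r.+1 <= m)%N by exact: leq_subr.
  have /andP[q0 q1] := dk_le _ rm1.
  apply: le_trans (_ : w + `|D (m - r.+1) b| * 1 <= _); last by rewrite -[r.+3%:R]natr1; lra.
  by rewrite lerD2l ler_wpM2l//; lra.
move=> /allP h.
have /run_le lb : left_end l0 by apply: h; rewrite mem_iota; clear; lia.
have /run_le lj : left_end (l0 + j0) by apply: h; rewrite mem_iota; clear; lia.
have [i0|i0] := ltnP b l0.
  have -> : l0 = (b + (l0 - b))%N by move: lb lj i0; clear; lia.
  apply: le_trans (Dright _ _ _ _ _) _; [move: lb lj i0; clear; lia|move: lb lj i0; clear; lia|move: lb lj i0; clear; lia|].
  by rewrite ler_peMl// ler1n.
have -> : l0 = b by move: lb lj i0; clear; lia.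
have -> : j0 = (m - (m - j0.+1).+1)%N by move: lb lj i0; clear; lia.
apply: le_trans (Dleft _ _) _; first by move: lb lj i0; clear; lia.
by apply: ler_wpM2r => //; rewrite ler_nat; move: lb lj i0; clear; lia.
Qed.

Let sum_T : \sum_(0 <= l < L) T l <= (2 + (m * m.+1)%:R) * (m.+1%:R * w) `^ p.
Proof.
rewrite /T big_split/=.
have ww : w `^ p <= (m.+1%:R * w) `^ p.
  apply: ge0_ler_powR; rewrite ?nnegrE ?mulr_ge0 ?(ltW p0)//.
  by rewrite ler_peMl// ler1n.
have e0 : 0 <= (m * m.+1)%:R * (m.+1%:R * w) `^ p by rewrite mulr_ge0// powR_ge0.
have h1 := sum_T1; have P0 : 0 <= (m.+1%:R * w) `^ p by exact: powR_ge0.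
rewrite mulrDl; have [cm|cm] := ltnP m (count left_end (iota 0 L)).
  have := sum_T2_many cm; rewrite /T2; lra.
have := sum_T2_few cm; rewrite /T2; lra.
Qed.

Lemma padded_dd_sum_upto n : (n + m <= L)%N ->
  \sum_(i < n) (y (i + m)%N - y i) * (\sum_(r < m.+1) `|D r i|) `^ p <=
  (variation_const R m * w) `^ p.
Proof.
move=> nL; have d0 i : 0 <= y (i + m)%N - y i by rewrite subr_ge0 yle// leq_addr.
set c := m.+1%:R : R; set c2 := 2 `^ (m%:R * p) : R.
have c0 : 0 <= c by [].
have c1 : 1 <= c by rewrite /c ler1n.
set ST := \sum_(0 <= l < L) T l.
have hT i : (i < n)%N -> (y (i + m)%N - y i) * (\sum_(r < m.+1) `|D r i|) `^ p <=
    c `^ p * (c * (2 * m%:R * c2)) * \sum_(e < m.+1) T (i + e)%N.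
  move=> ni; apply: le_trans (ler_wpM2l (d0 i) (powR_sum_le _ p0 (F := fun r => `|D r i|) (fun=> normr_ge0 _))) _.
  rewrite mulrCA -!mulrA; apply: ler_wpM2l; first exact: powR_ge0.
  rewrite mulr_sumr [leRHS]mulr_natl -[X in _ *+ X]card_ord -sumr_const.
  apply: ler_sum => r _; rewrite !mulrA; apply: term_le_T.
  by rewrite -ltnS.
apply: le_trans (_ : \sum_(i < n) c `^ p * (c * (2 * m%:R * c2)) * \sum_(e < m.+1) T (i + e)%N <= _).
  by apply: ler_sum => i _; exact: hT.
rewrite -mulr_sumr exchange_big/=.
have hST : \sum_(e < m.+1) \sum_(i < n) T (i + e)%N <= c * ST.
  rewrite mulr_natl -[X in _ *+ X]card_ord -sumr_const; apply: ler_sum => e _.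
  rewrite -(big_mkord xpredT (fun i => T (i + e)%N)) /ST.
  have en : (e + n <= L)%N by move: (leq_ord e) nL; clear; lia.
  rewrite (big_cat_nat (leq0n _) en)/= (big_cat_nat (leq0n _) (leq_addr n e))/=.
  have -> : \sum_(0 <= i < n) T (i + e)%N = \sum_(e <= i < e + n) T i.
    by have := @big_addn _ 0 +%R 0%N (e + n)%N e xpredT T; rewrite add0n addKn => ->.
  have h1 : 0 <= \sum_(0 <= i < e) T i by apply: sumr_ge0.
  have h2 : 0 <= \sum_(e + n <= i < L) T i by apply: sumr_ge0.
  by rewrite addrAC lerDr addr_ge0.
have cc0 : 0 <= c `^ p * (c * (2 * m%:R * c2)) by rewrite !mulr_ge0 ?powR_ge0.
apply: le_trans (ler_wpM2l cc0 hST) _.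
set K := c * (2 * m%:R) * c * (2 + (m * m.+1)%:R).
have K1 : 1 <= K.
  have mm1 : 1 <= 2 * m%:R :> R by have := m1; lra.
  have m2 : 1 <= 2 + (m * m.+1)%:R :> R by have : 0 <= (m * m.+1)%:R :> R by []; lra.
  exact: mulr_ege1 (mulr_ege1 (mulr_ege1 c1 mm1) c1) m2.
apply: le_trans (_ : c `^ p * c2 * (c * w) `^ p * K <= _).
  have -> : c `^ p * c2 * (c * w) `^ p * K =
    c `^ p * (c * (2 * m%:R * c2)) * (c * ((2 + (m * m.+1)%:R) * (c * w) `^ p)) by rewrite /K; ring.
  by apply: ler_wpM2l => //; apply: ler_wpM2l => //; exact: sum_T.
have -> : variation_const R m * w = c * 2 ^+ m * (c * w) * K by rewrite /variation_const /K /c; ring.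
have K0 : 0 <= K by apply: le_trans K1.
have p20 : 0 <= 2 ^+ m :> R by rewrite exprn_ge0.
have -> : (c * 2 ^+ m * (c * w) * K) `^ p = c `^ p * c2 * (c * w) `^ p * K `^ p.
  by rewrite !powRM ?mulr_ge0// /c2 powRrM powR_mulrn.
apply: ler_wpM2l; first by rewrite !mulr_ge0 ?powR_ge0.
by rewrite -[leLHS](powRr1 K0) ler_powR// ltW.
Qed.

End finite_exponent.

Lemma padded_dd_sum (p w : R) n : 1 < p -> 0 <= w ->
  (forall n x, (m <= n)%N -> increasing_in E n x ->
    \sum_(k < m.+1) \sum_(i < (n - k).+1)
      min_weight m n x i * `|consecutive_dd f x k i| `^ p <= w `^ p) ->
  \sum_(i < n) (y (i + m)%N - y i) * (\sum_(r < m.+1) `|D r i|) `^ p <=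
  (variation_const R m * w) `^ p.
Proof.
move=> p1 w0 HV; by apply: (@padded_dd_sum_upto p w p1 w0 HV (N + n + m)%N); lia.
Qed.

End padded_differences.

(** * Integrals over intervals *)
Section interval_integrals.
Context {R : realType}.
Implicit Types (f g F : R -> R) (a b c x : R).
Local Notation mu := (@lebesgue_measure R).

Lemma continuous_funB f g : continuous f -> continuous g ->
  continuous (fun x => f x - g x).
Proof. by move=> cf cg x; exact: (continuousB (cf x) (cg x)). Qed.

Lemma continuous_funM f g : continuous f -> continuous g ->
  continuous (fun x => f x * g x).
Proof. by move=> cf cg x; exact: (continuousM (cf x) (cg x)). Qed.

Lemma continuous_integrable_itv f a b : continuous f ->
  mu.-integrable `[a, b] (EFin \o f).
Proof.
move=> cf; apply: continuous_compact_integrable; first exact: segment_compact.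
exact: continuous_subspaceT.
Qed.

Lemma locally_integrable_itv g a b : locally_integrable setT g ->
  mu.-integrable `[a, b] (EFin \o g).
Proof.
move=> [mg _ gK]; apply/integrableP; split.
  by apply/measurable_EFinP; exact: measurable_funTS.
by have := gK _ (@subsetT _ _) (@segment_compact _ a b).
Qed.

Lemma continuous_locally_integrable f : continuous f -> locally_integrable setT f.
Proof.
move=> cf; split => //; first exact: continuous_measurable_fun.
  exact: openT.
move=> K _ cK; have cfK : {within K, continuous f} by exact: continuous_subspaceT.
by have /integrableP[] := continuous_compact_integrable cK cfK.
Qed.

Lemma integral_is_derive F f a b : a <= b ->
  (forall x, is_derive x 1 F (f x)) -> continuous f ->
  \int[mu]_(t in `[a, b]) f t = F b - F a.
Proof.
rewrite le_eqVlt => /predU1P[->|ab] dF cf.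
  by rewrite set_itv1 Rintegral_set1 subrr.
rewrite /Rintegral (continuous_FTC2 ab (F := F))//.
- exact: continuous_subspaceT.
- have cF : continuous F.
    by move=> x; apply/differentiable_continuous/derivable1_diffP; case: (dF x).
  split=> [x _| |]; first by case: (dF x).
    exact/cvg_at_right_filter/cF.
  exact/cvg_at_left_filter/cF.
- by move=> x _; rewrite derive1E; case: (dF x).
Qed.

Lemma Rintegral_itv_cat f a b c : a <= b -> b <= c ->
  mu.-integrable `[a, c] (EFin \o f) ->
  \int[mu]_(t in `[a, c]) f t =
  \int[mu]_(t in `[a, b]) f t + \int[mu]_(t in `[b, c]) f t.
Proof.
move=> ab bc i; apply/eqP; rewrite addrC -subr_eq; apply/eqP.
rewrite Rintegral_itvB// ?bnd_simp//.
apply: Rintegral_itv_obnd_cbnd; apply: integrableS i => //.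
by apply: subset_itvr; rewrite bnd_simp.
Qed.

Lemma Rintegral_itv_cst a b c : a <= b ->
  \int[mu]_(t in `[a, b]) c = c * (b - a).
Proof.
move=> ab; rewrite Rintegral_cst//= lebesgue_measure_itv/= lte_fin.
case: ifPn => [//|]; rewrite -leNgt => ba.
by have -> : a = b; [apply/eqP; rewrite eq_le ab ba|rewrite subrr].
Qed.

Lemma Rintegral_norm_le f (M : R) a b : a <= b ->
  mu.-integrable `[a, b] (EFin \o f) ->
  (forall x, a <= x <= b -> `|f x| <= M) ->
  `|\int[mu]_(t in `[a, b]) f t| <= M * (b - a).
Proof.
move=> ab i fM; apply: le_trans (le_normr_Rintegral _ i) _ => //.
rewrite -Rintegral_itv_cst//; apply: le_Rintegral => //.
- exact: integrable_norm.
- exact/continuous_integrable_itv/cst_continuous.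
Qed.

Lemma Rintegral_support f (D : set R) : (forall x, ~ D x -> f x = 0) ->
  \int[mu]_t f t = \int[mu]_(t in D) f t.
Proof.
move=> f0; rewrite [RHS]Rintegral_mkcond; congr (Rintegral _ _ _).
apply/funext => x; rewrite patchE; case: ifPn => // /negP xD.
by apply: f0 => Dx; apply: xD; rewrite inE.
Qed.

Lemma integrable_itvD f g a b : mu.-integrable `[a, b] (EFin \o f) ->
  mu.-integrable `[a, b] (EFin \o g) ->
  mu.-integrable `[a, b] (EFin \o (fun t => f t + g t)).
Proof. by move=> fi gi; apply: (integrableD _ fi gi). Qed.

Lemma integrable_itvZ c f a b : mu.-integrable `[a, b] (EFin \o f) ->
  mu.-integrable `[a, b] (EFin \o (fun t => c * f t)).
Proof. by move=> fi; apply: (integrableZl _ c fi). Qed.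

Lemma le_normr_Rintegral_itv f a b : mu.-integrable `[a, b] (EFin \o f) ->
  `|\int[mu]_(t in `[a, b]) f t| <= \int[mu]_(t in `[a, b]) `|f t|.
Proof. by move=> fi; exact: le_normr_Rintegral. Qed.

Lemma Rintegral_itvD f g a b : mu.-integrable `[a, b] (EFin \o f) ->
  mu.-integrable `[a, b] (EFin \o g) -> \int[mu]_(t in `[a, b]) (f t + g t) =
  \int[mu]_(t in `[a, b]) f t + \int[mu]_(t in `[a, b]) g t.
Proof. by move=> fi gi; rewrite RintegralD. Qed.

Lemma Rintegral_itv_sub f g a b : mu.-integrable `[a, b] (EFin \o f) ->
  mu.-integrable `[a, b] (EFin \o g) -> \int[mu]_(t in `[a, b]) (f t - g t) =
  \int[mu]_(t in `[a, b]) f t - \int[mu]_(t in `[a, b]) g t.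
Proof. by move=> fi gi; rewrite RintegralB. Qed.

Lemma integrable_itvM g f a b : a <= b -> mu.-integrable `[a, b] (EFin \o g) ->
  continuous f -> mu.-integrable `[a, b] (EFin \o (fun t => g t * f t)).
Proof.
move=> ab ig cf; have cn : {within `[a, b], continuous (fun x : R => `|f x|)}.
  apply: continuous_subspaceT => x.
  by apply: continuous_comp; [exact: cf|exact: norm_continuous].
have [z _ zB] := EVT_max ab cn.
rewrite (_ : EFin \o _ = (EFin \o f) \* (EFin \o g))%E; last first.
  by apply/funext => t /=; rewrite EFinM muleC.
apply: integrableMr => //.
  by apply: measurable_funTS; exact: continuous_measurable_fun.
exists `|f z|; split; first exact: num_real.
move=> M zM x xab; apply: le_trans (ltW zM); exact: zB.
Qed.

End interval_integrals.

(** * Extension from a finite set *)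
(** Bounded intervals keep the integrals finite and pass well to weak limits; by
    monotone convergence they determine the norm on the line. *)
Definition lp_bounded (R : realType) (p : \bar R) (K : R) (v : R -> R) : Prop :=
  match p with
  | r%:E => forall a b, (\int[lebesgue_measure]_(x in `[a, b]) (`|v x| `^ r)%:E
      <= (K `^ r)%:E)%E
  | _ => forall x, `|v x| <= K
  end.

Section finite_extension.
Context {R : realType}.
Local Notation mu := (@lebesgue_measure R).
Implicit Types (f F v : R -> R) (E : set R) (s : seq R) (k l m n : nat).

Lemma measurable_norm_powR v (p : R) (A : set R) : measurable_fun setT v ->
  measurable_fun A (fun x => (`|v x| `^ p)%:E).
Proof.
move=> mv; apply/measurable_EFinP/(@measurable_funS _ _ _ _ setT) => //.
by apply: (measurableT_comp (measurable_powR p)); exact: measurableT_comp.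
Qed.

Lemma smooth_measurable v k : smooth v -> measurable_fun setT v^`(k).
Proof. by move=> sv; apply: continuous_measurable_fun; exact: smooth_continuous. Qed.

Lemma lp_bounded0 (p : \bar R) (K : R) : 0 <= K -> (1 < p)%E -> lp_bounded p K (fun=> 0).
Proof.
case: p => [p| |//] K0 p1; last by move=> x; rewrite normr0.
move=> a b; rewrite integral0_eq ?lee_fin ?powR_ge0// => x _.
by rewrite normr0 powR0// gt_eqF// (lt_trans ltr01).
Qed.

Lemma smooth_step_bounds m : exists2 B : R, 1 <= B &
  forall k x, (k <= m)%N -> `|(@smooth_step R)^`(k) x| <= B.
Proof.
elim: m => [|m [B B1 HB]].
  have [B B1 HB] := @derive1n_smooth_step_bounded R 0.
  by exists B => // k x; rewrite leqn0 => /eqP ->.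
have [B' B'1 HB'] := @derive1n_smooth_step_bounded R m.+1.
exists (Num.max B B'); first by rewrite le_max B1.
move=> k x; rewrite leq_eqVlt => /predU1P[->|km]; rewrite le_max; first by rewrite HB' orbT.
by rewrite HB.
Qed.

Lemma variation_sum_le m (p w : R) E f n x : 0 < p -> 0 <= w ->
  (variation_functional m p%:E E f <= w%:E)%E -> (m <= n)%N -> increasing_in E n x ->
  \sum_(k < m.+1) \sum_(i < (n - k).+1)
    min_weight m n x i * `|consecutive_dd f x k i| `^ p <= w `^ p.
Proof.
move=> p0 w0 Ww mn xE; set S := \sum_(k < _) _.
have S0 : 0 <= S.
  apply: sumr_ge0 => k _; apply: sumr_ge0 => i _; rewrite mulr_ge0 ?powR_ge0// /min_weight.
  case: ifP => // im; rewrite le_min ler01 subr_ge0/=.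
  have := leq_addr m i; rewrite leq_eqVlt => /predU1P[<-//|ii].
  by apply/ltW/(xE.1); rewrite ii im.
have : (variation_sum m p f n x `^ p^-1 <= w%:E)%E.
  by apply: le_trans Ww; apply: ereal_sup_ubound; exists n, x.
rewrite variation_sumE poweR_EFin lee_fin -/S => h.
have -> : S = (S `^ p^-1) `^ p by rewrite -powRrM mulVf ?gt_eqF// powRr1.
by apply: ge0_ler_powR; rewrite ?nnegrE ?powR_ge0// ltW.
Qed.

Lemma integral_knots (y : nat -> R) (h : R -> R) (c : nat -> R) (L : nat) (a : R) :
  (forall l, y l < y l.+1) -> measurable_fun setT h ->
  (forall x, 0 <= h x) -> (forall x, x <= y 0%N -> h x = 0) ->
  (forall l x, y l <= x <= y l.+1 -> h x <= c l) -> a <= y 0%N ->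
  (\int[mu]_(x in `[a, y L]) (h x)%:E <= (\sum_(l < L) (y l.+1 - y l) * c l)%:E)%E.
Proof.
move=> yS mh h0 hl hc ay; elim: L => [|L IH].
  rewrite big_ord0 integral0_eq// => x /=; rewrite in_itv/= => /andP[_ /hl ->//].
have mhE (A : set R) : measurable_fun A (EFin \o h).
  by apply/measurable_EFinP; exact: measurable_funS mh.
have aL : a <= y L by apply: le_trans ay _; elim: (L) => // n /le_trans; apply; exact: ltW.
have U : `[a, y L.+1]%classic = `[a, y L] `|` `]y L, y L.+1].
  by rewrite -itv_bndbnd_setU// bnd_simp// ltW.
rewrite U ge0_integral_setU//=; last 3 first.
- exact: mhE.
- by move=> x _; rewrite lee_fin.
- rewrite disj_set2E; apply/eqP/seteqP; split => // x /=.
  by rewrite !in_itv/= => -[/andP[_ xy] /andP[yx _]]; move: (lt_le_trans yx xy); rewrite ltxx.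
rewrite big_ord_recr/= EFinD; apply: leeD IH _.
apply: le_trans (_ : \int[mu]_(x in `]y L, y L.+1]) (cst (c L)%:E x) <= _)%E.
  apply: ge0_le_integral => //=.
  - by move=> x _; rewrite lee_fin.
  - exact: mhE.
  - move=> x; rewrite in_itv/= => /andP[/ltW xa xb].
    by rewrite lee_fin; apply: hc; rewrite xa xb.
rewrite integral_cst//= lebesgue_measure_itv/= lte_fin yS -EFinD lee_fin.
by rewrite mulrC.
Qed.

Lemma sum_steps_le (y : nat -> R) (i m L : nat) : (forall l, y l < y l.+1) ->
  \sum_(0 <= l < L) (if (i <= l < i + m)%N then y l.+1 - y l else 0) <= y (i + m)%N - y i.
Proof.
move=> yS; have -> : \sum_(0 <= l < L) (if (i <= l < i + m)%N then y l.+1 - y l else 0) =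
    y (i + minn (L - i) m)%N - y i.
  elim: L => [|L IH]; first by rewrite big_geq// sub0n min0n addn0 subrr.
  rewrite big_nat_recr//= IH; case: ifPn => iL.
    have -> : (i + minn (L.+1 - i) m = L.+1)%N by lia.
    have -> : (i + minn (L - i) m = L)%N by lia.
    by rewrite addrC addrA subrK.
  by rewrite addr0; congr (y _ - _); lia.
have h : (i + minn (L - i) m <= i + m)%N by lia.
rewrite lerD2r; move: h; rewrite leq_eqVlt => /predU1P[->//|h].
by apply/ltW; apply: (homo_ltn lt_trans yS).
Qed.

(** Each index i contributes to the m intervals between knots that make up its
    window. *)
Lemma sum_windows_le (y : nat -> R) (b : nat -> R) (m L : nat) :
  (forall l, y l < y l.+1) -> (forall i, 0 <= b i) ->
  \sum_(l < L) (y l.+1 - y l) * \sum_(l.+1 - m <= i < l.+1) b i <=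
  \sum_(i < L) (y (i + m)%N - y i) * b i.
Proof.
move=> yS b0; rewrite -(big_mkord xpredT (fun l => (y l.+1 - y l) * \sum_(l.+1 - m <= i < l.+1) b i)).
rewrite -(big_mkord xpredT (fun i => (y (i + m)%N - y i) * b i)).
rewrite big_nat (eq_bigr (fun l => \sum_(0 <= i < L)
    (if (i <= l < i + m)%N then y l.+1 - y l else 0) * b i)); last first.
  move=> l /andP[_ lL]; rewrite (big_nat_widen _ _ L)// (big_nat_widenl _ 0%N)//.
  rewrite big_distrr/= big_mkcond/=; apply: eq_bigr => i _.
  rewrite andbC; have -> : ((l.+1 - m <= i) && (i < l.+1))%N = (i <= l < i + m)%N by lia.
  by case: ifP => // _; rewrite mul0r.
rewrite -big_nat exchange_big/=; apply: ler_sum => i _.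
by rewrite -mulr_suml; apply: ler_wpM2r => //; exact: sum_steps_le.
Qed.

(** The constant depends on m only: the spline costs K, each point sees m windows,
    and variation_const comes from the sum over all windows. *)
Lemma finite_extension m : (0 < m)%N -> exists2 C : R, 1 <= C &
  forall (p : \bar R) (w : R) E f s, (1 < p)%E -> 0 <= w ->
  (variation_functional m p E f <= w%:E)%E ->
  uniq s -> (forall x, x \in s -> E x) -> (m < size s)%N ->
  exists F, [/\ smooth F, forall x, x \in s -> F x = f x &
    forall k, (k <= m)%N -> lp_bounded p (C * w) F^`(k)].
Proof.
case: m => // m' _; set m := m'.+1.
have [B B1 HB] := smooth_step_bounds m.
set K := spline_const m B.
have m1 : (1:R) <= m%:R by rewrite ler1n.
have K1 : 1 <= K.
  rewrite /K /spline_const; apply: le_trans (_ : (2 ^+ m * (2 * m%:R)) ^+ m <= _).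
    rewrite exprn_ege1// mulr_ege1//; first by rewrite exprn_ege1// ler1n.
    by lra.
  by rewrite lerDl !mulr_ge0 ?exprn_ge0 ?mulr_ge0 ?exprn_ge0//; lra.
have K0 : 0 <= K by lra.
have vc1 : m.+1%:R * 2 ^+ m <= variation_const R m.
  have e1 : (1:R) <= m.+1%:R by rewrite ler1n.
  have mm1 : 1 <= 2 * m%:R :> R by lra.
  have m2 : 1 <= 2 + (m * m.+1)%:R :> R by have : 0 <= (m * m.+1)%:R :> R by []; lra.
  rewrite /variation_const -[leLHS]mulr1 -[leRHS]mulrA; apply: ler_wpM2l.
    by rewrite mulr_ge0// exprn_ge0.
  exact: mulr_ege1 e1 (mulr_ege1 (mulr_ege1 (mulr_ege1 e1 mm1) e1) m2).
have vc11 : 1 <= variation_const R m.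
  by apply: le_trans vc1; rewrite mulr_ege1 ?ler1n// exprn_ege1// ler1n.
exists (K * m%:R * variation_const R m); first exact: mulr_ege1 (mulr_ege1 K1 m1) vc11.
move=> p w E f s p1 w0 Ww us sE ms.
have s0 : s != [::] by case: (s) ms.
have [y [N [yS y2 y1 yout ysurj]]] := @knot_sequence R m s isT s0.
pose f' := zero_outside f s.
have f'0 l : y l \notin s -> f' (y l) = 0 by rewrite /f' /zero_outside => /negbTE ->.
have c0 i : (N <= i)%N ->
    (y (i + m)%N - y i) * divided_difference f' m (fun j => y (i + j)%N) = 0.
  move=> Ni; rewrite /divided_difference big1 ?mulr0// => j _.
  by rewrite f'0 ?mul0r//; apply: yout; right; rewrite (leq_trans Ni)// leq_addr.
have f0 i : (i < m)%N -> f' (y i) = 0 by move=> im; apply/f'0/yout; left.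
pose F := spline m' y f' N.
have sF : smooth F by exact: smooth_spline.
exists F; split=> // [x xs|k km].
  have [l yl] := ysurj x xs; rewrite -yl /F (@spline_interpolates _ m' y f' yS N c0 f0).
  by rewrite /f' /zero_outside yl xs.
pose b i : R := \sum_(r < m.+1) `|consecutive_dd f' y r i|.
have b0 i : 0 <= b i by apply: sumr_ge0.
have Fb l t : y l <= t <= y l.+1 -> `|F^`(k) t| <= K * \sum_(l.+1 - m <= i < l.+1) b i.
  by move=> /andP[lt tl]; exact: (@spline_bound _ m' y f' yS N c0 f0 B B1 HB y2).
have F0 t : t <= y 0%N -> F^`(k) t = 0 by exact: (@spline_left _ m' y f' yS N).
have yge l : y (N + l)%N >= y N + l%:R.
  elim: l => [|l IH]; first by rewrite addn0 addr0.
  have : ~~ ((y (N + l)%N \in s) && (y (N + l).+1 \in s)).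
    by rewrite negb_and yout//; right; rewrite leq_addr.
  by move=> /y1; rewrite addnS -natr1; lra.
have ybig t : exists L, t <= y L.
  exists (N + Num.truncn (`|t - y N|)).+1; rewrite -addnS.
  apply: le_trans (yge _); have := truncnS_gt `|t - y N|; have := ler_norm (t - y N); lra.
case: p p1 Ww => [p| |//] p1 Ww.
  rewrite lte_fin in p1; have p0 : 0 < p by apply: lt_trans p1.
  move=> a e; have [L eL] := ybig e.
  set h := fun x => `|F^`(k) x| `^ p.
  pose S l := (K * m%:R) `^ p * \sum_(l.+1 - m <= i < l.+1) b i `^ p.
  have hS l x : y l <= x <= y l.+1 -> h x <= S l.
    move=> /Fb Fl; rewrite /h /S; set a_ := (l.+1 - m)%N.
    apply: le_trans (_ : (K * \sum_(a_ <= i < l.+1) b i) `^ p <= _).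
      by apply: ge0_ler_powR; rewrite ?nnegrE ?(ltW p0)// mulr_ge0// sumr_ge0.
    rewrite (powRM _ K0) ?sumr_ge0// (powRM _ K0)//.
    rewrite -[leRHS]mulrA; apply: ler_wpM2l; first exact: powR_ge0.
    rewrite -[X in index_iota X](add0n a_) !big_addn !big_mkord.
    apply: le_trans (powR_sum_le _ p0 (F := fun i => b (i + a_)%N) (fun=> b0 _)) _.
    apply: ler_wpM2r; first by apply: sumr_ge0 => i _; exact: powR_ge0.
    by apply: ge0_ler_powR; rewrite ?nnegrE ?(ltW p0)// ler_nat /a_; clear; lia.
  pose a0 : R := Num.min a (y 0%N).
  have mh : measurable_fun setT h.
    by apply/measurable_EFinP; apply: measurable_norm_powR; exact: (@smooth_measurable F k sF).
  apply: le_trans (_ : \int[mu]_(x in `[a0, y L]) (h x)%:E <= _)%E.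
    apply: ge0_subset_integral => //.
    - by apply/measurable_EFinP; exact: measurable_funS mh.
    - move=> x /=; rewrite !in_itv/= => /andP[ax xe].
      by rewrite (le_trans xe eL) andbT ge_min ax.
  apply: le_trans (integral_knots L yS mh _ _ hS _) _.
  - by move=> x; exact: powR_ge0.
  - by move=> x xy; rewrite /h F0// normr0 powR0// gt_eqF.
  - by rewrite ge_min lexx orbT.
  rewrite lee_fin.
  have HV := @variation_sum_le m p w E f _ _ p0 w0 Ww.
  have m0 : (0 < m)%N by [].
  have := padded_dd_sum m0 sE us ms yS y2 y1 yout ysurj L p1 w0 HV => hp.
  have Km0 : 0 <= K * m%:R by rewrite mulr_ge0.
  have vw0 : 0 <= variation_const R m * w by rewrite mulr_ge0// (le_trans ler01).
  rewrite -[K * _ * _ * _]mulrA (powRM _ Km0 vw0).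
  apply: le_trans (ler_wpM2l (powR_ge0 _ _) hp).
  apply: le_trans (ler_wpM2l (powR_ge0 _ _) (sum_windows_le m L yS (b := fun i => b i `^ p) (fun=> powR_ge0 _ _))).
  rewrite mulr_sumr; apply: ler_sum => l _.
  by rewrite /S mulrCA.
move=> t; have [t0|t0] := leP t (y 0%N).
  by rewrite F0// normr0 !mulr_ge0//; lra.
have [l /Fb Fl] : exists l, y l <= t <= y l.+1.
  have [L tL] := ybig t; elim: L tL => [/(lt_le_trans t0)|L IH tL]; first by rewrite ltxx.
  by have [/IH//|Lt] := leP t (y L); exists L; rewrite tL ltW.
apply: le_trans Fl _; rewrite -(mulrA (K * m%:R)) -(mulrA K); apply: ler_wpM2l => //.
have bw i : b i <= variation_const R m * w.
  have m0 : (0 < m)%N by [].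
  apply: le_trans (padded_dd_bound m0 sE us ms yS y1 i w0 _) _.
    move=> j x jm xE; rewrite -lee_fin; apply: le_trans Ww.
    by apply: ereal_sup_ubound; exists j, x.
  by rewrite mulrA; exact: ler_wpM2r.
apply: le_trans (_ : \sum_(l.+1 - m <= i < l.+1) variation_const R m * w <= _).
  by apply: ler_sum.
rewrite big_const_seq iter_addr_0 -[leLHS]mulr_natl; apply: ler_wpM2r.
  by apply: le_trans (bw 0%N).
by rewrite ler_nat count_predT size_iota; clear; lia.
Qed.

End finite_extension.

(** * Limits along filters and ultrafilters *)
Section filter_limit.
Context {R : realType} {X : Type} {F : set_system X} {FF : ProperFilter F}.

Lemma cvg_le_bound (a : X -> R) (l c : R) :
  a s @[s --> F] --> l -> (\forall s \near F, a s <= c) -> l <= c.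
Proof. by move=> al ac; apply: (closed_cvg _ (@closed_le R c) ac _ al). Qed.

Lemma cvg_norm_le_bound (a : X -> R) (l c : R) :
  a s @[s --> F] --> l -> (\forall s \near F, `|a s| <= c) -> `|l| <= c.
Proof. by move=> al ac; apply: cvg_le_bound ac; exact: cvg_norm. Qed.

End filter_limit.

Section ultralimit.
Context {R : realType} {X : Type} (U : set_system X) {UF : UltraFilter U}.
Implicit Types a b : X -> R.

Lemma ultra_cvg a (M : R) :
  (forall s, `|a s| <= M) -> a s @[s --> U] --> lim (a s @[s --> U]).
Proof.
move=> aM.
have UFa : UltraFilter (a @ U).
  split; first exact: fmap_proper_filter.
  move=> G GF aUG; rewrite predeqE => A; split; last exact: aUG.
  move=> GA; have [//|UnA] := in_ultra_setVsetC (a @^-1` A) UF.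
  have /filter_ex[x []//] : G (A `&` ~` A) by apply: filterI => //; exact: aUG.
have := @segment_compact R (- M) M.
rewrite compact_ultra /= => /(_ (a @ U) UFa) [].
  by apply: nearW => s /=; rewrite in_itv/= -ler_norml.
by move=> l [_ al]; apply/cvg_ex; exists l.
Qed.

End ultralimit.

(** * Weak compactness of equi-integrable families *)
Section dunford_pettis.
Context d (T : measurableType d) (R : realType).
Variable mu : {sigma_finite_measure set T -> \bar R}.
Context (X : Type) (U : set_system X) {UF : UltraFilter U}.
Context (v : X -> T -> R) (D : set T) (mD : measurable D) (M : R).
Hypothesis muD : (mu D < +oo)%E.
Hypothesis iv : forall s, mu.-integrable D (EFin \o v s).
Hypothesis vM : forall s, \int[mu]_(x in D) `|v s x| <= M.
Hypothesis equi : forall e : R, 0 < e -> exists2 dl : R, 0 < dl &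
  forall s A, measurable A -> A `<=` D -> (mu A < dl%:E)%E ->
    \int[mu]_(x in A) `|v s x| <= e.

Let J (A : set T) s := \int[mu]_(x in A `&` D) v s x.
Let nu (A : set T) := (lim (J A s @[s --> U]))%:E.

Let ivA A s : measurable A -> mu.-integrable (A `&` D) (EFin \o v s).
Proof.
by move=> mA; apply: integrableS (iv s) => //; exact: measurableI.
Qed.

Let JM A s : measurable A -> `|J A s| <= M.
Proof.
move=> mA; apply: le_trans (vM s).
apply: le_trans (le_normr_Rintegral (measurableI _ _ mA mD) (ivA s mA)) _.
have mAD := measurableI _ _ mA mD.
have ia : mu.-integrable D (EFin \o (fun x => `|v s x|)) by exact: integrable_norm.
rewrite /Rintegral fine_le//.
- by apply: integrable_fin_num => //; apply: integrableS ia.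
- exact: integrable_fin_num.
- apply: ge0_subset_integral => //; exact: measurable_int ia.
Qed.

Let Jc A : measurable A -> J A s @[s --> U] --> lim (J A s @[s --> U]).
Proof. by move=> mA; apply: (@ultra_cvg _ _ _ _ _ M) => s; exact: JM. Qed.

Let Jle e dl A : (forall s A, measurable A -> A `<=` D -> (mu A < dl%:E)%E ->
    \int[mu]_(x in A) `|v s x| <= e) -> measurable A ->
  (mu (A `&` D) < dl%:E)%E -> `|lim (J A s @[s --> U])| <= e.
Proof.
move=> H mA Adl.
apply: cvg_norm_le_bound (Jc mA) _; apply: nearW => s.
apply: le_trans (le_normr_Rintegral (measurableI _ _ mA mD) (ivA s mA)) _.
apply: H => //; exact: measurableI.
Qed.

Let JU A B s : measurable A -> measurable B -> A `&` B = set0 ->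
  J (A `|` B) s = J A s + J B s.
Proof.
move=> mA mB AB; rewrite /J setIUl Rintegral_setU//.
- exact: measurableI.
- exact: measurableI.
- rewrite -setIUl; apply: ivA; exact: measurableU.
- apply/disj_setPS => x [[Ax _] [Bx _]]; by rewrite -AB.
Qed.

Let nuU A B : measurable A -> measurable B -> A `&` B = set0 ->
  nu (A `|` B) = (nu A + nu B)%E.
Proof.
move=> mA mB AB; rewrite /nu -EFinD; congr EFin.
apply: cvg_lim => //; under eq_fun do rewrite JU//.
by apply: cvgD; exact: Jc.
Qed.

Let nu0 : nu set0 = 0%E.
Proof.
rewrite /nu; congr EFin; apply: cvg_lim => //.
under eq_fun do rewrite /J set0I Rintegral_set0.
exact: cvg_cst.
Qed.

Let nufin A : measurable A -> nu A \is a fin_num.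
Proof. by []. Qed.

Let nus : semi_sigma_additive nu.
Proof.
move=> F mF tF mUF.
have sumE n : (\sum_(0 <= i < n) nu (F i))%E = nu (\bigcup_(i < n) F i).
  elim: n => [|n IHn]; first by rewrite big_geq// bigcup_mkord big_ord0 nu0.
  rewrite big_nat_recr//= IHn -nuU//.
  - by rewrite !bigcup_mkord big_ord_recr.
  - exact: bigcup_measurable.
  - apply/seteqP; split => // x [[i /= ni Fi] Fn].
    have /trivIsetP/(_ i n I I) := tF.
    rewrite ltn_eqF// => /(_ isT) FF; by have : (F i `&` F n) x by []; rewrite FF.
pose G n := \bigcup_i F i `\` \bigcup_(i < n) F i.
have mG n : measurable (G n) by apply: measurableD => //; exact: bigcup_measurable.
have nuE n : nu (\bigcup_i F i) = (nu (\bigcup_(i < n) F i) + nu (G n))%E.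
  rewrite -nuU//; [|exact: bigcup_measurable|].
    congr nu; rewrite /G setDUK//.
    by apply: bigcup_subset.
  by rewrite setDIK.
have capG : \bigcap_n (G n `&` D) = set0.
  rewrite -subset0 => x Gx; have [[[i _ Fix] _] _] := Gx 0 I.
  by have [[_ +] _] := Gx i.+1 I; apply; exists i => //=.
have muG : mu (G n `&` D) @[n --> \oo] --> 0%E.
  rewrite -(measure0 mu) -capG; apply: nonincreasing_cvg_mu.
  - apply: le_lt_trans muD; apply: le_measure; rewrite ?inE//.
    exact: measurableI.
  - by move=> n; exact: measurableI.
  - by rewrite capG.
  - move=> n k nk; apply/subsetPset => x [[Fx nFx] Dx]; split => //; split => //.
    by move=> [i /= ik Fix]; apply: nFx; exists i => //=; exact: leq_trans nk.
under eq_fun do rewrite sumE.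
rewrite /nu; apply: cvg_EFin; first by apply: nearW.
apply/cvgrPdist_le => /= e e0.
have [dl dl0 H] := equi e0.
have := muG => /fine_cvgP[_ /cvgrPdist_lt/(_ _ dl0)].
apply: filterS => n; rewrite sub0r normrN => Gdl.
have nE := nuE n; rewrite /nu in nE; case: nE => ->; rewrite [X in X - _]addrC addrK.
apply: (Jle H) => //.
have muGf : mu (G n `&` D) \is a fin_num.
  rewrite ge0_fin_numE//; apply: le_lt_trans muD; apply: le_measure; rewrite ?inE//.
  exact: measurableI.
rewrite -(fineK muGf) lte_fin; apply: le_lt_trans Gdl; exact: ler_norm.
Qed.

HB.instance Definition _ := isCharge.Build _ _ _ nu nu0 nufin nus.

Let nu_dom : nu `<< mu.
Proof.
apply/null_content_dominatesP => A mA A0; rewrite /nu; congr EFin.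
apply/eqP; rewrite -normr_le0; apply/ler_addgt0Pl => e e0; rewrite addr0.
have [dl dl0 H] := equi e0; apply: (Jle H) => //.
apply: le_lt_trans (_ : 0 < dl%:E)%E; last by rewrite lte_fin.
rewrite -A0; apply: le_measure; rewrite ?inE//; exact: measurableI.
Qed.

(** Equi-integrability makes the limit of the integrals along the ultrafilter
    countably additive in the domain of integration, and absolutely continuous;
    its density is the weak limit. *)
Lemma equiintegrable_weak_limit : exists2 g : T -> R,
  mu.-integrable D (EFin \o g) & forall A, measurable A -> A `<=` D ->
    \int[mu]_(x in A) v s x @[s --> U] --> \int[mu]_(x in A) g x.
Proof.
pose f := Radon_Nikodym nu mu.
have fE x : f x = (fine (f x))%:E by rewrite fineK//; exact: Radon_Nikodym_fin_num.
have ig : mu.-integrable setT f := Radon_Nikodym_integrable nu_dom.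
exists (fun x => fine (f x)).
  apply: (integrableS measurableT mD _) => //.
  by rewrite (_ : _ \o _ = f)//; apply/funext => x /=; rewrite -fE.
move=> A mA AD; have -> : \int[mu]_(x in A) fine (f x) = lim (J A s @[s --> U]).
  rewrite /Rintegral; under eq_integral do rewrite -fE.
  by rewrite -(Radon_Nikodym_integral nu_dom mA).
suff <- : J A = fun s => \int[mu]_(x in A) v s x by exact: Jc.
by apply/funext => s; rewrite /J (setIidl AD).
Qed.

End dunford_pettis.

(** * Functions bounded in L^p *)
Section lp_bounded_families.
Context {R : realType}.
Local Notation mu := (@lebesgue_measure R).
Implicit Types (v u : R -> R) (a b x T e K : R) (A : set R).

Lemma sub_itv_measure_lty A a b : measurable A -> A `<=` `[a, b] -> (mu A < +oo)%E.
Proof.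
move=> mA Aab; apply: le_lt_trans (_ : mu `[a, b] < +oo)%E.
  by apply: le_measure; rewrite ?inE//; exact: measurable_itv.
by rewrite /= lebesgue_measure_itv/=; case: ifP => _; rewrite ?ltry.
Qed.

Lemma Rintegral_ge0_le f A (c : R) : (forall x, 0 <= f x) ->
  (\int[mu]_(x in A) (f x)%:E <= c%:E)%E -> \int[mu]_(x in A) f x <= c.
Proof.
move=> f0 fc; rewrite -lee_fin /Rintegral fineK//.
by rewrite ge0_fin_numE ?(le_lt_trans fc) ?ltry//; apply: integral_ge0 => x _; rewrite lee_fin.
Qed.

Lemma continuous_integrable_sub v A a b : continuous v -> measurable A ->
  A `<=` `[a, b] -> mu.-integrable A (EFin \o v).
Proof.
move=> cv mA Aab; apply: integrableS (continuous_integrable_itv a b cv) => //.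
Qed.

(** Truncating v at the level T leaves an error controlled by the p-norm, so that
    boundedness in L^p with p > 1 makes the integrals uniformly absolutely
    continuous. *)
Lemma lp_bounded_equi (p : \bar R) K e : (1 < p)%E -> 0 <= K -> 0 < e ->
  exists2 T, 0 <= T & forall v A a b, continuous v -> lp_bounded p K v ->
    measurable A -> A `<=` `[a, b] -> \int[mu]_(x in A) `|v x| <= T * fine (mu A) + e.
Proof.
move=> p1 K0 e0; case: p p1 => [p| |//] p1; last first.
  exists K => // v A a b cv vK mA Aab; have Ay := sub_itv_measure_lty mA Aab.
  apply: Rintegral_ge0_le => //.
  apply: le_trans (_ : \int[mu]_(x in A) cst K%:E x <= _)%E.
    apply: ge0_le_integral => //=.
    - by apply/measurable_EFinP/measurable_funTS/measurableT_comp => //; exact: continuous_measurable_fun.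
    - by move=> x _; rewrite lee_fin.
  rewrite integral_cst// EFinD EFinM fineK; last by rewrite ge0_fin_numE// measure_ge0.
  by rewrite leeDl// lee_fin ltW.
rewrite lte_fin in p1; have p0 : 0 < p by lra.
pose q := p - 1; have q0 : 0 < q by rewrite /q; lra.
have Kp0 : 0 <= K `^ p by exact: powR_ge0.
(* Where `|v| > T one has `|v| <= `|v| ^ p / T ^ q, and T makes K ^ p / T ^ q <= e. *)
pose T := ((K `^ p + 1) / e) `^ q^-1.
have T0 : 0 < T by rewrite powR_gt0// divr_gt0//; lra.
have Tq : T `^ q = (K `^ p + 1) / e.
  by rewrite -powRrM mulVf ?gt_eqF// powRr1// divr_ge0//; lra.
have Tq0 : 0 < T `^ q by exact: powR_gt0.
have KT : K `^ p / T `^ q <= e.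
  by rewrite Tq invf_div mulrA ler_pdivrMr; nra.
exists T; first exact: ltW.
move=> v A a b cv vK mA Aab; have Ay := sub_itv_measure_lty mA Aab.
have mv : measurable_fun setT v by exact: continuous_measurable_fun.
have pw x : `|v x| <= T + (T `^ q)^-1 * `|v x| `^ p.
  have [vT|Tv] := leP `|v x| T.
    by apply: le_trans vT _; rewrite lerDl mulr_ge0 ?powR_ge0// invr_ge0 ltW.
  apply: le_trans (_ : (T `^ q)^-1 * `|v x| `^ p <= _); last by rewrite lerDr ltW.
  rewrite mulrC ler_pdivlMr// -(mulr_powRB1 _ p0)//; apply: ler_wpM2l => //.
  by apply: ge0_ler_powR; rewrite ?nnegrE ?(ltW T0) ?(ltW Tv) ?(ltW q0).
apply: Rintegral_ge0_le => //.
apply: le_trans (_ : \int[mu]_(x in A) (cst T%:E x + (T `^ q)^-1%:E * (`|v x| `^ p)%:E) <= _)%E.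
  apply: ge0_le_integral => //=.
  - by apply/measurable_EFinP/measurable_funTS/measurableT_comp.
  - apply: emeasurable_funD => //; apply: emeasurable_funM => //.
    exact: measurable_norm_powR.
  - by move=> x _; rewrite -EFinM -EFinD lee_fin.
have mp : measurable_fun A (fun x => (`|v x| `^ p)%:E) by exact: measurable_norm_powR.
have Ti : 0 <= (T `^ q)^-1 by rewrite invr_ge0 ltW.
rewrite ge0_integralD//=; last 3 first.
- by move=> x _; rewrite lee_fin ltW.
- by move=> x _; rewrite -EFinM lee_fin mulr_ge0// powR_ge0.
- by apply: emeasurable_funM.
have := @integral_cst _ _ _ mu A mA T%:E; rewrite /= => ->.
rewrite EFinD EFinM fineK; last by rewrite ge0_fin_numE// measure_ge0.
apply: leeD => //; rewrite ge0_integralZl//.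
apply: le_trans (_ : (T `^ q)^-1%:E * (K `^ p)%:E <= _)%E.
  apply: lee_wpmul2l; first by rewrite lee_fin.
  apply: le_trans (vK a b); apply: ge0_subset_integral => //.
  exact: measurable_norm_powR.
by rewrite -EFinM lee_fin mulrC.
Qed.

Lemma derivative_increment_le v v' T e a b : a <= b -> continuous v' ->
  (forall x, is_derive x 1 v (v' x)) ->
  (forall A a b, measurable A -> A `<=` `[a, b] ->
    \int[mu]_(x in A) `|v' x| <= T * fine (mu A) + e) ->
  `|v b - v a| <= T * (b - a) + e.
Proof.
move=> ab cv' dv h; rewrite -(integral_is_derive ab dv cv').
apply: le_trans (le_normr_Rintegral_itv (continuous_integrable_itv a b cv')) _.
have := h `[a, b]%classic a b (measurable_itv _).
rewrite /= lebesgue_measure_itv/= lte_fin => /(_ (fun=> id)); case: ltP => // ba.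
have -> : b = a by apply/eqP; rewrite eq_le ab ba.
by rewrite subrr.
Qed.

(** A function that varies little on an interval of length 1 is close to its
    average there. *)
Lemma sup_le_integral v v' c x : continuous v -> continuous v' ->
  (forall x, is_derive x 1 v (v' x)) ->
  \int[mu]_(t in `[x, x + 1]) `|v t| <= c ->
  (forall y, x <= y <= x + 1 -> `|v y - v x| <= c) -> `|v x| <= c + c.
Proof.
move=> cv cv' dv vc v'c; have x1 : x <= x + 1 by lra.
have cn : continuous (fun t => `|v t|).
  by move=> t; apply: cvg_norm; exact: cv.
have : \int[mu]_(t in `[x, x + 1]) (`|v x| - c) <= \int[mu]_(t in `[x, x + 1]) `|v t|.
  apply: le_Rintegral.
  - exact: measurable_itv.
  - by apply: continuous_integrable_itv => t; exact: cst_continuous.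
  - exact: continuous_integrable_itv.
  - move=> t /=; rewrite in_itv/= => /v'c.
    by have := lerB_dist (v x) (v t); rewrite distrC; lra.
have x2 : x + 1 - x = 1 by ring.
by rewrite Rintegral_itv_cst// x2 mulr1; lra.
Qed.

End lp_bounded_families.

(** * Limits of equicontinuous families *)
Section equicontinuous_limit.
Context {R : realType} (X : Type) (U : set_system X) {FU : ProperFilter U}.
Variables (v : X -> R -> R) (u : R -> R).
Local Notation mu := (@lebesgue_measure R).
Implicit Types (a b x T e : R) (A : set R).
Hypothesis cv : forall s, continuous (v s).
Hypothesis equi : forall e, 0 < e -> exists2 T, 0 <= T &
  forall s a b, a <= b -> `|v s b - v s a| <= T * (b - a) + e.
Hypothesis vu : forall x, v s x @[s --> U] --> u x.

Let u_equi T e a b : a <= b -> (forall s a b, a <= b -> `|v s b - v s a| <= T * (b - a) + e) ->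
  `|u b - u a| <= T * (b - a) + e.
Proof.
move=> ab h; apply: (cvg_norm_le_bound (F := U) (a := fun s => v s b - v s a)).
  exact: cvgB.
by near=> s; exact: h.
Unshelve. all: by end_near. Qed.

Lemma equicontinuous_limit : continuous u.
Proof.
move=> x; apply/cvgrPdist_le => /= e e0; have e2 : 0 < e / 2 by lra.
have [T T0 h] := equi e2; have T1 : 0 < T + 1 by lra.
have d0 : 0 < e / 2 / (T + 1) by rewrite divr_gt0.
exists (e / 2 / (T + 1)) => //= t /= xt; have Txt : (T + 1) * `|x - t| <= e / 2.
  by rewrite mulrC -ler_pdivlMr// ltW.
have Txt' : T * `|x - t| <= e / 2 by apply: le_trans Txt; apply: ler_wpM2r => //; lra.
have [xlt|tlx] := leP x t.
  by rewrite distrC; have := u_equi xlt h; rewrite ler0_norm in Txt'; lra.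
by have := u_equi (ltW tlx) h; rewrite ger0_norm in Txt'; lra.
Qed.

(** Pointwise convergence on a fine finite grid of [a, b] suffices. *)
Lemma equicontinuous_uniform a b e : 0 < e ->
  \forall s \near U, forall x, a <= x <= b -> `|v s x - u x| <= e.
Proof.
move=> e0; have e5 : 0 < e / 5 by lra.
have [T T0 h] := equi e5; have T1 : 0 < T + 1 by lra.
pose d := e / 5 / (T + 1); have d0 : 0 < d by rewrite divr_gt0.
have Td : T * d <= e / 5.
  apply: le_trans (_ : (T + 1) * d <= _); first by apply: ler_wpM2r; lra.
  by rewrite /d mulrC divfK// gt_eqF.
pose n := Num.truncn ((b - a) / d).
have : \forall s \near U, forall i : 'I_n.+1,
    `|v s (a + i%:R * d) - u (a + i%:R * d)| <= e / 5.
  apply: filter_forall => i; have /cvgrPdist_le/(_ _ e5) := @vu (a + i%:R * d).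
  by apply: filterS => s; rewrite distrC.
apply: filterS => s hs x /andP[ax xb].
have xd : 0 <= (x - a) / d by rewrite divr_ge0 ?subr_ge0// ltW.
have /truncn_itv/andP[kx xk] := xd; set k := Num.truncn _ in kx xk.
have kn : (k < n.+1)%N.
  by rewrite ltnS; apply: le_truncn; rewrite ler_pM2r ?invr_gt0// lerD2r.
have {kx} kx : k%:R * d <= x - a by rewrite -ler_pdivlMr.
have {xk} xk : x - a < k.+1%:R * d by rewrite -ltr_pdivrMr.
have := hs (Ordinal kn); rewrite /=; set t := a + _ => hst.
have tx : t <= x by rewrite /t; lra.
have xt : x - t <= d by rewrite -natr1 in xk; rewrite /t; lra.
have Txt : T * (x - t) <= e / 5 by apply: le_trans Td; apply: ler_wpM2l.
have h1 := h s t x tx; have h2 := u_equi tx h.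
have -> : v s x - u x = (v s x - v s t) + (v s t - u t) - (u x - u t) by ring.
apply: le_trans (ler_normB _ _) _; have := ler_normD (v s x - v s t) (v s t - u t); lra.
Qed.

Lemma equicontinuous_integral_cvg A a b : measurable A -> A `<=` `[a, b] ->
  \int[mu]_(x in A) v s x @[s --> U] --> \int[mu]_(x in A) u x.
Proof.
move=> mA Aab; have Ay := sub_itv_measure_lty mA Aab.
have m0 : 0 <= fine (mu A) by rewrite fine_ge0.
apply/cvgrPdist_le => /= e e0.
have e1 : 0 < e / (fine (mu A) + 1) by rewrite divr_gt0//; lra.
have := equicontinuous_uniform a b e1; apply: filterS => s hs.
have iv := continuous_integrable_sub (@cv s) mA Aab.
have iu := continuous_integrable_sub equicontinuous_limit mA Aab.
rewrite distrC -RintegralB//.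
have ib : mu.-integrable A (EFin \o (fun x => v s x - u x)) by apply: (integrableB _ iv iu).
apply: le_trans (le_normr_Rintegral _ _) _ => //.
apply: Rintegral_ge0_le => //.
apply: le_trans (_ : \int[mu]_(x in A) cst (e / (fine (mu A) + 1))%:E x <= _)%E.
  apply: ge0_le_integral => //=.
  - apply/measurable_EFinP/measurableT_comp => //.
    apply: measurable_funB; apply: measurable_funTS; apply: continuous_measurable_fun => //.
    exact: equicontinuous_limit.
  - by move=> x /Aab /=; rewrite in_itv/= => /hs; rewrite lee_fin.
rewrite integral_cst//= -[mu A]fineK ?ge0_fin_numE// -EFinM lee_fin.
by rewrite mulrAC ler_pdivrMr; nra.
Qed.

End equicontinuous_limit.

(** * Weak limits on the line *)
Section local_weak_limit.
Context {R : realType} (X : Type) (U : set_system X) {UF : UltraFilter U}.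
Local Notation mu := (@lebesgue_measure R).
Implicit Types (f g : R -> R) (a b x T e : R) (A B : set R) (n : nat).

Lemma integrable_union f A B : measurable A -> measurable B ->
  mu.-integrable A (EFin \o f) -> mu.-integrable B (EFin \o f) ->
  mu.-integrable (A `|` B) (EFin \o f).
Proof.
move=> mA mB /integrableP[mfA iA] /integrableP[mfB iB].
have mf : measurable_fun (A `|` B) (EFin \o f) by apply/measurable_funU.
apply/integrableP; split => //.
have E : A `|` B = A `|` (B `\` A).
  by apply/seteqP; split=> x; have := pselect (A x); rewrite /=; tauto.
rewrite E in mf *; rewrite ge0_integral_setU//.
- apply: lte_add_pinfty => //; apply: le_lt_trans iB.
  apply: ge0_subset_integral => //; first exact: measurableD.
  exact: measurableT_comp.
- exact: measurableD.
- exact: measurableT_comp.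
- by rewrite disj_set2E setDIK.
Qed.

Lemma Rintegral_setIC f A B : measurable A -> measurable B ->
  mu.-integrable A (EFin \o f) ->
  \int[mu]_(x in A) f x = \int[mu]_(x in A `&` B) f x + \int[mu]_(x in A `\` B) f x.
Proof.
move=> mA mB fi; rewrite -[in LHS](setUIDK A B) Rintegral_setU//.
- exact: measurableI.
- exact: measurableD.
- by rewrite setUIDK.
- by rewrite disj_set2E; apply/eqP/seteqP; split => // x [[_ Bx] [_]].
Qed.

Variable v : X -> R -> R.
Hypothesis cv : forall s, continuous (v s).
Hypothesis equi : forall e, 0 < e -> exists2 T, 0 <= T &
  forall s A a b, measurable A -> A `<=` `[a, b] ->
    \int[mu]_(x in A) `|v s x| <= T * fine (mu A) + e.

Let D n : set R := `[- n%:R, n%:R].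

Let weak_limit_on n : exists2 g : R -> R, mu.-integrable (D n) (EFin \o g) &
  forall A, measurable A -> A `<=` D n ->
    \int[mu]_(x in A) v s x @[s --> U] --> \int[mu]_(x in A) g x.
Proof.
have mD : measurable (D n) by exact: measurable_itv.
have [T T0 hT] := equi ltr01.
apply: (@equiintegrable_weak_limit _ _ R mu X U UF v (D n) mD (T * fine (mu (D n)) + 1)).
- by have := sub_itv_measure_lty mD (fun=> id).
- by move=> s; exact: continuous_integrable_itv.
- by move=> s; exact: (hT s (D n) (- n%:R) n%:R).
move=> e e0; have e2 : 0 < e / 2 by lra.
have [T' T'0 hT'] := equi e2; have T1 : 0 < T' + 1 by lra.
exists (e / 2 / (T' + 1)); first by rewrite divr_gt0.
move=> s A mA AD mAe; apply: le_trans (hT' s A _ _ mA AD) _.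
have m0 : 0 <= fine (mu A) by rewrite fine_ge0.
have : fine (mu A) <= e / 2 / (T' + 1).
  rewrite -lee_fin fineK; first exact: ltW.
  by rewrite ge0_fin_numE// (lt_trans mAe)// ltry.
rewrite ler_pdivlMr//; nra.
Qed.

(** The weak limits on the intervals [-n, n] are glued along the shells between
    consecutive intervals. *)
Lemma local_weak_limit : exists g : R -> R, locally_integrable setT g /\
  forall A a b, measurable A -> A `<=` `[a, b] ->
    \int[mu]_(x in A) v s x @[s --> U] --> \int[mu]_(x in A) g x.
Proof.
have /choice[G HG] n : exists g : R -> R, mu.-integrable (D n) (EFin \o g) /\
    forall A, measurable A -> A `<=` D n ->
      \int[mu]_(x in A) v s x @[s --> U] --> \int[mu]_(x in A) g x.
  by have [g] := weak_limit_on n; exists g.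
have DE n x : D n x <-> `|x| <= n%:R by rewrite /D /= in_itv/= ler_norml.
have bnd x : exists n, `|x| <= n%:R.
  by exists (Num.truncn `|x|).+1; exact/ltW/truncnS_gt.
pose g x := G (ex_minn (bnd x)) x.
pose C n := if n is n'.+1 then D n' else set0.
have mC n : measurable (C n) by case: n => [|n]; [exact: measurable0|exact: measurable_itv].
have gG n x : (D n `\` C n) x -> g x = G n x.
  move=> [/DE xn nC]; rewrite /g; case: ex_minnP => k xk kmin; congr (G _ x).
  apply/eqP; rewrite eqn_leq kmin// leqNgt; apply/negP => kn; apply: nC.
  case: n kn xn => // n kn _; apply/DE; apply: le_trans xk _; rewrite ler_nat//.
have P n : mu.-integrable (C n) (EFin \o g) /\ forall A, measurable A -> A `<=` C n ->
    \int[mu]_(x in A) v s x @[s --> U] --> \int[mu]_(x in A) g x.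
  elim: n => [|n [IHi IHc]].
    split=> [|A _]; first exact: integrable_set0.
    rewrite subset0 => ->; rewrite Rintegral_set0.
    by under eq_fun do rewrite Rintegral_set0; exact: cvg_cst.
  have CD : C n `<=` D n.
    case: n {IHi IHc} => // n x /DE xn; apply/DE; apply: le_trans xn _; rewrite ler_nat//.
  have mD : measurable (D n) by exact: measurable_itv.
  have mDC : measurable (D n `\` C n) by exact: measurableD.
  have iDC : mu.-integrable (D n `\` C n) (EFin \o g).
    apply: (@eq_integrable _ _ _ mu _ mDC (EFin \o G n) (EFin \o g)).
      by move=> x /set_mem xD /=; rewrite (gG n).
    by apply: integrableS (HG n).1 => // x [].
  have DUC : C n `|` (D n `\` C n) = D n by rewrite setDUK.
  have iD : mu.-integrable (D n) (EFin \o g) by rewrite -DUC; exact: integrable_union.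
  split=> // A mA AD; have iA : mu.-integrable A (EFin \o g) by exact: integrableS iD.
  have iv s : mu.-integrable A (EFin \o v s) by exact: (continuous_integrable_sub (@cv s) mA AD).
  rewrite (Rintegral_setIC mA (mC n) iA).
  have -> : (fun s => \int[mu]_(x in A) v s x) = (fun s => \int[mu]_(x in A `&` C n) v s x +
      \int[mu]_(x in A `\` C n) v s x).
    by apply/funext => s; exact: Rintegral_setIC.
  apply: cvgD; first by apply: IHc; [exact: measurableI|exact: subIsetr].
  have -> : \int[mu]_(x in A `\` C n) g x = \int[mu]_(x in A `\` C n) G n x.
    by apply: eq_Rintegral => x /set_mem[Ax nC]; apply: gG; split => //; exact: AD.
  by apply: (HG n).2; [exact: measurableD|move=> x [/AD]].
have sub a b : exists n, `[a, b]%classic `<=` C n.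
  exists (Num.truncn (`|a| + `|b|)).+2 => x /=; rewrite in_itv/= => /andP[ax xb].
  apply/DE; have := truncnS_gt (`|a| + `|b|); rewrite ler_norml.
  have := ler_norm b; have := ler_norm (- a); rewrite normrN; have := normr_ge0 a; have := normr_ge0 b; lra.
exists g; split=> [|A a b mA Aab]; last first.
  by have [n abn] := sub a b; apply: (P n).2 => //; exact: subset_trans abn.
have mg : measurable_fun setT g.
  have -> : setT = \bigcup_n C n.
    apply/seteqP; split=> // x _; have [n xn] := sub x x.
    by exists n => //; apply: xn; rewrite /= in_itv/= lexx.
  apply/measurable_fun_bigcup => // n.
  by apply/measurable_EFinP; have /integrableP[] := (P n).1.
split=> //; first exact: openT.
move=> K _ cK; have [M [_ KM]] := compact_bounded cK.
have [n Mn] := sub (- (M + 1)) (M + 1).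
have /integrableP[mgn ign] := (P n).1; apply: le_lt_trans ign.
apply: ge0_subset_integral => //=.
- exact: compact_measurable.
- exact: mC.
- by apply/measurable_EFinP/measurableT_comp => //; exact/measurable_EFinP.
move=> x Kx; apply: Mn; rewrite /= in_itv/= -ler_norml; apply: KM => //.
by rewrite ltrDl.
Qed.

End local_weak_limit.

(** * Weak derivatives and primitives *)
Section weak_derivative.
Context {R : realType}.
Implicit Types (f g h : R -> R) (a b c x t : R).
Local Notation mu := (@lebesgue_measure R).

Definition step_at a n t : R := smooth_step (n.+1%:R * t + (- (n.+1%:R * a))).

Lemma smooth_step_at a n : smooth (step_at a n).
Proof.
apply/Ck_smooth => k; apply: (Ck_affine (f := smooth_step)).
by have /Ck_smooth := @smooth_smooth_step R; exact.
Qed.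

Lemma step_at_le a n t : t <= a -> step_at a n t = 0.
Proof.
move=> ta; apply: smooth_step_eq0.
suff : n.+1%:R * t <= n.+1%:R * a by lra.
exact: ler_wpM2l.
Qed.

Lemma step_at_ge a n t : a + n.+1%:R^-1 <= t -> step_at a n t = 1.
Proof.
move=> ta; apply: smooth_step_eq1.
have : n.+1%:R * (a + n.+1%:R^-1) <= n.+1%:R * t by exact: ler_wpM2l.
by rewrite mulrDr mulfV//; lra.
Qed.

Lemma step_at_bounded : exists B : R, forall a n t, `|step_at a n t| <= B.
Proof.
have [B _ HB] := @derive1n_smooth_step_bounded R 0.
by exists B => a n t; exact: HB.
Qed.

Lemma derive1_step_at a n t : (step_at a n)^`() t =
  n.+1%:R * smooth_step^`() (n.+1%:R * t + (- (n.+1%:R * a))).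
Proof.
have := derive1n_affine n.+1%:R (- (n.+1%:R * a)) 1 t (@smooth_smooth_step R).
by rewrite !derive1n1 expr1.
Qed.

Lemma derive1_step_at_out a n t : ~ `[a, a + n.+1%:R^-1]%classic t ->
  (step_at a n)^`() t = 0.
Proof.
move=> h; rewrite derive1_step_at -derive1n1; have [ta|ta] := leP t a.
  rewrite derive1n_smooth_step_le0 ?mulr0//.
  suff : n.+1%:R * t <= n.+1%:R * a by lra.
  exact: ler_wpM2l.
have {}ta' : a + n.+1%:R^-1 <= t.
  by rewrite leNgt; apply/negP => ta'; apply: h; rewrite /= in_itv/= !ltW.
rewrite derive1n_smooth_step_ge1 ?derive1n_cst ?mulr0//.
have : n.+1%:R * (a + n.+1%:R^-1) <= n.+1%:R * t by exact: ler_wpM2l.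
by rewrite mulrDr mulfV//; lra.
Qed.

(** The derivatives of the steps are an approximate identity. *)
Lemma mollify_cvg h a : continuous h ->
  \int[mu]_t (h t * (step_at a n)^`() t) @[n --> \oo] --> h a.
Proof.
move=> ch; have [B B1 HB] := @derive1n_smooth_step_bounded R 1.
have B0 : 0 < B by lra.
apply/cvgrPdist_le => /= e e0.
have /cvgrPdist_le/(_ (e / B) (divr_gt0 e0 B0))/nbhs_ballP[d /= d0 hd] := ch a.
near=> n; set D := `[a, a + n.+1%:R^-1]%classic.
have aD : a <= a + n.+1%:R^-1 by rewrite lerDl invr_ge0.
have cS : continuous (step_at a n)^`().
  by rewrite -derive1n1; exact: smooth_continuous (@smooth_step_at a n).
rewrite (Rintegral_support (D := D)); last first.
  by move=> x Dx; rewrite derive1_step_at_out// mulr0.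
have S1 : \int[mu]_(t in D) (step_at a n)^`() t = 1.
  have dS x : is_derive x 1 (step_at a n) ((step_at a n)^`() x).
    exact: (smooth_is_derive 0 x (@smooth_step_at a n)).
  rewrite /D (integral_is_derive aD dS cS).
  by rewrite step_at_ge// step_at_le// subr0.
have chS : continuous (fun t => h t * (step_at a n)^`() t).
  exact: continuous_funM.
have caS : continuous (fun t => h a * (step_at a n)^`() t).
  by apply: continuous_funM => //; exact: cst_continuous.
rewrite -[X in `|X - _|]mulr1 -S1 -RintegralZl//; last exact: continuous_integrable_itv.
rewrite -RintegralB//; try exact: continuous_integrable_itv.
apply: le_trans (@Rintegral_norm_le _ _ (e * n.+1%:R) _ _ aD _ _) _.
- by apply: continuous_integrable_itv; exact: continuous_funB.
- move=> x /andP[ax xa]; rewrite -mulrBl normrM.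
  have -> : e * n.+1%:R = (e / B) * (n.+1%:R * B) by field; rewrite gt_eqF.
  apply: ler_pM => //.
    apply: hd; rewrite /ball/= distrC ger0_norm; last lra.
    rewrite ltrBlDl; apply: le_lt_trans xa _; rewrite ltrD2l.
    by near: n; exact: near_infty_natSinv_lt (PosNum d0).
  by rewrite derive1_step_at normrM ger0_norm// ler_wpM2l// -derive1n1.
- by rewrite [a + _]addrC addrK mulfK.
- exact: measurable_itv.
- exact: measurable_itv.
Unshelve. all: by end_near. Qed.

Lemma test_function_step a b n : a <= b ->
  test_function (fun t => step_at a n t + -1 * step_at b n t).
Proof.
move=> ab; split=> [k x|].
  have Cs c : Ck k.+1 (step_at c n) by have /Ck_smooth := @smooth_step_at c n; exact.
  have : Ck k.+1 (fun t => step_at a n t + -1 * step_at b n t).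
    apply: (CkD (Cs a)); apply: (CkM (f := fun=> -1)) (Cs b); exact: Ck_cst.
  exact.
exists (`|a| + `|b| + 1) => x; rewrite ltr_normr => /orP[|] h.
  have n1 : (n.+1%:R^-1 : R) <= 1 by rewrite invf_le1// ler1n.
  have := ler_norm b; have := normr_ge0 a; have := ler_norm a; have := normr_ge0 b => *.
  have [] : (a + n.+1%:R^-1 <= x) /\ (b + n.+1%:R^-1 <= x).
    by move: n1; move: (n.+1%:R^-1 : R) => i i1; split; lra.
  by move=> ? ?; rewrite !step_at_ge//; ring.
have := ler_norm (- a); have := ler_norm (- b); rewrite !normrN => *.
have := normr_ge0 a; have := normr_ge0 b => *.
by rewrite !step_at_le ?mulr0 ?addr0//; lra.
Qed.

(** Testing against a smooth approximation of the indicator of an interval. *)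
Lemma weak_derivative_FTC h g a b : continuous h -> is_weak_derivative h g ->
  a <= b -> \int[mu]_(t in `[a, b]) g t = h b - h a.
Proof.
move=> ch [_ lg hg] ab.
pose phi n t := step_at a n t + -1 * step_at b n t.
have dphi n t : (phi n)^`() t = (step_at a n)^`() t + -1 * (step_at b n)^`() t.
  rewrite -!derive1n1; rewrite smooth_derive1nD; last 2 first.
  - exact: smooth_step_at.
  - by apply/Ck_smooth => k; apply: (CkM (f := fun=> -1)); [exact: Ck_cst|
      have /Ck_smooth := @smooth_step_at b n; exact].
  by rewrite smooth_derive1nZ//; exact: smooth_step_at.
pose D := `[a, b + 1]%classic.
have ab1 : a <= b + 1 by lra.
have ln (n : nat) : (n.+1%:R^-1 : R) <= 1 by rewrite invf_le1// ler1n.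
have cS c n : continuous (step_at c n)^`().
  by rewrite -derive1n1; exact: smooth_continuous (@smooth_step_at c n).
have L1 : \int[mu]_t (h t * (phi n)^`() t) @[n --> \oo] --> h a - h b.
  have -> : (fun n => \int[mu]_t (h t * (phi n)^`() t)) = fun n =>
    \int[mu]_t (h t * (step_at a n)^`() t) - \int[mu]_t (h t * (step_at b n)^`() t).
    apply/funext => n.
    have out c t : (c = a \/ c = b) -> ~ D t -> (step_at c n)^`() t = 0.
      move=> cab Dt; apply: derive1_step_at_out => /=; rewrite in_itv/= => /andP[ct tc].
      by apply: Dt; rewrite /D/= in_itv/=; move: ct tc (ln n); move: (n.+1%:R^-1 : R) => i; case: cab => -> *; lra.
    rewrite !(Rintegral_support (D := D)); last 3 first.
    - by move=> x Dx; rewrite out ?mulr0//; right.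
    - by move=> x Dx; rewrite out ?mulr0//; left.
    - by move=> x Dx; rewrite dphi !out ?mulr0 ?addr0 ?mulr0//; [right|left].
    rewrite -RintegralB//.
    - apply: eq_Rintegral => t _; rewrite dphi; ring.
    - exact: measurable_itv.
    - by apply: continuous_integrable_itv; exact: continuous_funM.
    - by apply: continuous_integrable_itv; exact: continuous_funM.
  by apply: cvgB; exact: mollify_cvg.
have L2 : \int[mu]_t (g t * phi n t) @[n --> \oo] --> \int[mu]_(t in `[a, b]) g t.
  have [B HB] := step_at_bounded.
  have iD : mu.-integrable D (EFin \o g) by exact: locally_integrable_itv.
  have mD : measurable D by exact: measurable_itv.
  have mgD : measurable_fun D g by have /integrableP[/measurable_EFinP] := iD.
  have phi_out n t : ~ D t -> phi n t = 0.
    rewrite /D/= in_itv/= => Dt; rewrite /phi.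
    have [ta|ta] := leP t a; first by rewrite !step_at_le ?mulr0 ?addr0//; lra.
    have bt : b + 1 < t by rewrite ltNge; apply/negP => tb; apply: Dt; rewrite tb ltW.
    have [] : (a + n.+1%:R^-1 <= t) /\ (b + n.+1%:R^-1 <= t).
      by move: (ln n); move: (n.+1%:R^-1 : R) => i i1; split; lra.
    by move=> ? ?; rewrite !step_at_ge//; ring.
  pose gab := g \_ `]a, b].
  have -> : \int[mu]_(t in `[a, b]) g t = \int[mu]_(t in D) gab t.
    rewrite -Rintegral_mkcondr (_ : D `&` `]a, b] = `]a, b]%classic); last first.
      apply/setIidPr; apply: subset_itv; rewrite ?bnd_simp//; lra.
    rewrite [RHS]Rintegral_itv_obnd_cbnd//.
    by apply: integrableS iD => //; apply: subset_itv; rewrite ?bnd_simp//; lra.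
  have -> : (fun n => \int[mu]_t (g t * phi n t)) = fun n => \int[mu]_(t in D) (g t * phi n t).
    apply/funext => n; apply: Rintegral_support => t Dt.
    by rewrite phi_out// mulr0.
  have lim1 t : g t * phi n t @[n --> \oo] --> gab t.
    suff h0 : \forall n \near \oo, g t * phi n t = gab t by exact: cvg_near_cst.
    rewrite /gab patchE /phi; case: ifPn; rewrite ?inE/= ?notin_setE/= in_itv/=.
      move=> /andP[ta tb]; near=> n; rewrite step_at_ge; last first.
        rewrite -lerBrDl; near: n; have ta0 : 0 < t - a by rewrite subr_gt0.
        by apply: filterS (near_infty_natSinv_lt (PosNum ta0)) => n /ltW.
      by rewrite step_at_le// mulr0 addr0 mulr1.
    move=> /negP; rewrite negb_and -!leNgt -ltNge => /orP[ta|tb].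
      by near=> n; rewrite !step_at_le ?mulr0 ?addr0 ?mulr0//; exact: le_trans ab.
    near=> n; have h1 : b + n.+1%:R^-1 <= t.
      rewrite -lerBrDl; near: n; have tb0 : 0 < t - b by rewrite subr_gt0.
      by apply: filterS (near_infty_natSinv_lt (PosNum tb0)) => n /ltW.
    have h2 : a + n.+1%:R^-1 <= t by apply: le_trans h1; rewrite lerD2r.
    by rewrite !step_at_ge// mulN1r subrr mulr0.
  have [] := @dominated_convergence _ _ _ mu D mD (fun n t => (g t * phi n t)%:E)
     (EFin \o gab) (fun t => (`|g t| * (B + B))%:E).
  - move=> n; apply/measurable_EFinP; apply: measurable_funM => //.
    apply: measurable_funTS; apply: continuous_measurable_fun.
    exact: (smooth_continuous (k := 0) (test_function_step n ab).1).
  - apply/measurable_EFinP; apply/measurable_restrict => //.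
    by apply: measurable_funS mgD => //; exact: subIsetl.
  - by apply: aeW => x Dx; apply: cvg_EFin; [exact: nearW|exact: lim1].
  - under eq_fun do rewrite EFinM.
    by apply: integrableZr => //; exact: integrable_norm iD.
  - apply: aeW => x n Dx; rewrite lee_fin normrM ler_wpM2l// /phi.
    apply: le_trans (ler_normD _ _) _; rewrite mulN1r normrN.
    by apply: lerD; exact: HB.
  move=> igab _; rewrite -[X in _ --> X -> _]fineK; last exact: integrable_fin_num.
  by move=> /fine_cvgP[_].
have E : (fun n => \int[mu]_t (h t * (phi n)^`() t)) = (fun n => - \int[mu]_t (g t * phi n t)).
  by apply/funext => n; apply: hg; exact: test_function_step.
rewrite E in L1.
have L3 : - (\int[mu]_t (g t * phi n t)) @[n --> \oo] --> - \int[mu]_(t in `[a, b]) g t.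
  exact: cvgN L2.
have L4 : h a - h b = - \int[mu]_(t in `[a, b]) g t.
  by rewrite -(cvg_lim (@Rhausdorff R) L1); apply/cvg_lim; [exact: Rhausdorff|exact: L3].
by rewrite -[LHS]opprK -L4 opprB.
Unshelve. all: by end_near. Qed.

(** By Lebesgue's differentiation theorem the primitive of g1 - g2, which is 0,
    has the derivative g1 - g2 almost everywhere. *)
Lemma primitive_unique_ae g1 g2 :
  locally_integrable setT g1 -> locally_integrable setT g2 ->
  (forall a b, a <= b ->
    \int[mu]_(t in `[a, b]) g1 t = \int[mu]_(t in `[a, b]) g2 t) ->
  {ae mu, forall x, g1 x = g2 x}.
Proof.
move=> l1 l2 g12; have l := locally_integrableB l1 l2.
pose g := (g1 \- g2)%R.
have aek (k : nat) : {ae mu, forall x, - k%:R < x -> g x = 0}.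
  have := @FTC1 R g (BLeft (- k%:R)) (fun y => locally_integrable_itv _ y l) l.
  apply: filterS; first exact: (ae_filter_ringOfSetsType mu).
  move=> x h kx; have [|_ <-] := h; first by rewrite lte_fin.
  have -> : (fun x => \int[mu]_(t in [set` Interval (BLeft (- k%:R)) (BRight x)]) g t) = cst 0.
    apply/funext => y; have [ky|ky] := leP (- k%:R) y; last first.
      by rewrite set_itv_ge ?Rintegral_set0// bnd_simp -ltNge.
    by rewrite RintegralB//; [rewrite g12// subrr|
      exact: locally_integrable_itv..].
  exact: derive1_cst.
have := ae_foralln aek; apply: filterS => x h; apply/eqP; rewrite -subr_eq0.
apply/eqP; pose y : R := x; apply: (h (Num.bound `|y|)).
rewrite -/y ltrNl; apply: le_lt_trans (archi_boundP (normr_ge0 y)).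
by rewrite -normrN ler_norm.
Qed.

(** Subdividing [a, b] into n equal parts bounds the total increment by
    (b - a) (G b - G a) / n. *)
Lemma superadditive_increment_eq (f G : R -> R) a b : a <= b ->
  (forall x y, a <= x -> x <= y -> y <= b ->
     `|f y - f x| <= (y - x) * (G y - G x)) -> f a = f b.
Proof.
move=> ab fG; apply/eqP; rewrite eq_sym -subr_eq0 -normr_le0.
apply/ler_addgt0Pl => e e0; rewrite addr0.
have GG : 0 <= (b - a) * (G b - G a) by apply: le_trans (fG a b _ _ _).
pose K := (b - a) * (G b - G a) / e.
have K0 : 0 <= K by apply: divr_ge0 => //; exact: ltW.
pose n := Num.bound K; have Kn : K < n%:R := archi_boundP K0.
have n0 : 0 < n%:R :> R by exact: le_lt_trans Kn.
pose d := (b - a) / n%:R.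
have d0 : 0 <= d by apply: divr_ge0; [rewrite subr_ge0|exact: ltW].
pose u (i : nat) := a + i%:R * d.
have un : u n = b by rewrite /u /d [n%:R * _]mulrC divfK ?gt_eqF//; ring.
have ule i j : (i <= j)%N -> u i <= u j.
  by move=> ij; rewrite lerD2l ler_wpM2r// ler_nat.
have -> : f b - f a = \sum_(0 <= i < n) (f (u i.+1) - f (u i)).
  by rewrite telescope_sumr// un /u mul0r addr0.
apply: le_trans (ler_norm_sum _ _ _) _.
apply: le_trans (_ : \sum_(0 <= i < n) d * (G (u i.+1) - G (u i)) <= _).
  apply: ler_sum_nat => i /andP[_ ni].
  have -> : d = u i.+1 - u i by rewrite /u -natr1; ring.
  apply: fG; [|exact: ule|].
    by rewrite -[leLHS]addr0 lerD2l mulr_ge0.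
  by rewrite -un; exact: ule.
rewrite -mulr_sumr telescope_sumr// un /u mul0r addr0 /d mulrAC.
by rewrite ler_pdivrMr// -ler_pdivrMl// mulrC ltW.
Qed.

(** Integration by parts against a test function: the defect
    h phi - \int (h phi' + g phi) has increments of order |y - x| times the
    integral of |g| over [x, y]. *)
Lemma FTC_weak_derivative h g : continuous h -> locally_integrable setT g ->
  (forall a b, a <= b -> \int[mu]_(t in `[a, b]) g t = h b - h a) ->
  is_weak_derivative h g.
Proof.
move=> ch lg hg; split => //; first exact: continuous_locally_integrable.
move=> phi [sphi [M phiM]].
have dphi x : is_derive x 1 phi (phi^`() x) by exact: (smooth_is_derive 0 x sphi).
have cphi : continuous phi := smooth_continuous (k := 0) sphi.
have cdphi : continuous phi^`() := smooth_continuous (k := 1) sphi.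
pose c := `|M| + 1; have Mc : M < c by rewrite /c; have := ler_norm M; lra.
have c0 : - c <= c by rewrite /c; have := normr_ge0 M; lra.
have phi0 x : M < `|x| -> phi^`() x = 0.
  move=> Mx; apply: is_derive1E; apply: (near_eq_is_derive (f := cst 0)).
  near=> y; apply/esym/phiM; near: y.
  have cn : (fun y : R => `|y|) y @[y --> x] --> `|x| by exact: norm_continuous.
  by have /cvgr_gt/(_ _ Mx) := cn.
have out x : ~ `[- c, c]%classic x -> M < `|x|.
  rewrite /= in_itv/= -ler_norml => /negP; rewrite -ltNge; exact: lt_trans.
rewrite (Rintegral_support (D := `[- c, c]%classic)); last first.
  by move=> x /out xc; rewrite phi0// mulr0.
rewrite [in RHS](Rintegral_support (D := `[- c, c]%classic)); last first.
  by move=> x /out xc; rewrite phiM// mulr0.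
have phic : phi c = 0 by apply: phiM; rewrite ger0_norm// /c; have := normr_ge0 M; lra.
have phiNc : phi (- c) = 0 by apply: phiM; rewrite normrN ger0_norm// /c; have := normr_ge0 M; lra.
have ig a b := locally_integrable_itv a b lg.
have ihd a b : mu.-integrable `[a, b] (EFin \o (fun t => h t * phi^`() t)).
  by apply: continuous_integrable_itv; exact: continuous_funM.
have [B B0 HB] : exists2 B : R, 0 <= B & forall x, `|phi^`() x| <= B.
  have cn : {within `[- c, c], continuous (fun x : R => `|phi^`() x|)}.
    apply: continuous_subspaceT => x.
    by apply: continuous_comp; [exact: cdphi|exact: norm_continuous].
  have [z _ zB] := EVT_max c0 cn; exists `|phi^`() z| => // x.
  have [xc|/negP xc] := boolP (x \in `[- c, c]); first exact: zB.
  by rewrite phi0 ?normr0//; exact: out.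
have igp a b : a <= b -> mu.-integrable `[a, b] (EFin \o (fun t => g t * phi t)).
  by move=> ab; exact: integrable_itvM.
have phiL x y : x <= y -> `|phi y - phi x| <= B * (y - x).
  move=> xy; rewrite -(integral_is_derive xy dphi cdphi).
  by apply: Rintegral_norm_le => // ; exact: continuous_integrable_itv.
(* It has to be shown that F takes the same value at both ends of the support. *)
pose F x := h x * phi x - \int[mu]_(t in `[- c, x]) (h t * phi^`() t + g t * phi t).
pose G x := 2 * B * \int[mu]_(t in `[- c, x]) `|g t|.
have ihg a b : a <= b ->
    mu.-integrable `[a, b] (EFin \o (fun t => h t * phi^`() t + g t * phi t)).
  by move=> ab; exact: integrable_itvD (ihd a b) (igp a b ab).
have ing a b : mu.-integrable `[a, b] (EFin \o (fun t => `|g t|)) by exact: integrable_norm (ig a b).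
have FG x y : - c <= x -> x <= y -> y <= c -> `|F y - F x| <= (y - x) * (G y - G x).
  move=> cx xy yc; have cy := le_trans cx xy.
  pose J := \int[mu]_(t in `[x, y]) `|g t|.
  have J0 : 0 <= J by exact: Rintegral_ge0.
  have -> : G y - G x = 2 * B * J.
    by rewrite /G (Rintegral_itv_cat cx xy (ing _ _)) -/J; ring.
  pose D t := g t * (phi y - phi t) + (h x - h t) * phi^`() t.
  have cD1 : continuous (fun t => phi y - phi t).
    by apply: continuous_funB => //; exact: cst_continuous.
  have cD2 : continuous (fun t => (h x - h t) * phi^`() t).
    by apply: continuous_funM => //; apply: continuous_funB => //; exact: cst_continuous.
  have iD1 := integrable_itvM xy (ig x y) cD1.
  have iD2 := @continuous_integrable_itv R _ x y cD2.
  have -> : F y - F x = \int[mu]_(t in `[x, y]) D t.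
    rewrite /F (Rintegral_itv_cat cx xy (ihg _ _ cy)).
    rewrite [RHS]Rintegral_itvD//.
    have -> : \int[mu]_(t in `[x, y]) (g t * (phi y - phi t)) =
        phi y * (h y - h x) - \int[mu]_(t in `[x, y]) (g t * phi t).
      rewrite -hg// -RintegralZl// -Rintegral_itv_sub; last 2 first.
      - exact: integrable_itvZ.
      - exact: igp.
      by apply: eq_Rintegral => t _; ring.
    have -> : \int[mu]_(t in `[x, y]) ((h x - h t) * phi^`() t) =
        h x * (phi y - phi x) - \int[mu]_(t in `[x, y]) (h t * phi^`() t).
      rewrite -(integral_is_derive xy dphi cdphi) -RintegralZl//; last first.
        exact: continuous_integrable_itv.
      rewrite -Rintegral_itv_sub; last 2 first.
      - apply: continuous_integrable_itv; apply: continuous_funM => //.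
        exact: cst_continuous.
      - exact: ihd.
      by apply: eq_Rintegral => t _; ring.
    have -> := @Rintegral_itvD R _ _ x y (ihd x y) (igp x y xy).
    ring.
  have iDn1 := integrable_itvD iD1 iD2.
  apply: le_trans (le_normr_Rintegral_itv iDn1) _.
  have -> : (y - x) * (2 * B * J) = \int[mu]_(t in `[x, y]) (B * (y - x) * `|g t|)
     + \int[mu]_(t in `[x, y]) (J * B).
    rewrite RintegralZl// Rintegral_itv_cst// -/J; ring.
  rewrite -Rintegral_itvD; last 2 first.
  - exact: integrable_itvZ.
  - exact/continuous_integrable_itv/cst_continuous.
  apply: le_Rintegral => //.
  - exact: integrable_norm iDn1.
  - have i1 := integrable_itvZ (B * (y - x)) (ing x y).
    have i2 := @continuous_integrable_itv R _ x y (@cst_continuous _ _ (J * B)).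
    exact: integrable_itvD i1 i2.
  move=> t /=; rewrite in_itv/= => /andP[xt ty].
  apply: le_trans (ler_normD _ _) _; rewrite !normrM; apply: lerD.
    rewrite mulrC ler_wpM2r//; apply: le_trans (phiL _ _ ty) _.
    by rewrite ler_wpM2l//; lra.
  apply: ler_pM => //.
  rewrite distrC -hg//; apply: le_trans (le_normr_Rintegral_itv (ig x t)) _.
  by rewrite /J (Rintegral_itv_cat xt ty (ing _ _)) lerDl; exact: Rintegral_ge0.
have := superadditive_increment_eq c0 FG; rewrite /F phic phiNc !mulr0.
rewrite set_itv1 Rintegral_set1 subr0 sub0r => /esym/eqP; rewrite oppr_eq0.
rewrite Rintegral_itvD//; last exact: igp.
by rewrite addr_eq0 => /eqP.
Unshelve. all: by end_near. Qed.

End weak_derivative.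

(** * Lower semicontinuity of the norms *)
Section lower_semicontinuity.
Context {R : realType} (X : Type) (U : set_system X) {FU : ProperFilter U}.
Local Notation mu := (@lebesgue_measure R).
Implicit Types (a b c t x K p : R) (A : set R) (n : nat).

(** Young's inequality, read as the position of the graph of t ^ p above its
    tangent at c. *)
Lemma powR_tangent p c t : 1 < p -> 0 <= c -> 0 <= t ->
  p * c `^ (p - 1) * t - (p - 1) * c `^ p <= t `^ p.
Proof.
move=> p1 c0 t0; have p0 : 0 < p by lra. have q0 : 0 < p - 1 by lra.
have qq : 0 < p / (p - 1) by rewrite divr_gt0.
have pq : p^-1 + (p / (p - 1))^-1 = 1 by field; rewrite !gt_eqF.
have := conjugate_powR t0 (powR_ge0 c (p - 1)) p0 qq pq.
rewrite -powRrM (_ : (p - 1) * (p / (p - 1)) = p); last by field; rewrite gt_eqF.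
rewrite invf_div -(ler_pM2l p0) mulrDr.
have -> : p * (t `^ p / p) = t `^ p by field; rewrite gt_eqF.
have -> : p * (c `^ p * ((p - 1) / p)) = c `^ p * (p - 1) by field; rewrite gt_eqF.
lra.
Qed.

Lemma cvg_sum_seq (I : Type) (r : seq I) (F : I -> X -> R) (l : I -> R) :
  (forall i, F i s @[s --> U] --> l i) ->
  \sum_(i <- r) F i s @[s --> U] --> \sum_(i <- r) l i.
Proof.
move=> Fl; elim: r => [|i r IH].
  by rewrite big_nil; under eq_fun do rewrite big_nil; exact: cvg_cst.
by rewrite big_cons; under eq_fun do rewrite big_cons; exact: cvgD.
Qed.

Variables (v : X -> R -> R) (g : R -> R) (K : R).
Hypothesis cv : forall s, continuous (v s).
Hypothesis lg : locally_integrable setT g.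
Hypothesis vg : forall A a b, measurable A -> A `<=` `[a, b] ->
  \int[mu]_(x in A) v s x @[s --> U] --> \int[mu]_(x in A) g x.
Hypothesis K0 : 0 <= K.

Let mg : measurable_fun setT g. Proof. by case: lg. Qed.

Let nonneg_part := [set x : R | 0 <= g x].

Let mP : measurable nonneg_part.
Proof. by rewrite -[X in measurable X]setTI; exact: (measurable_fun_le _ _ mg). Qed.

Let integrable_g A a b : measurable A -> A `<=` `[a, b] -> mu.-integrable A (EFin \o g).
Proof.
by move=> mA Aab; apply: integrableS (locally_integrable_itv a b lg) => //; exact: measurable_itv.
Qed.

Section finite_exponent.
Variable p : R.
Hypothesis p1 : 1 < p.
Hypothesis vK : forall s, lp_bounded p%:E K (v s).

Let p0 : 0 < p. Proof. exact: lt_trans p1. Qed.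

Let integrable_pow s A a b : measurable A -> A `<=` `[a, b] ->
  mu.-integrable A (EFin \o (fun x => `|v s x| `^ p)).
Proof.
move=> mA Aab; apply: (@integrableS _ _ _ mu `[a, b]) => //; apply/integrableP; split.
  by apply: measurable_norm_powR; exact: continuous_measurable_fun.
under eq_integral do rewrite /= ger0_norm ?powR_ge0//.
by apply: le_lt_trans (vK s a b) _; rewrite ltry.
Qed.

(** The tangent bound is linear in `|v|, but only v itself converges weakly; so `|v|
    is bounded below by v where g >= 0 and by - v elsewhere, which becomes `|g| in
    the limit. *)
Let tangent A c s : R := p * c `^ (p - 1) *
  (\int[mu]_(x in A `&` nonneg_part) v s x - \int[mu]_(x in A `\` nonneg_part) v s x)
  - (p - 1) * c `^ p * fine (mu A).

Let tangent_le A c s a b : 0 <= c -> measurable A -> A `<=` `[a, b] ->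
  tangent A c s <= \int[mu]_(x in A) `|v s x| `^ p.
Proof.
move=> c0 mA Aab; rewrite /tangent.
have iv : mu.-integrable A (EFin \o v s) := continuous_integrable_sub (@cv s) mA Aab.
have ipw := integrable_pow s mA Aab.
have pc0 : 0 <= p * c `^ (p - 1) by rewrite mulr_ge0 ?powR_ge0// ltW.
have mAP : measurable (A `&` nonneg_part) by exact: measurableI.
have mAD : measurable (A `\` nonneg_part) by exact: measurableD.
have sP : A `&` nonneg_part `<=` A by exact: subIsetl.
have sD : A `\` nonneg_part `<=` A by exact: subDsetl.
have Ay := sub_itv_measure_lty mA Aab.
have part (B : set R) (w : R -> R) : measurable B -> B `<=` A ->
    (forall x, w x = v s x \/ w x = - v s x) -> mu.-integrable B (EFin \o w) ->
    p * c `^ (p - 1) * \int[mu]_(x in B) w x - (p - 1) * c `^ p * fine (mu B) <=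
    \int[mu]_(x in B) `|v s x| `^ p.
  move=> mB BA wv iw.
  have ic : mu.-integrable B (EFin \o (fun=> (p - 1) * c `^ p)).
    apply: (@continuous_integrable_sub _ (fun=> (p - 1) * c `^ p) B a b) => //.
      by move=> x; exact: cst_continuous.
    exact: subset_trans Aab.
  have iz : mu.-integrable B (EFin \o (fun x => p * c `^ (p - 1) * w x)).
    by apply: (integrableZl _ (p * c `^ (p - 1)) iw).
  rewrite -RintegralZl// -Rintegral_cst// -RintegralB//.
  apply: le_Rintegral => //.
  - by apply: (integrableB _ iz ic).
  - by apply: integrableS ipw.
  move=> x _; apply: le_trans (powR_tangent p1 c0 (normr_ge0 (v s x))).
  rewrite lerD2r; apply: ler_wpM2l => //.
  by case: (wv x) => ->; rewrite ?ler_norm// -normrN ler_norm.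
have iP : mu.-integrable (A `&` nonneg_part) (EFin \o v s) by exact: integrableS iv.
have iD : mu.-integrable (A `\` nonneg_part) (EFin \o v s) by exact: integrableS iv.
have h1 := part _ (v s) mAP sP (fun x => or_introl erefl) iP.
have iN : mu.-integrable (A `\` nonneg_part) (EFin \o (fun x => - 1 * v s x)).
  by apply: (integrableZl _ (-1) iD).
have h2 := part _ (fun x => - 1 * v s x) mAD sD (fun x => or_intror (mulN1r _)) iN.
rewrite RintegralZl// mulN1r in h2.
rewrite (Rintegral_setIC mA mP ipw).
have muA : fine (mu A) = fine (mu (A `&` nonneg_part)) + fine (mu (A `\` nonneg_part)).
  rewrite -fineD ?ge0_fin_numE//; last 2 first.
  - by apply: sub_itv_measure_lty mAP (subset_trans sP Aab).
  - by apply: sub_itv_measure_lty mAD (subset_trans sD Aab).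
  by rewrite addeC -measureDI.
apply: le_trans (lerD h1 h2); rewrite muA.
by move: (fine _) (fine _) (Rintegral _ _ _) (Rintegral _ _ _) => *; lra.
Qed.

Let tangent_lim A c a b : measurable A -> A `<=` `[a, b] ->
  tangent A c s @[s --> U] --> p * c `^ (p - 1) * \int[mu]_(x in A) `|g x| -
    (p - 1) * c `^ p * fine (mu A).
Proof.
move=> mA Aab; have ig := integrable_g mA Aab.
have mAP : measurable (A `&` nonneg_part) by exact: measurableI.
have mAD : measurable (A `\` nonneg_part) by exact: measurableD.
have -> : \int[mu]_(x in A) `|g x| =
    \int[mu]_(x in A `&` nonneg_part) g x - \int[mu]_(x in A `\` nonneg_part) g x.
  rewrite (Rintegral_setIC mA mP); last exact: (integrable_norm ig).
  congr (_ + _); first by apply: eq_Rintegral => x /set_mem[_ /= g0]; rewrite ger0_norm.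
  rewrite -mulN1r -RintegralZl//.
    apply: eq_Rintegral => x /set_mem[_ /= /negP]; rewrite -ltNge => /ltW g0.
    by rewrite ler0_norm// mulN1r.
  by apply: integrableS ig.
apply: cvgB; last exact: cvg_cst.
apply: cvgM; first exact: cvg_cst.
apply: cvgB; apply: (@vg _ a b) => //; first by move=> x [/Aab].
by move=> x [/Aab].
Qed.

(** On the level set A y the tangent is taken at the value y ^ (1/p), at which it
    is sharp. *)
Lemma weak_limit_level_sum (r : seq R) (A : R -> set R) a b : uniq r ->
  (forall y, y \in r -> 0 <= y) ->
  (forall y, measurable (A y)) -> (forall y, A y `<=` `[a, b]) ->
  trivIset setT A -> (forall y x, A y x -> y <= `|g x| `^ p) ->
  \sum_(y <- r) y * fine (mu (A y)) <= K `^ p.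
Proof.
move=> ur r0 mA Aab tA gy.
pose c (y : R) := y `^ p^-1.
have cp y : 0 <= y -> c y `^ p = y by move=> y0; rewrite -powRrM mulVf ?gt_eqF// powRr1.
apply: (@le_trans _ _ (\sum_(y <- r) (p * c y `^ (p - 1) * \int[mu]_(x in A y) `|g x| -
    (p - 1) * c y `^ p * fine (mu (A y))))).
  rewrite big_seq [leRHS]big_seq; apply: ler_sum => y /r0 y0.
  have c0 : 0 <= c y by exact: powR_ge0.
  have : \int[mu]_(x in A y) c y <= \int[mu]_(x in A y) `|g x|.
    apply: le_Rintegral.
    - exact: mA.
    - apply: (@continuous_integrable_sub _ (fun=> c y) (A y) a b) => //.
      by move=> x; exact: cst_continuous.
    - exact: (integrable_norm (integrable_g (mA y) (@Aab y))).
    - move=> x /gy; rewrite -{1}(cp y y0) => h; rewrite leNgt; apply/negP => gc.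
      by move: h; apply/negP; rewrite -ltNge; apply: gt0_ltr_powR; rewrite ?nnegrE.
  rewrite Rintegral_cst; last exact: mA.
  move=> h; rewrite (cp y y0).
  have pc0 : 0 <= p * c y `^ (p - 1) by rewrite mulr_ge0 ?powR_ge0// ltW.
  have := ler_wpM2l pc0 h.
  have -> : p * c y `^ (p - 1) * (c y * fine (mu (A y))) = p * y * fine (mu (A y)).
    have e : c y * c y `^ (p - 1) = y by rewrite (mulr_powRB1 c0 p0) cp.
    by rewrite -!mulrA; congr (p * _); rewrite mulrA (mulrC (_ `^ _)) e.
  lra.
apply: (cvg_le_bound (F := U) (a := fun s => \sum_(y <- r) tangent (A y) (c y) s)).
  by apply: cvg_sum_seq => y; exact: tangent_lim (@Aab y).
near=> s.
apply: (@le_trans _ _ (\sum_(y <- r) \int[mu]_(x in A y) `|v s x| `^ p)).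
  by apply: ler_sum => y _; apply: tangent_le (@Aab y) => //; exact: powR_ge0.
have mp (B : set R) : measurable_fun B (fun x => (`|v s x| `^ p)%:E).
  by apply: measurable_norm_powR; exact: continuous_measurable_fun.
rewrite -lee_fin -sumEFin; apply: le_trans (vK s a b).
rewrite (eq_bigr (fun y => \int[mu]_(x in A y) (`|v s x| `^ p)%:E)%E); last first.
  move=> y _; rewrite fineK//; apply: integrable_fin_num; first exact: mA.
  by apply: (integrable_pow s (mA y)); exact: Aab.
rewrite -ge0_integral_bigsetU//.
- apply: ge0_subset_integral => //; first by apply: bigsetU_measurable => y _; exact: mA.
    exact: mp.
  by move=> x; rewrite -bigcup_seq => -[y _ /Aab].
- exact: sub_trivIset tA.
- exact: mp.
Unshelve. all: by end_near. Qed.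

(** The integral is the supremum of the level sums of simple functions below it. *)
Lemma weak_limit_integral_pow a b :
  (\int[mu]_(x in `[a, b]) (`|g x| `^ p)%:E <= (K `^ p)%:E)%E.
Proof.
rewrite ge0_integralE//; apply: ub_ereal_sup => _ [h /= hg <-].
rewrite sintegralE fsbig_finite/=; last exact: fimfunP.
pose A (y : R) : set R := (h @^-1` [set y]) `&` `[a, b].
have mA y : measurable (A y).
  have mh : measurable (h @^-1` [set y]) by exact: measurable_sfunP.
  by apply: (measurableI _ _ mh); exact: measurable_itv.
rewrite (eq_big_seq (fun y : R => (y * fine (mu (A y)))%:E)).
  rewrite sumEFin lee_fin; apply: (@weak_limit_level_sum _ A a b) => //.
  - exact: finmap.fset_uniq.
  - by move=> y; rewrite in_fset_set; [case/set_mem => x _ <-|exact: fimfunP].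
  - by move=> y x [].
  - by move=> y z _ _ [x [[/= <- _] [/= ->]]].
  - move=> y x [/= hy xab]; have := hg x; rewrite patchE mem_set//= hy lee_fin//.
move=> y; rewrite in_fset_set; last exact: fimfunP.
move=> /set_mem [z _ hz].
have [->|y0] := eqVneq y 0; first by rewrite mul0e mul0r.
have -> : h @^-1` [set y] = A y.
  apply/seteqP; split=> x; last by case.
  move=> /= hx; split=> //; apply: contrapT => nx; have := hg x.
  rewrite patchE memNset// hx lee_fin => y0'; have y0'' : 0 <= y by rewrite -hx.
  by move: y0; rewrite eq_le y0' y0''.
rewrite EFinM fineK// ge0_fin_numE//; apply: (@sub_itv_measure_lty _ _ a b).
  exact: mA.
by move=> x [].
Qed.

End finite_exponent.

Lemma itv_setT : [set: R] = \bigcup_n `[- n%:R, n%:R]%classic.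
Proof.
apply/seteqP; split=> // x _; exists (Num.truncn `|x|).+1 => //=.
by rewrite in_itv/= -ler_norml; exact/ltW/truncnS_gt.
Qed.

Lemma integral_setT_le (f : R -> R) (c : R) : measurable_fun setT f ->
  (forall x, 0 <= f x) ->
  (forall n, (\int[mu]_(x in `[(- n%:R)%R, (n%:R)%R]) (f x)%:E <= c%:E)%E) ->
  (\int[mu]_x (f x)%:E <= c%:E)%E.
Proof.
move=> mf f0 fc; rewrite itv_setT.
have cvg : (\int[mu]_(x in `[(- n%:R)%R, (n%:R)%R]) (f x)%:E)%E @[n --> \oo] -->
    (\int[mu]_(x in \bigcup_n `[(- n%:R)%R, (n%:R)%R]%classic) (f x)%:E)%E.
  apply: ge0_nondecreasing_set_cvg_integral.
  - move=> n k nk; apply/subsetPset => x /=; rewrite !in_itv/= -!ler_norml => /le_trans; apply.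
    by rewrite ler_nat.
  - by move=> n; exact: measurable_itv.
  - by move=> n; apply/measurable_EFinP; exact: measurable_funS mf.
  - by move=> n x _; rewrite lee_fin.
rewrite -(cvg_lim _ cvg)//; apply: lime_le; first by apply/cvg_ex; eexists; exact: cvg.
by near=> n; exact: fc.
Unshelve. all: by end_near. Qed.

(** On the set where e * g > K, with e = 1 or -1, the integral of e * g is a limit
    of integrals that are at most that of K, so the set has measure 0. *)
Lemma weak_limit_sup_le : (forall s x, `|v s x| <= K) -> {ae mu, forall x, `|g x| <= K}.
Proof.
move=> vK.
have side (e : R) n : `|e| = 1 -> mu.-negligible (`[- n%:R, n%:R] `&` [set x | K < e * g x]).
  move=> e1; set D : set R := _ `&` _; set f := fun x => e * g x.
  have mf : measurable_fun setT f by exact: measurable_funM.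
  have mD : measurable D.
    apply: measurableI; first exact: measurable_itv.
    have := mf measurableT _ (measurable_itv `]K, +oo[); rewrite setTI.
    by congr measurable; apply/seteqP; split=> x /=; rewrite in_itv/= andbT.
  have DD : D `<=` `[- n%:R, n%:R] by exact: subIsetl.
  have ig : mu.-integrable D (EFin \o g) := integrable_g mD DD.
  have fi : mu.-integrable D (EFin \o f) by apply: (integrableZl _ e ig).
  have Ki : mu.-integrable D (EFin \o (fun=> K)).
    by apply: (@continuous_integrable_sub _ (fun=> K) D _ _ _ mD DD) => x; exact: cst_continuous.
  have fK : \int[mu]_(x in D) f x <= \int[mu]_(x in D) K.
    rewrite RintegralZl//.
    apply: (cvg_le_bound (F := U) (a := fun s => e * \int[mu]_(x in D) v s x)).
      by apply: cvgM; [exact: cvg_cst|exact: vg DD].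
    near=> s; have iv : mu.-integrable D (EFin \o v s) := continuous_integrable_sub (@cv s) mD DD.
    rewrite -RintegralZl//; apply: le_Rintegral => //; first by apply: (integrableZl _ e iv).
    by move=> x _; rewrite (le_trans (ler_norm _))// normrM e1 mul1r.
  have {}fK : \int[mu]_(x in D) (f x - K) <= 0 by rewrite RintegralB// subr_le0.
  have f0 : (\int[mu]_(x in D) `|(f x - K)%:E| = 0)%E.
    apply/eqP; rewrite eq_le; apply/andP; split; last by apply: integral_ge0.
    have -> : (\int[mu]_(x in D) `|(f x - K)%:E| = \int[mu]_(x in D) (f x - K)%:E)%E.
      apply: eq_integral => x /set_mem[_ /= Kf].
      by rewrite ger0_norm// subr_ge0 ltW.
    have fin : (\int[mu]_(x in D) (f x - K)%:E)%E \is a fin_num.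
      by apply: integrable_fin_num => //; apply: (integrableB _ fi Ki).
    by rewrite -(fineK fin) lee_fin.
  have mfK : measurable_fun D (fun x => (f x - K)%:E).
    by apply/measurable_EFinP/measurable_funB => //; exact: measurable_funS mf.
  have /(ae_eq_integral_abs mu mD mfK) := f0; apply: negligibleS => x [xD Kf] /= h.
  by have /eqP := h (conj xD Kf); rewrite eqe subr_eq0 => /eqP fxK; move: Kf; rewrite /= -/(f x) fxK ltxx.
have := negligible_bigcup (fun n => negligibleU (side 1 n (normr1 R)) (side (-1) n (normrN1 R))).
apply: negligibleS => x /= /negP; rewrite -ltNge => Kg.
have [n _ xn] : (\bigcup_n `[- n%:R, n%:R]%classic) x by rewrite -itv_setT.
exists n => //; have [g0|g0] := leP 0 (g x); [left|right]; split => //=.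
  by rewrite mul1r -(ger0_norm g0).
by rewrite mulN1r -(ltr0_norm g0).
Unshelve. all: by end_near. Qed.

Lemma weak_limit_Lnorm (p : \bar R) : (1 < p)%E -> (forall s, lp_bounded p K (v s)) ->
  ('N[mu]_p[EFin \o g] <= K%:E)%E.
Proof.
case: p => [p| |//] p1 vK; last first.
  rewrite unlock; case: ifP => _; last by rewrite lee_fin.
  apply/ess_supP; have := weak_limit_sup_le vK.
  by apply: negligibleS => x /= h gK; apply: h; rewrite lee_fin.
rewrite lte_fin in p1; have p0 : 0 < p by lra.
rewrite unlock.
have h : (\int[mu]_x (`|g x| `^ p)%:E <= (K `^ p)%:E)%E.
  apply: integral_setT_le.
  - by apply/measurable_EFinP; exact: measurable_norm_powR.
  - by move=> x; exact: powR_ge0.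
  - by move=> n; exact: weak_limit_integral_pow.
apply: le_trans (_ : ((K `^ p)%:E `^ p^-1 <= _)%E).
  apply: gt0_ler_poweR => //; first by rewrite invr_ge0 ltW.
  - by rewrite in_itv/= leey andbT integral_ge0// => x _; exact: poweR_ge0.
  - by rewrite in_itv/= leey andbT lee_fin powR_ge0.
by rewrite poweR_EFin lee_fin -powRrM mulfV ?gt_eqF// powRr1.
Qed.

End lower_semicontinuity.

(** * Limits of smooth functions bounded in Sobolev norm *)
Section limit_of_extensions.
Context {R : realType}.
Local Notation mu := (@lebesgue_measure R).
Implicit Types (f g h : R -> R) (a b x T e : R) (A : set R) (i k n : nat).

Lemma primitive_is_derive f h : continuous f ->
  (forall a b, a <= b -> \int[mu]_(t in `[a, b]) f t = h b - h a) ->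
  forall x, is_derive x 1 h (f x).
Proof.
move=> cf hf x; pose a := x - 1; have ax : a < x by rewrite /a; lra.
have xu : x < x + 1 by lra.
have [dF FE] := continuous_FTC1_closed xu (continuous_integrable_itv a (x + 1) cf) ax (cf x).
set F := fun y => _ in dF FE.
have hF : \forall y \near x, F y + h a = h y.
  exists 1 => //= y /=; rewrite ltr_norml => /andP[xy1 xy2].
  by rewrite /F hf ?subrK// /a; lra.
have d : is_derive x 1 (fun y => F y + h a) (f x).
  have -> : f x = F^`() x + 0 by rewrite addr0 FE.
  by apply: is_deriveD; exact: derivable_is_derive1.
by apply: near_eq_is_derive hF d.
Qed.

Lemma weak_derive_spec h g : is_weak_derivative h g -> is_weak_derivative h (weak_derive h).
Proof. by move=> hg; exact: (xgetPex (cst 0) (ex_intro _ g hg)). Qed.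

(** Sums of increments over disjoint intervals are dominated by one integral over
    their union, hence uniformly small. *)
Lemma sum_increments_le (v v' : R -> R) T e n (a b : nat -> R) :
  continuous v' -> (forall x, is_derive x 1 v (v' x)) ->
  (forall A a b, measurable A -> A `<=` `[a, b] ->
    \int[mu]_(x in A) `|v' x| <= T * fine (mu A) + e) ->
  (forall i, (i < n)%N -> a i <= b i) ->
  trivIset `I_n (fun i => `]a i, b i[%classic) ->
  \sum_(i < n) `|v (b i) - v (a i)| <= T * \sum_(i < n) (b i - a i) + e.
Proof.
move=> cv' dv equi ab tI.
pose I i := `]a i, b i[%classic.
have mI i : measurable (I i) by exact: measurable_itv.
have tI' : trivIset [set` iota 0 n] I.
  by apply: sub_trivIset tI => i /=; rewrite mem_iota add0n.
pose D : set R := \big[setU/set0]_(i <- iota 0 n) I i.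
have mD : measurable D by apply: bigsetU_measurable => i _.
pose M : R := \sum_(i < n) (`|a i| + `|b i|).
have DM : D `<=` `[- M, M].
  rewrite /D -bigcup_seq => x [i /=]; rewrite mem_iota add0n => /andP[_ il].
  rewrite /I /= !in_itv/= => /andP[ax xb].
  have := @le_term_sum R (fun i => `|a i| + `|b i|) n i (fun=> addr_ge0 (normr_ge0 _) (normr_ge0 _)) il.
  rewrite -/M => h.
  have := ler_norm (b i); have := ler_norm (- a i); rewrite normrN.
  have := normr_ge0 (a i); have := normr_ge0 (b i).
  by move=> *; apply/andP; split; lra.
have muD : fine (mu D) = \sum_(i < n) (b i - a i).
  have one (B : set R) : measurable B -> (\int[mu]_(x in B) (cst 1%E) x = mu B)%E.
    by move=> mB; rewrite integral_cst// mul1e.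
  rewrite -(one D mD) ge0_integral_bigsetU ?iota_uniq// -(big_mkord xpredT (fun i => b i - a i)).
  rewrite (eq_big_seq (fun i => (b i - a i)%:E)); first by rewrite sumEFin/= /index_iota subn0.
  move=> i; rewrite mem_iota add0n => /andP[_ /ab abi].
  rewrite one// /= lebesgue_measure_itv/= lte_fin; case: ltP => [_|ba]; first by rewrite EFinB.
  have -> : b i = a i by apply/eqP; rewrite eq_le ba abi.
  by rewrite subrr.
have mv : measurable_fun setT (fun x => `|v' x|).
  by apply: measurableT_comp => //; exact: continuous_measurable_fun.
apply: le_trans (_ : \int[mu]_(x in D) `|v' x| <= _); last by rewrite -muD; exact: equi mD DM.
have inc i : (i < n)%N -> `|v (b i) - v (a i)| <= \int[mu]_(x in I i) `|v' x|.
  move=> /ab abi; rewrite -(integral_is_derive abi dv cv').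
  have iv : mu.-integrable `[a i, b i] (EFin \o v') by exact: continuous_integrable_itv.
  apply: le_trans (le_normr_Rintegral_itv iv) _.
  have ivn := integrable_norm iv.
  rewrite -Rintegral_itv_bndo_bndc; last by apply: integrableS ivn => //; exact: subset_itv_co_cc.
  rewrite -Rintegral_itv_obnd_cbnd//; apply: integrableS ivn => //; exact: subset_itv_oo_cc.
apply: le_trans (_ : \sum_(i < n) \int[mu]_(x in I i) `|v' x| <= _).
  by apply: ler_sum => i _; exact: inc.
rewrite -(big_mkord xpredT (fun i => \int[mu]_(x in I i) `|v' x|)).
have iD : mu.-integrable D (EFin \o (fun x => `|v' x|)).
  by apply: integrable_norm; exact: continuous_integrable_sub DM.
rewrite -lee_fin -sumEFin [leRHS]fineK; last exact: integrable_fin_num.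
rewrite ge0_integral_bigsetU//; last by apply/measurable_EFinP; exact: measurable_funS mv.
  rewrite /index_iota subn0 le_eqVlt; apply/orP; left; apply/eqP; apply: eq_bigr => i _.
  have iI : mu.-integrable (I i) (EFin \o v').
    by apply: (@continuous_integrable_sub _ v' (I i) (a i) (b i)) => //; exact: subset_itv_oo_cc.
  have iIn : mu.-integrable (I i) (EFin \o (fun x => `|v' x|)) by exact: (integrable_norm iI).
  by rewrite fineK//; apply: integrable_fin_num; [exact: mI|exact: iIn].
by rewrite iota_uniq.
Qed.

(** The derivatives of order k < m of the limit are the limits u k of the
    derivatives: they are primitives of one another by passing to the limit in
    integrals over intervals. The chosen weak derivative agrees almost everywhere
    with the weak limit g of the derivatives of order m, since both have the
    primitive u (m - 1). *)
Lemma sobolev_limit (X : Type) (U : set_system X) (UF : UltraFilter U)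
    (F : X -> R -> R) m (p : \bar R) (K : R) :
  (0 < m)%N -> (1 < p)%E -> 0 <= K -> (forall s, smooth (F s)) ->
  (forall s k, (k <= m)%N -> lp_bounded p K (F s)^`(k)) ->
  exists G : R -> R, [/\ sobolev m p G,
    (sobolev_norm m p G <= (m.+1%:R * K)%:E)%E &
    forall x, F s x @[s --> U] --> G x].
Proof.
move=> m0 p1 K0 sF FK.
pose v k s := (F s)^`(k).
have cv k s : continuous (v k s) by exact: smooth_continuous.
have dv k s x : is_derive x 1 (v k s) (v k.+1 s x) by exact: smooth_is_derive.
have equi k e : (k <= m)%N -> 0 < e -> exists2 T, 0 <= T & forall s A a b,
    measurable A -> A `<=` `[a, b] -> \int[mu]_(x in A) `|v k s x| <= T * fine (mu A) + e.
  move=> km e0; have [T T0 hT] := lp_bounded_equi p1 K0 e0.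
  by exists T => // s A a b mA Aab; apply: hT Aab => //; exact: FK.
have incr k e : (k < m)%N -> 0 < e -> exists2 T, 0 <= T & forall s a b, a <= b ->
    `|v k s b - v k s a| <= T * (b - a) + e.
  move=> km e0; have [T T0 hT] := equi k.+1 e km e0; exists T => // s a b ab.
  by apply: (derivative_increment_le ab (@cv k.+1 s) (dv k s)) => A c d; exact: hT.
have vbnd k : (k < m)%N -> exists M, forall s x, `|v k s x| <= M.
  move=> km; have [T1 T10 h1] := equi k 1 (ltnW km) ltr01.
  have [T2 T20 h2] := incr k 1 km ltr01; pose c := T1 + T2 + 1.
  exists (c + c) => s x.
  apply: (sup_le_integral (@cv k s) (@cv k.+1 s) (dv k s)).
    apply: le_trans (h1 s `[x, x + 1]%classic x (x + 1) (measurable_itv _) (fun=> id)) _.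
    rewrite /= lebesgue_measure_itv/= lte_fin ltrDl ltr01 -EFinB/=.
    have -> : x + 1 - x = 1 by ring.
    by rewrite /c mulr1; lra.
  move=> y /andP[xy yx]; apply: le_trans (h2 s x y xy) _.
  have : T2 * (y - x) <= T2 * 1 by apply: ler_wpM2l => //; lra.
  by rewrite /c; lra.
pose u k x := lim (v k s x @[s --> U]).
have vu k x : (k < m)%N -> v k s x @[s --> U] --> u k x.
  by move=> /vbnd[M hM]; apply: (@ultra_cvg _ _ U UF _ M) => s.
have cu k : (k < m)%N -> continuous (u k).
  move=> km; apply: (@equicontinuous_limit R X U _ (v k) (u k)).
  - by move=> e; exact: incr.
  - by move=> x; exact: vu.
have uint k A a b : (k < m)%N -> measurable A -> A `<=` `[a, b] ->
    \int[mu]_(x in A) v k s x @[s --> U] --> \int[mu]_(x in A) u k x.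
  move=> km; apply: (@equicontinuous_integral_cvg R X U _ (v k) (u k)).
  - exact: cv.
  - by move=> e; exact: incr.
  - by move=> x; exact: vu.
have FTCv k s a b : a <= b -> \int[mu]_(t in `[a, b]) v k.+1 s t = v k s b - v k s a.
  by move=> ab; apply: integral_is_derive => //; exact: cv.
have lim_inc k (g : R -> R) : (k < m)%N ->
    (forall A a b, measurable A -> A `<=` `[a, b] ->
      \int[mu]_(x in A) v k.+1 s x @[s --> U] --> \int[mu]_(x in A) g x) ->
    forall a b, a <= b -> \int[mu]_(t in `[a, b]) g t = u k b - u k a.
  move=> km hg a b ab.
  have l1 := hg `[a, b]%classic a b (measurable_itv _) (fun=> id).
  have l2 : (v k s b - v k s a) @[s --> U] --> u k b - u k a by apply: cvgB; exact: vu.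
  have e : (fun s => \int[mu]_(x in `[a, b]) v k.+1 s x) = (fun s => v k s b - v k s a).
    by apply/funext => s; exact: FTCv.
  by rewrite e in l1; exact: (cvg_unique _ l1 l2).
have du k x : (k.+1 < m)%N -> is_derive x 1 (u k) (u k.+1 x).
  move=> km; apply: (primitive_is_derive (cu _ km)) => a b ab.
  apply: lim_inc ab => [|A c d]; [exact: ltnW|exact: uint].
have uE k : (k < m)%N -> (u 0%N)^`(k) = u k.
  elim: k => [//|k IH] km; rewrite derive1nS IH; last exact: ltnW.
  by apply/funext => x; apply: is_derive1E; exact: du.
have mE : m.-1.+1 = m by rewrite prednK.
have m1m : (m.-1 < m)%N by rewrite mE.
have [g [lg hg]] : exists g : R -> R, locally_integrable setT g /\
    forall A a b, measurable A -> A `<=` `[a, b] ->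
    \int[mu]_(x in A) v m s x @[s --> U] --> \int[mu]_(x in A) g x.
  by apply: local_weak_limit => [|e]; [exact: cv|exact: equi].
have hgu a b : a <= b -> \int[mu]_(t in `[a, b]) g t = u m.-1 b - u m.-1 a.
  by apply: lim_inc => //; rewrite mE.
have wg : is_weak_derivative (u m.-1) g.
  by apply: FTC_weak_derivative => //; exact: cu.
pose wd := weak_derive (u m.-1).
have wwd : is_weak_derivative (u m.-1) wd by exact: weak_derive_spec wg.
have lwd : locally_integrable setT wd by case: wwd.
have gwd : {ae mu, forall x, g x = wd x}.
  apply: primitive_unique_ae => // a b ab; rewrite hgu//.
  by rewrite (weak_derivative_FTC (cu _ m1m) wwd ab).
have hwd A a b : measurable A -> A `<=` `[a, b] ->
    \int[mu]_(x in A) v m s x @[s --> U] --> \int[mu]_(x in A) wd x.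
  move=> mA Aab; have -> : \int[mu]_(x in A) wd x = \int[mu]_(x in A) g x.
    congr fine; apply: ae_eq_integral => //.
    - by apply/measurable_EFinP; apply: measurable_funTS; case: lwd.
    - by apply/measurable_EFinP; apply: measurable_funTS; case: lg.
    by move: gwd; apply: negligibleS => x /= nx gx; apply: nx => _; rewrite gx.
  exact: hg Aab.
pose G := u 0%N.
have sG k : (k <= m)%N -> sobolev_derive m G k = if (k < m)%N then u k else wd.
  by move=> km; rewrite /sobolev_derive; case: ifP => km'; rewrite uE.
have mG k : (k <= m)%N -> measurable_fun setT (sobolev_derive m G k) /\
    ('N[mu]_p[EFin \o sobolev_derive m G k] <= K%:E)%E.
  move=> km; rewrite sG//; case: ifP => km'.
    split; first exact: continuous_measurable_fun (cu _ km').
    apply: (@weak_limit_Lnorm R X U _ (v k) (u k)) => //.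
    - exact: continuous_locally_integrable (cu _ km').
    - by move=> A a b; exact: uint.
    - by move=> s; exact: FK.
  split; first by case: lwd.
  apply: (@weak_limit_Lnorm R X U _ (v m) wd) => //.
  by move=> s; exact: FK.
have GL k : (k <= m)%N -> sobolev_derive m G k \in Lfun mu p.
  move=> /mG[mk nk]; rewrite inE; apply/andP; split; rewrite inE//=.
  by apply: le_lt_trans nk _; rewrite ltry.
exists G; split; last by move=> x; exact: vu.
- split=> //; split.
  + move=> k km x; rewrite uE; last lia.
    by have [] := du k x; first lia.
  + rewrite uE// => e e0; have e2 : 0 < e / 2 by lra.
    have [T T0 hT] := equi m (e / 2) (leqnn m) e2; have T1 : 0 < T + 1 by lra.
    exists (e / 2 / (T + 1)); first by rewrite divr_gt0.
    move=> n a b ab tI sd.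
    have s0 : 0 <= \sum_(i < n) (b i - a i) by apply: sumr_ge0 => i _; rewrite subr_ge0 ab.
    have le : \sum_(i < n) `|u m.-1 (b i) - u m.-1 (a i)| <= T * \sum_(i < n) (b i - a i) + e / 2.
      apply: (cvg_le_bound (F := U) (a := fun s => \sum_(i < n) `|v m.-1 s (b i) - v m.-1 s (a i)|)).
        by apply: cvg_sum_seq => i; apply: cvg_norm; apply: cvgB; exact: vu.
      near=> s; apply: (@sum_increments_le _ (v m s)) => //; first by rewrite -mE.
      by move=> A c d; exact: hT.
    apply: le_lt_trans le _; move: sd; rewrite ltr_pdivlMr//.
    by move: s0; set S := \sum_(i < n) _; nra.
  + by rewrite uE//; exists g.
  + exact: GL.
- rewrite /sobolev_norm; apply: (@le_trans _ _ (\sum_(k < m.+1) K%:E)%E).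
    by apply: lee_sum => k _; apply: (mG k _).2; rewrite -ltnS.
  by rewrite sumEFin lee_fin sumr_const card_ord mulr_natl.
Unshelve. all: by end_near. Qed.

End limit_of_extensions.

(** * Divided differences as averages of derivatives *)
Section averaged_differences.
Context {R : realType}.
Local Notation mu := (@lebesgue_measure R).
Implicit Types (f g h : R -> R) (a b c d t : R) (x : nat -> R) (i j k n : nat).

Lemma absolutely_continuous_continuous h : absolutely_continuous h -> continuous h.
Proof.
move=> ach x; apply/cvgrPdist_lt => /= e e0; have [dl dl0 H] := ach e e0.
exists dl => //= y /= xy.
have sub s t : s <= t -> t - s < dl -> `|h t - h s| < e.
  move=> st tsd; have := H 1%N (fun=> s) (fun=> t) (fun _ _ => st).
  rewrite !big_ord1; apply => // i j /= i1 j1 _.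
  by move: i1 j1; rewrite !ltnS !leqn0 => /eqP -> /eqP ->.
have [xly|ylx] := leP x y.
  by rewrite distrC; apply: sub => //; rewrite ler0_norm in xy; lra.
by apply: sub; [exact: ltW|rewrite gtr0_norm in xy; lra].
Qed.

Lemma Rintegral_itv_mono g a b c d : mu.-integrable `[c, d] (EFin \o g) ->
  (forall t, 0 <= g t) -> c <= a -> b <= d ->
  \int[mu]_(t in `[a, b]) g t <= \int[mu]_(t in `[c, d]) g t.
Proof.
move=> ig g0 ca bd; have abcd : `[a, b]%classic `<=` `[c, d].
  by move=> t /=; rewrite !in_itv/= => /andP[at_ tb]; rewrite (le_trans ca)//= (le_trans tb).
apply: fine_le; [|exact: integrable_fin_num|].
  by apply: integrable_fin_num => //; exact: integrableS ig.
apply: ge0_subset_integral => //; first by case/integrableP: ig.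
by move=> t _; rewrite lee_fin.
Qed.

Variables (m : nat) (F : R -> R).
Hypothesis m0 : (0 < m)%N.
Hypothesis dF : forall k, (k < m.-1)%N -> forall t, derivable F^`(k) t 1.
Hypothesis acF : absolutely_continuous F^`(m.-1).
Hypothesis wF : weakly_derivable F^`(m.-1).

Let v := sobolev_derive m F.

Let vE k : (k < m)%N -> v k = F^`(k).
Proof. by rewrite /v /sobolev_derive => ->. Qed.

Lemma sobolev_derive_continuous k : (k < m)%N -> continuous (v k).
Proof.
move=> km; rewrite vE//; have [km'|] := ltnP k m.-1; last first.
  move=> mk; have -> : k = m.-1 by lia.
  exact: absolutely_continuous_continuous.
by move=> t; apply/differentiable_continuous/derivable1_diffP; exact: dF.
Qed.

Let wd : is_weak_derivative F^`(m.-1) (v m).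
Proof.
by have [g hg] := wF; rewrite /v /sobolev_derive ltnn; exact: weak_derive_spec hg.
Qed.

Lemma sobolev_derive_integrable k a b : (k <= m)%N ->
  mu.-integrable `[a, b] (EFin \o v k).
Proof.
rewrite leq_eqVlt => /predU1P[->|km].
  by apply: locally_integrable_itv; case: wd.
exact/continuous_integrable_itv/sobolev_derive_continuous.
Qed.

Lemma sobolev_derive_increment k a b : (k < m)%N -> a <= b ->
  \int[mu]_(t in `[a, b]) v k.+1 t = v k b - v k a.
Proof.
move=> km ab; have [km'|mk] := ltnP k.+1 m.
  apply: integral_is_derive => //; last exact: sobolev_derive_continuous.
  move=> t; rewrite (vE km) (vE km').
  by rewrite derive1nS; apply: derivable_is_derive1; apply: dF; lia.
have mE : m = k.+1 by lia.
have kE : k = m.-1 by lia.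
rewrite -mE (vE km) {1}kE [in RHS]kE; apply: weak_derivative_FTC => //.
by rewrite -kE -(vE km); exact: sobolev_derive_continuous.
Qed.

Definition total_derivative t : R := \sum_(k < m.+1) `|v k t|.

Local Notation W := total_derivative.

Lemma total_derivative_ge0 t : 0 <= W t. Proof. exact: sumr_ge0. Qed.

Lemma total_derivative_integrable a b : mu.-integrable `[a, b] (EFin \o W).
Proof.
have -> : EFin \o W = (fun t => \sum_(k < m.+1) (`|v k t|)%:E)%E.
  by apply/funext => t; rewrite /= sumEFin.
apply: integrable_sum; first exact: measurable_itv.
move=> k _; have ik : mu.-integrable `[a, b] (EFin \o v k).
  by apply: sobolev_derive_integrable; rewrite -ltnS.
exact: (integrable_norm ik).
Qed.

Let increment_le k a b c d : (k < m)%N -> c <= a -> a <= b -> b <= d ->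
  `|v k b - v k a| <= \int[mu]_(t in `[c, d]) `|v k.+1 t|.
Proof.
move=> km ca ab bd; rewrite -sobolev_derive_increment//.
apply: le_trans (le_normr_Rintegral_itv (sobolev_derive_integrable a b km)) _.
apply: Rintegral_itv_mono => //.
exact: (integrable_norm (sobolev_derive_integrable c d km)).
Qed.

(** On [c, d] the function v k differs from its value at xi by at most the integral
    of `|v k.+1|. *)
Let point_average k c d xi : (k < m)%N -> c < d -> d - c <= 1 -> c <= xi <= d ->
  `|v k xi| * (d - c) <= \int[mu]_(t in `[c, d]) W t.
Proof.
move=> km cd cd1 /andP[cxi xid].
have ik := integrable_norm (sobolev_derive_integrable c d (ltnW km)).
have ik1 := integrable_norm (sobolev_derive_integrable c d km).
set I1 := \int[mu]_(t in `[c, d]) `|v k.+1 t|.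
have I10 : 0 <= I1 by apply: Rintegral_ge0.
apply: (@le_trans _ _ (\int[mu]_(t in `[c, d]) `|v k t| + I1)); last first.
  rewrite -Rintegral_itvD//; apply: le_Rintegral => //.
  - exact: integrable_itvD.
  - exact: total_derivative_integrable.
  move=> t _; rewrite /W (bigD1 (Ordinal (ltnW (km : (k < m)%N) : (k < m.+1)%N)))//=.
  rewrite lerD2l (bigD1 (Ordinal (km : (k.+1 < m.+1)%N)))//=; first by rewrite lerDl sumr_ge0.
  by rewrite -val_eqE/= gtn_eqF.
have : \int[mu]_(t in `[c, d]) (`|v k xi| - I1) <= \int[mu]_(t in `[c, d]) `|v k t|.
  apply: le_Rintegral => //.
  - by apply: continuous_integrable_itv => t; exact: cst_continuous.
  move=> t /=; rewrite in_itv/= => /andP[ct td].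
  have : `|v k xi - v k t| <= I1.
    have [xt|tx] := leP xi t; first by rewrite distrC; exact: increment_le.
    by apply: increment_le => //; exact: ltW.
  by have := lerB_dist (v k xi) (v k t); lra.
rewrite (Rintegral_itv_cst _ (ltW cd)) mulrBl.
have : I1 * (d - c) <= I1 by rewrite ler_piMr.
lra.
Qed.

(** By the mean value theorem a difference of order k < m is a value of the k-th
    derivative up to a factorial, and point_average applies on an interval of
    length at most 1 around it. A difference of order m has no such point: it is
    an increment of the derivative of order m - 1, which the integral over the
    whole window bounds; hence the condition on a and b. *)
Lemma dd_average k x a b : (k <= m)%N -> (forall i j, (i < j <= k)%N -> x i < x j) ->
  a <= x 0%N -> x k <= b -> a < b -> (k = m -> a = x 0%N /\ b = x m) ->
  exists c d, [/\ a <= c, c < d, d <= b, Num.min 1 (b - a) <= d - c &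
    `|divided_difference F k x| * (d - c) <= \int[mu]_(t in `[c, d]) W t].
Proof.
move=> km xS ax xb ab kmE.
have xle i j : (i <= j <= k)%N -> x i <= x j.
  rewrite leq_eqVlt => /andP[/predU1P[->//|ij] jk]; apply/ltW/xS; rewrite ij jk//.
have ddv j z : (j < m)%N -> (forall i l, (i < l <= j)%N -> z i < z l) ->
    exists2 t, z 0%N <= t <= z j & divided_difference F j z = v j t / j`!%:R.
  move=> jm zS; have [i t ij|t tz tE] := @dd_mean_value _ j F z _ zS.
    by apply: dF; lia.
  by exists t => //; rewrite tE vE.
have fact_le j (r : R) : `|r / j`!%:R| <= `|r|.
  rewrite normrM [X in _ * X]ger0_norm ?invr_ge0// ler_piMr// invf_le1 ?ltr0n ?fact_gt0//.
  by rewrite ler1n fact_gt0.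
have [km'|mk] := ltnP k m.
  have [t /andP[xt tx] ->] := ddv k x km' xS.
  pose L := Num.min 1 (b - a); have L0 : 0 < L by rewrite lt_min ltr01 subr_gt0.
  have L1 : L <= 1 by rewrite ge_min lexx.
  have Lab : L <= b - a by rewrite ge_min lexx orbT.
  (* The interval starts or ends at the point t. *)
  suff [c [d [ac db dcL ctd]]] : exists c d, [/\ a <= c, d <= b, d - c = L & c <= t <= d].
    exists c, d; rewrite dcL; split=> //; first lra.
    apply: le_trans (_ : `|v k t| * (d - c) <= _).
      by rewrite dcL; apply: ler_wpM2r (fact_le _ _); exact: ltW.
    by apply: point_average => //; lra.
  have [h|h] := leP (t + L) b; [exists t, (t + L)|exists (b - L), b]; split; lra.
have {mk} km' : k = m by lia.
have [aE bE] := kmE km'; exists a, b; split=> //; first by rewrite ge_min lexx orbT.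
have mE : m = m.-1.+1 by lia.
have mm : (m.-1 < m)%N by lia.
have [t /andP[xt tx] tE] := ddv m.-1 x mm (fun i j ij => xS i j ltac:(lia)).
have [t' /andP[xt' tx'] tE'] := ddv m.-1 (fun j => x j.+1) mm (fun i j ij => xS i.+1 j.+1 ltac:(lia)).
have rec : divided_difference F m x * (b - a) = (v m.-1 t' - v m.-1 t) / m.-1`!%:R.
  have xmE : x m = x m.-1.+1 by rewrite -mE.
  rewrite mulrBl -tE -tE' aE bE xmE {1}mE dd_rec// => i j ij.
  by rewrite lt_eqF// xS//; lia.
rewrite -[X in _ * X]ger0_norm; last by rewrite subr_ge0 ltW.
rewrite -normrM km' rec; apply: le_trans (fact_le _ _) _.
have xm1 : x m.-1 <= b by rewrite bE; apply: xle; lia.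
have x1 : a <= x 1%N by rewrite aE; apply: xle; lia.
have xm : x m.-1.+1 = b by rewrite -mE bE.
have vW : \int[mu]_(u in `[a, b]) `|v m.-1.+1 u| <= \int[mu]_(u in `[a, b]) W u.
  apply: le_Rintegral => //.
  - by rewrite -mE; exact: (integrable_norm (sobolev_derive_integrable a b (leqnn m))).
  - exact: total_derivative_integrable.
  by move=> u _; rewrite -mE /W (@le_term_sum _ (fun k => `|v k u|)).
apply: le_trans vW; have [tt|tt] := leP t t'.
  by apply: increment_le => //; lra.
by rewrite distrC; apply: increment_le => //; lra.
Qed.

End averaged_differences.

(** * The variation of a Sobolev function *)
Section necessity.
Context {R : realType}.
Local Notation mu := (@lebesgue_measure R).
Implicit Types (f g F : R -> R) (E : set R) (x y : nat -> R) (i k n : nat).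

(** A point of the line belongs to at most m of the windows. *)
Lemma sum_shift_diff_le (G : nat -> R) (T : R) m n :
  (forall j, 0 <= G j) -> (forall j, G j <= T) ->
  \sum_(i < n) (G (i + m)%N - G i) <= m%:R * T.
Proof.
move=> G0 GT; elim: m => [|m IH].
  by rewrite mul0r big1// => i _; rewrite addn0 subrr.
have -> : \sum_(i < n) (G (i + m.+1)%N - G i) =
    \sum_(i < n) (G (i + m)%N - G i) + \sum_(i < n) (G (i + m).+1 - G (i + m)%N).
  by rewrite -big_split/=; apply: eq_bigr => i _; rewrite addnS; ring.
rewrite -(big_mkord xpredT (fun i => G (i + m).+1 - G (i + m)%N)).
rewrite (telescope_sumr (fun i => G (i + m)%N) (leq0n n)) add0n -natr1.
have := G0 m; have := GT (n + m)%N; lra.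
Qed.

(** Jensen's inequality for t ^ p, from the tangent at D. *)
Lemma integral_powR_ge g (p D c d : R) : 1 < p -> 0 <= D -> c <= d ->
  (forall t, 0 <= g t) -> mu.-integrable `[c, d] (EFin \o g) ->
  mu.-integrable `[c, d] (EFin \o (fun t => g t `^ p)) ->
  D * (d - c) <= \int[mu]_(t in `[c, d]) g t ->
  (d - c) * D `^ p <= \int[mu]_(t in `[c, d]) g t `^ p.
Proof.
move=> p1 D0 cd g0 ig igp Dg; have p0 : 0 < p by lra.
have pD0 : 0 <= p * D `^ (p - 1) by rewrite mulr_ge0 ?powR_ge0// ltW.
have ic : mu.-integrable `[c, d] (EFin \o (fun=> (p - 1) * D `^ p)).
  by apply: continuous_integrable_itv => t; exact: cst_continuous.
have iz : mu.-integrable `[c, d] (EFin \o (fun t => p * D `^ (p - 1) * g t)).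
  exact: integrable_itvZ.
apply: (@le_trans _ _ (\int[mu]_(t in `[c, d]) (p * D `^ (p - 1) * g t - (p - 1) * D `^ p))); last first.
  apply: le_Rintegral => //; first by apply: (integrableB _ iz ic).
  by move=> t _; exact: powR_tangent.
rewrite Rintegral_itv_sub// Rintegral_itv_cst// RintegralZl//.
have := ler_wpM2l pD0 Dg.
have -> : p * D `^ (p - 1) * (D * (d - c)) = p * D `^ p * (d - c).
  by rewrite -(mulr_powRB1 D0 p0); ring.
by move: (Rintegral _ _ _) => I; lra.
Qed.

(** Also large enough for all p: the p-th roots of the constants that occur are at
    most the constants. *)
Definition necessity_const (m : nat) : R :=
  (2 * m%:R * m.+1%:R) * (m.+1%:R * m.+1%:R).

Variables (m : nat) (F : R -> R).
Hypothesis m0 : (0 < m)%N.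

Let v := sobolev_derive m F.
Let W := total_derivative m F.

Lemma divided_difference_extends E f k x : extends E f F ->
  (forall i, (i <= k)%N -> E (x i)) ->
  divided_difference f k x = divided_difference F k x.
Proof. by move=> fF xE; apply: eq_bigr => i _; rewrite fF//; apply: xE; exact: leq_ord. Qed.

Section finite_exponent.
Variables (p N : R).
Hypothesis p1 : 1 < p.
Hypothesis SF : sobolev m p%:E F.
Hypothesis FN : (sobolev_norm m p%:E F <= N%:E)%E.

Let p0 : 0 < p. Proof. exact: lt_trans p1. Qed.

Let mv k : (k <= m)%N -> measurable_fun setT (v k).
Proof. by move=> /(SF.2 k); rewrite inE => /andP[]; rewrite inE. Qed.

Let N0 : 0 <= N.
Proof.
by rewrite -lee_fin; apply: le_trans FN; apply: sume_ge0 => k _; exact: Lnorm_ge0.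
Qed.

Let integral_v k : (k <= m)%N -> (\int[mu]_t (`|v k t| `^ p)%:E <= (N `^ p)%:E)%E.
Proof.
move=> km; have vN : ('N[mu]_p%:E[EFin \o v k] <= N%:E)%E.
  apply: le_trans FN; rewrite /sobolev_norm (bigD1 (Ordinal (km : (k < m.+1)%N)))//=.
  by rewrite leeDl// sume_ge0// => i _; exact: Lnorm_ge0.
have -> : (\int[mu]_t (`|v k t| `^ p)%:E = 'N[mu]_p%:E[EFin \o v k] `^ p)%E.
  by rewrite powR_Lnorm// gt_eqF.
rewrite -poweR_EFin; apply: gt0_ler_poweR => //; first exact: ltW.
- by rewrite in_itv/= leey andbT Lnorm_ge0.
- by rewrite in_itv/= leey andbT lee_fin.
Qed.

Let T : R := m.+1%:R `^ p * m.+1%:R * N `^ p.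

Let T0 : 0 <= T. Proof. by rewrite !mulr_ge0 ?powR_ge0. Qed.

Let mW : measurable_fun setT W.
Proof.
apply: measurable_sum => k; apply: measurableT_comp => //.
by apply: mv; rewrite -ltnS.
Qed.

Let mWp (A : set R) : measurable_fun A (fun t => (W t `^ p)%:E).
Proof.
apply/measurable_EFinP/(@measurable_funS _ _ _ _ setT) => //.
exact: (measurableT_comp (measurable_powR p)).
Qed.

Let W0 t : 0 <= W t. Proof. exact: total_derivative_ge0. Qed.

Let integral_W (A : set R) : measurable A -> (\int[mu]_(t in A) (W t `^ p)%:E <= T%:E)%E.
Proof.
move=> mA; apply: le_trans (_ : \int[mu]_t (W t `^ p)%:E <= _)%E.
  apply: ge0_subset_integral => //; first exact: mWp.
  by move=> t _; rewrite lee_fin powR_ge0.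
apply: (@le_trans _ _ (\int[mu]_t ((m.+1%:R `^ p)%:E * \sum_(k < m.+1) (`|v k t| `^ p)%:E))%E).
  apply: ge0_le_integral => //.
  - by move=> t _; rewrite lee_fin powR_ge0.
  - exact: mWp.
  - apply: emeasurable_funM => //; apply: emeasurable_sum => k.
    by apply: measurable_norm_powR; apply: mv; rewrite -ltnS.
  - move=> t _; rewrite sumEFin -EFinM lee_fin.
    exact: (powR_sum_le m.+1 p0 (F := fun k => `|v k t|)).
have mk (k : 'I_m.+1) : measurable_fun setT (fun t => (`|v k t| `^ p)%:E).
  by apply: measurable_norm_powR; apply: mv; rewrite -ltnS.
rewrite ge0_integralZl//; last 2 first.
- by apply: emeasurable_sum => k; exact: mk.
- by move=> t _; apply: sume_ge0 => k _; rewrite lee_fin powR_ge0.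
rewrite ge0_integral_sum//.
rewrite /T -mulrA EFinM; apply: lee_wpmul2l; first by rewrite lee_fin powR_ge0.
apply: (@le_trans _ _ (\sum_(k < m.+1) (N `^ p)%:E)%E).
  by apply: lee_sum => k _; apply: integral_v; rewrite -ltnS.
by rewrite sumEFin lee_fin sumr_const card_ord mulr_natl.
Qed.

Let integrable_Wp a b : mu.-integrable `[a, b] (EFin \o (fun t => W t `^ p)).
Proof.
apply/integrableP; split; first exact: mWp.
under eq_integral do rewrite /= ger0_norm ?powR_ge0//.
by apply: le_lt_trans (integral_W (measurable_itv _)) _; rewrite ltry.
Qed.

Let Rintegral_W a b : 0 <= \int[mu]_(t in `[a, b]) W t `^ p /\
  \int[mu]_(t in `[a, b]) W t `^ p <= T.
Proof.
split; first by apply: Rintegral_ge0 => t _; exact: powR_ge0.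
by apply: Rintegral_ge0_le; [move=> t; exact: powR_ge0|exact: integral_W].
Qed.

Let dd_le k x a b : (k <= m)%N -> (forall i j, (i < j <= k)%N -> x i < x j) ->
  a <= x 0%N -> x k <= b -> a < b -> (k = m -> a = x 0%N /\ b = x m) ->
  Num.min 1 (b - a) * `|divided_difference F k x| `^ p <=
  \int[mu]_(t in `[a, b]) W t `^ p.
Proof.
move=> km xS ax xb ab kmE; case: SF => -[dF acF wF _] _.
have [c [d [ac cd db dmin ddW]]] := dd_average m0 dF acF wF km xS ax xb ab kmE.
apply: (@le_trans _ _ ((d - c) * `|divided_difference F k x| `^ p)).
  by apply: ler_wpM2r => //; exact: powR_ge0.
apply: (@le_trans _ _ (\int[mu]_(t in `[c, d]) W t `^ p)); last first.
  by apply: Rintegral_itv_mono => // t; exact: powR_ge0.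
apply: integral_powR_ge => //; first exact: ltW.
exact: total_derivative_integrable.
Qed.

(** The windows with i + m <= n lie in [x i, x (i + m)], and their integrals are
    summed by sum_shift_diff_le. The others are at most m for each order, and
    since their weight is 1 they are extended to the right by 1. *)
Lemma variation_real_le n x : (m <= n)%N -> (forall i j, (i < j <= n)%N -> x i < x j) ->
  \sum_(k < m.+1) \sum_(i < (n - k).+1)
    min_weight m n x i * `|consecutive_dd F x k i| `^ p <=
  2 * m%:R * m.+1%:R * T.
Proof.
move=> mn xS.
have xle i j : (i <= j <= n)%N -> x i <= x j.
  by rewrite leq_eqVlt => /andP[/predU1P[->//|ij] jn]; apply/ltW/xS; rewrite ij.
pose G j := \int[mu]_(t in `[x 0%N, x j]) W t `^ p.
suff row k : (k <= m)%N -> \sum_(i < (n - k).+1)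
    min_weight m n x i * `|consecutive_dd F x k i| `^ p <= 2 * m%:R * T.
  apply: (@le_trans _ _ (\sum_(k < m.+1) (2 * m%:R * T))).
    by apply: ler_sum => k _; apply: row; rewrite -ltnS.
  by rewrite sumr_const card_ord -[leLHS]mulr_natl; lra.
move=> km.
have xSi i : forall j l, (j < l <= k)%N -> (i + k <= n)%N -> x (i + j)%N < x (i + l)%N.
  by move=> j l jl ik; apply: xS; lia.
rewrite -(big_mkord xpredT (fun i => min_weight m n x i * `|consecutive_dd F x k i| `^ p)).
have cut : ((n - m).+1 <= (n - k).+1)%N by lia.
rewrite (big_cat_nat (leq0n _) cut)/=.
have h1 : \sum_(0 <= i < (n - m).+1) min_weight m n x i * `|consecutive_dd F x k i| `^ p
    <= m%:R * T.
  apply: le_trans (@sum_shift_diff_le G T m (n - m).+1 _ _); last 2 first.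
  - by move=> j; case: (Rintegral_W (x 0%N) (x j)).
  - by move=> j; case: (Rintegral_W (x 0%N) (x j)).
  rewrite big_mkord; apply: ler_sum => i _.
  have im : (i + m <= n)%N by have := ltn_ord i; lia.
  rewrite /min_weight im /consecutive_dd.
  have -> : G (i + m)%N - G i = \int[mu]_(t in `[x i, x (i + m)%N]) W t `^ p.
    rewrite /G (@Rintegral_itv_cat _ (fun t => W t `^ p) (x 0%N) (x i) (x (i + m)%N)) //.
    + by rewrite addrC addKr.
    + by apply: xle; lia.
    + by apply: xle; lia.
  apply: dd_le => //.
  - by move=> j l jl; apply: xSi => //; lia.
  - by rewrite addn0.
  - by apply: xle; lia.
  - by apply: xS; lia.
  - by rewrite addn0.
have h2 : \sum_((n - m).+1 <= i < (n - k).+1) min_weight m n x i * `|consecutive_dd F x k i| `^ p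
    <= m%:R * T.
  apply: (@le_trans _ _ (\sum_((n - m).+1 <= i < (n - k).+1) T)); last first.
    rewrite big_const_nat iter_addr_0 -[leLHS]mulr_natl; apply: ler_wpM2r => //.
    by rewrite ler_nat; lia.
  rewrite big_nat [leRHS]big_nat; apply: ler_sum => i ink.
  rewrite /min_weight ifF; last by lia.
  have := @dd_le k (fun j => x (i + j)%N) (x i) (x (i + k)%N + 1) km.
  have x0 : x i <= x (i + k)%N by apply: xle; lia.
  have -> : Num.min 1 (x (i + k)%N + 1 - x i) = 1 by apply: min_idPl; lra.
  have [_ tT] := Rintegral_W (x i) (x (i + k)%N + 1).
  move=> h; apply: le_trans tT; apply: h.
  - by move=> j l jl; apply: xSi => //; lia.
  - by rewrite addn0.
  - by lra.
  - by lra.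
  - by move=> kmE; lia.
lra.
Qed.

Lemma variation_sum_root_le n x : (m <= n)%N -> (forall i j, (i < j <= n)%N -> x i < x j) ->
  (variation_sum m p F n x `^ p^-1 <= (necessity_const m * N)%:E)%E.
Proof.
move=> mn xS; rewrite variation_sumE poweR_EFin lee_fin.
set S := \sum_(k < _) _.
have S0 : 0 <= S.
  apply: sumr_ge0 => k _; apply: sumr_ge0 => i _; rewrite mulr_ge0 ?powR_ge0// /min_weight.
  case: ifP => // im; rewrite le_min ler01 subr_ge0/=.
  by have := leq_addr m i; rewrite leq_eqVlt => /predU1P[<-//|ii]; apply/ltW/xS; rewrite ii.
have m1 : (1:R) <= m%:R by rewrite ler1n.
have mS1 : (1:R) <= m.+1%:R by rewrite ler1n.
have c1 : 1 <= 2 * m%:R * m.+1%:R :> R by rewrite mulr_ege1//; lra.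
have c2 : 1 <= 2 * m%:R * m.+1%:R * m.+1%:R :> R by rewrite mulr_ege1.
have nc0 : 0 <= necessity_const m * N.
  by rewrite mulr_ge0// /necessity_const !mulr_ge0.
have : S <= (necessity_const m * N) `^ p.
  apply: le_trans (variation_real_le mn xS) _.
  have -> : necessity_const m * N = (2 * m%:R * m.+1%:R * m.+1%:R) * m.+1%:R * N.
    by rewrite /necessity_const; ring.
  rewrite !powRM ?mulr_ge0// -!powRM ?mulr_ge0// (_ : 2 * m%:R * m.+1%:R * T =
    (2 * m%:R * m.+1%:R * m.+1%:R) * m.+1%:R `^ p * N `^ p); last by rewrite /T; ring.
  rewrite !powRM ?mulr_ge0//; apply: ler_wpM2r; first exact: powR_ge0.
  apply: ler_wpM2r; first exact: powR_ge0.
  rewrite -!powRM ?mulr_ge0//.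
  by rewrite -[leLHS]powRr1 ?(le_trans ler01)// ler_powR// ltW.
move=> h; have -> : necessity_const m * N = ((necessity_const m * N) `^ p) `^ p^-1.
  by rewrite -powRrM mulfV ?gt_eqF// powRr1.
by apply: ge0_ler_powR; rewrite ?nnegrE ?invr_ge0 ?powR_ge0// ltW.
Qed.

End finite_exponent.

(** The average of W over any interval is at most its essential supremum. *)
Lemma dd_sup_le (N : R) k x : sobolev m +oo F -> (sobolev_norm m +oo F <= N%:E)%E ->
  (k <= m)%N -> (forall i j, (i < j <= k)%N -> x i < x j) ->
  `|divided_difference F k x| <= N.
Proof.
move=> [[dF acF wF _] LF] FN km xS.
have muT : (0 < mu [set: R])%E by rewrite -set_itvNyy /= lebesgue_measure_itv/= ltry.
have N0 : 0 <= N.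
  by rewrite -lee_fin; apply: le_trans FN; apply: sume_ge0 => i _; exact: Lnorm_ge0.
have mv j : (j <= m)%N -> measurable_fun setT (v j).
  by move=> /(LF j); rewrite inE => /andP[]; rewrite inE.
have vle j : {ae mu, forall t, (`|v j t|%:E <= 'N[mu]_+oo[EFin \o v j])%E}.
  by rewrite unlock muT; exact: ess_sup_ge.
have sum_le n : {ae mu, forall t,
    (\sum_(j < n) `|v j t|%:E <= \sum_(j < n) 'N[mu]_+oo[EFin \o v j])%E}.
  elim: n => [|n IH]; first by apply: aeW => t; rewrite !big_ord0.
  apply: (negligibleS _ (negligibleU IH (vle n))) => t /= nt.
  apply: contrapT => /not_orP[/contrapT h1 /contrapT h2]; apply: nt.
  by rewrite !big_ord_recr/=; exact: leeD.
have Wle : {ae mu, forall t, W t <= N}.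
  apply: (negligibleS _ (sum_le m.+1)) => t /= nt h; apply: nt.
  by rewrite -lee_fin /W /total_derivative -sumEFin; apply: le_trans h _; exact: FN.
(* For k < m any interval that contains the points will do. *)
pose b := if k == m then x m else x k + 1.
have xle : x 0%N <= x k.
  by have [->//|k0] := posnP k; apply/ltW/xS; rewrite k0 leqnn.
have xkb : x k <= b by rewrite /b; case: eqP => [->|_]; lra.
have ab : x 0%N < b.
  by rewrite /b; case: eqP => [km'|_]; [apply: xS; rewrite m0 km' leqnn|lra].
have kmE : k = m -> x 0%N = x 0%N /\ b = x m by move=> km'; rewrite /b km' eqxx.
have [c [d [_ cd _ _ h]]] := dd_average m0 dF acF wF km xS (lexx _) xkb ab kmE.
rewrite -(ler_pM2r (_ : 0 < d - c)) ?subr_gt0//; apply: le_trans h _.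
apply: Rintegral_ge0_le; first by move=> t; exact: total_derivative_ge0.
apply: (@le_trans _ _ (\int[mu]_(t in `[c, d]) (cst N%:E) t)%E).
  apply: ae_ge0_le_integral => //.
  - by move=> t _; rewrite lee_fin; exact: total_derivative_ge0.
  - apply/measurable_EFinP/measurable_funTS; apply: measurable_sum => j.
    by apply: measurableT_comp => //; apply: mv; rewrite -ltnS.
  - by apply: (negligibleS _ Wle) => t /= nt h'; apply: nt => _; rewrite lee_fin.
by rewrite integral_cst//= lebesgue_measure_itv/= lte_fin cd -EFinB -EFinM.
Qed.

Lemma variation_le_sobolev_norm (p : \bar R) E f : (1 < p)%E -> sobolev m p F ->
  extends E f F ->
  (variation_functional m p E f <= (necessity_const m)%:E * sobolev_norm m p F)%E.
Proof.
move=> p1 SF fF.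
have nc1 : 1 <= necessity_const m.
  have m1 : (1:R) <= m%:R by rewrite ler1n.
  have mS1 : (1:R) <= m.+1%:R by rewrite ler1n.
  by rewrite /necessity_const; apply: mulr_ege1; apply: mulr_ege1 => //; lra.
have n0 : (0 <= sobolev_norm m p F)%E by apply: sume_ge0 => k _; exact: Lnorm_ge0.
have nf : sobolev_norm m p F \is a fin_num.
  rewrite ge0_fin_numE//; apply: lte_sum_pinfty => k _.
  have := SF.2 k; rewrite -ltnS => /(_ (ltn_ord k)).
  by rewrite inE => /andP[_]; rewrite inE.
have FN : (sobolev_norm m p F <= (fine (sobolev_norm m p F))%:E)%E by rewrite fineK.
rewrite -(fineK nf) -EFinM; case: p p1 SF n0 nf FN => [p| |//] p1 SF n0 nf FN.
  apply: ub_ereal_sup => _ [n [x [mn [xS xE] ->]]]; rewrite lte_fin in p1.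
  have -> : variation_sum m p f n x = variation_sum m p F n x.
    rewrite /variation_sum; apply: eq_bigr => k _; apply: eq_bigr => i _.
    rewrite (@divided_difference_extends E f k _ fF)// => j jk; apply: xE.
    by have := ltn_ord i; have := ltn_ord k; lia.
  exact: variation_sum_root_le.
apply: ub_ereal_sup => _ [k [y [km [yS yE] ->]]]; rewrite lee_fin.
rewrite (@divided_difference_extends E f k _ fF)//.
apply: le_trans (dd_sup_le SF FN km yS) _.
by rewrite ler_peMl// fine_ge0.
Qed.

End necessity.

(** * The ultrafilter of finite subsets *)
Section finite_subsets.
Context {R : realType} (E : set R) (m : nat).
Implicit Types (s t : seq R).

Definition interpolation_set s := [/\ uniq s, forall x, x \in s -> E x & (m < size s)%N].

Hypothesis Em : (`I_m.+1 #<= E)%card.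

Lemma exists_interpolation_set t : (forall x, x \in t -> E x) ->
  exists2 s, interpolation_set s & {subset t <= s}.
Proof.
move=> tE; have /pcard_leP[g] := Em.
pose s0 := map g (iota 0 m.+1).
have s0E x : x \in s0 -> E x.
  move=> /mapP[i]; rewrite mem_iota add0n => /andP[_ im] ->.
  by apply: (@funS _ _ _ _ g).
have us0 : uniq s0.
  rewrite map_inj_in_uniq ?iota_uniq// => i j; rewrite !mem_iota !add0n => im jm.
  by apply: (@inj _ _ _ g); rewrite inE.
exists (undup (s0 ++ t)) => [|x xt]; last by rewrite mem_undup mem_cat xt orbT.
split; [exact: undup_uniq| |].
  by move=> x; rewrite mem_undup mem_cat => /orP[/s0E|/tE].
rewrite -[m.+1](size_iota 0) -(size_map g); apply: uniq_leq_size => // x xs.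
by rewrite mem_undup mem_cat xs.
Qed.

Lemma exists_increasing_in : exists x, increasing_in E m x.
Proof.
have [s [us sE sm] _] := @exists_interpolation_set [::] (fun x => ltac:(by [])).
have ss : sorted <%O (sort <=%O s) by rewrite sort_lt_sorted.
exists (nth 0 (sort <=%O s)); split=> [i j /andP[ij jm]|i im].
  have js : (j < size s)%N by exact: leq_ltn_trans sm.
  by rewrite (lt_sorted_ltn_nth 0 ss) ?inE ?size_sort// (ltn_trans ij).
by apply: sE; rewrite -(mem_sort <=%O); apply: mem_nth; rewrite size_sort (leq_ltn_trans im).
Qed.

Lemma variation_functional_ge0 (p : \bar R) f : (1 < p)%E ->
  (0 <= variation_functional m p E f)%E.
Proof.
have [x xE] := exists_increasing_in.
case: p => [p| |//] p1.
  apply: (@le_trans _ _ (variation_sum m p f m x `^ p^-1)%E); first exact: poweR_ge0.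
  by apply: ereal_sup_ubound; exists m, x.
apply: (@le_trans _ _ (`|divided_difference f m x|%:E)); first by rewrite lee_fin.
by apply: ereal_sup_ubound; exists m, x.
Qed.

(** The finite subsets of E that contain a given one generate a filter, because the
    union of two finite subsets is one. *)
Lemma interpolation_ultrafilter : exists U : set_system (seq R),
  [/\ UltraFilter U, U interpolation_set & forall x, E x -> U [set s : seq R | x \in s]].
Proof.
pose B : set_system (seq R) := [set P | exists2 t : seq R, forall x, x \in t -> E x &
  forall s, interpolation_set s -> {subset t <= s} -> P s].
have FB : ProperFilter B.
  split.
    move=> [t tE]; have [s gs ts] := exists_interpolation_set tE.
    by move=> /(_ s gs ts).
  split.
  - by exists [::].
  - move=> P Q [t tE tP] [t' t'E t'Q]; exists (t ++ t') => [x|s gs ts].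
      by rewrite mem_cat => /orP[/tE|/t'E].
    split; [apply: tP => // x xt|apply: t'Q => // x xt]; apply: ts; rewrite mem_cat xt//.
    by rewrite orbT.
  - by move=> P Q PQ [t tE tP]; exists t => // s gs ts; apply/PQ/tP.
have [U [UU BU]] := ultraFilterLemma FB.
exists U; split=> // [|x xE]; apply: BU; first by exists [::].
exists [:: x] => [y|s gs ts]; first by rewrite inE => /eqP ->.
by apply: ts; rewrite inE.
Qed.

End finite_subsets.

(** * The trace theorem *)
Section sufficiency.
Context {R : realType}.

(** At a point x of E the extensions of the finite sets that contain x, which are
    eventual along the ultrafilter, all have the value f x. *)
Lemma sobolev_extension m : (0 < m)%N -> exists2 C : R, 1 <= C &
  forall (p : \bar R) (E : set R) (f : R -> R), (1 < p)%E -> (`I_m.+1 #<= E)%card ->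
  (variation_functional m p E f < +oo)%E -> exists F, [/\ sobolev m p F,
    extends E f F & (sobolev_norm m p F <= C%:E * variation_functional m p E f)%E].
Proof.
move=> m0; have [C C1 HC] := @finite_extension R m m0.
have mS1 : (1:R) <= m.+1%:R by rewrite ler1n.
exists (m.+1%:R * C); first exact: mulr_ege1.
move=> p E f p1 Em Wy; have W0 := variation_functional_ge0 Em f p1.
have Wf : variation_functional m p E f \is a fin_num by rewrite ge0_fin_numE.
pose w := fine (variation_functional m p E f).
have w0 : 0 <= w by rewrite fine_ge0.
have Ww : (variation_functional m p E f <= w%:E)%E by rewrite fineK.
have Cw0 : 0 <= C * w by rewrite mulr_ge0// (le_trans ler01).
have /choice[F HF] s : exists F, [/\ smooth F,
    forall k, (k <= m)%N -> lp_bounded p (C * w) F^`(k) &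
    interpolation_set E m s -> forall x, x \in s -> F x = f x].
  have [[us sE sm]|ns] := pselect (interpolation_set E m s).
    by have [F [sF Ff Fb]] := HC p w E f s p1 w0 Ww us sE sm; exists F.
  (* A value for the sets that do not count in the limit. *)
  exists (fun=> 0); split=> // [|k km]; first exact: smooth_cst.
  have -> : (fun=> 0 : R)^`(k) = (fun=> 0 : R).
    by case: k {km} => // k; apply/funext => x; exact: derive1n_cst.
  exact: lp_bounded0.
have [U [UU Ugood Ux]] := interpolation_ultrafilter Em.
have sF s : smooth (F s) by case: (HF s).
have FK s k : (k <= m)%N -> lp_bounded p (C * w) (F s)^`(k).
  by move=> km; case: (HF s) => _ /(_ k km).
have [G [SG NG FG]] := sobolev_limit UU m0 p1 Cw0 sF FK.
exists G; split=> // [x xE|]; last first.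
  by apply: le_trans NG _; rewrite -(fineK Wf) -EFinM mulrA.
apply: (cvg_unique _ (FG x)) => //; apply: cvg_near_cst.
apply: filterS2 Ugood (Ux x xE) => s gs xs.
by case: (HF s) => _ _ /(_ gs x xs).
Qed.

End sufficiency.

Theorem theorem1p2 (R : realType) (m : nat) (hm : (0 < m)%N) :
  exists2 C : R, 1 <= C &
  forall (p : \bar R) (E : set R) (f : R -> R),
    (1 < p)%E -> closed E -> (`I_m.+1 #<= E)%card ->
    ((exists2 F : R -> R, sobolev m p F & extends E f F) <->
       (variation_functional m p E f < +oo)%E) /\
    (C^-1%:E * variation_functional m p E f <= trace_norm m p E f)%E /\
    (trace_norm m p E f <= C%:E * variation_functional m p E f)%E.
Proof.
have [C1 C11 suff_ext] := @sobolev_extension R m hm.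
have C20 : 0 <= @necessity_const R m by rewrite /necessity_const !mulr_ge0.
(* Larger than both constants, so that it serves both inequalities. *)
pose C := C1 + necessity_const m.
have C1C : C1 <= C by rewrite /C; lra.
have C2C : necessity_const m <= C by rewrite /C; lra.
have C0 : 0 < C by rewrite /C; lra.
exists C; first by rewrite /C; lra.
move=> p E f p1 _ Em.
have W0 := variation_functional_ge0 Em f p1.
have norm_ge F : sobolev m p F -> extends E f F ->
    (variation_functional m p E f <= C%:E * sobolev_norm m p F)%E.
  move=> SF fF; apply: le_trans (variation_le_sobolev_norm hm p1 SF fF) _.
  by apply: lee_wpmul2r; [apply: sume_ge0 => k _; exact: Lnorm_ge0|rewrite lee_fin].
split; first split.
- move=> [F SF fF]; apply: le_lt_trans (norm_ge F SF fF) _.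
  apply: lte_mul_pinfty; [by rewrite lee_fin ltW|by []|].
  apply: lte_sum_pinfty => k _; have := SF.2 k; rewrite -ltnS => /(_ (ltn_ord k)).
  by rewrite inE => /andP[_]; rewrite inE.
- by move=> /(suff_ext p E f p1 Em)[F [SF fF _]]; exists F.
split.
  apply: le_ereal_inf_tmp => _ [F [SF fF] <-]; rewrite lee_pdivrMl//.
  exact: norm_ge.
have [Wy|] := ltP (variation_functional m p E f) +oo%E; last first.
  by rewrite leye_eq => /eqP ->; rewrite gt0_muley ?lte_fin// leey.
have [F [SF fF NF]] := suff_ext p E f p1 Em Wy.
apply: (@le_trans _ _ (sobolev_norm m p F)).
  by apply: ereal_inf_lbound; exists F.
by apply: le_trans NF _; apply: lee_wpmul2r; rewrite ?lee_fin.
Qed.
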